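(* Let $n\ge 3$, let $V^{n-1}$ be a lightlike hypersurface of the pseudoconformal space $C^n_1$ of Lorentzian signature, and let $\varphi: C^n_1\to Q^n_1\subset P^{n+1}$ be the Darboux mapping. Then the submanifold $U^{n-1}=\varphi(V^{n-1})$ of $P^{n+1}$ corresponding to $V^{n-1}$ is a ruled tangentially degenerate submanifold of rank $n-2$. Each of its rectilinear generators carries $n-2$ real singular points, if each of them is counted as many times as its multiplicity. These points are the images under $\varphi$ of the singular points of the lightlike hypersurface $V^{n-1}$.
   Context: Space and Darboux mapping. Let $R^n_1$ be $\mathbb{R}^n$ with a quadratic form $g=g_{rs}x^rx^s$ ($r,s=1,\dots,n$) of signature $(n-1,1)$. The pseudoconformal space $C^n_1$ is its conformal compactification, obtained by adding a point at infinity and the light cone with vertex at that point. Equip $\mathbb{R}^{n+2}$ (coordinates $x^0,\dots,x^{n+1}$) with the scalar product $(\cdot,\cdot)$ of signature $(n,2)$ whose quadratic form is $g_{rs}x^rx^s-2x^0x^{n+1}$. Let $Q^n_1\subset P^{n+1}=P(\mathbb{R}^{n+2})$ be the hyperquadric $g_{rs}x^rx^s-2x^0x^{n+1}=0$ (the Darboux hyperquadric). The Darboux mapping $\varphi:C^n_1\to Q^n_1$ is the bijective conformal identification that sends $x\in R^n_1$ to $[1:x:\tfrac12 g(x,x)]$ and extends to the ideal points. It maps the isotropic (light) cones $C_x$ of $C^n_1$ to the asymptotic cones of $Q^n_1$ (the intersections of $Q^n_1$ with its tangent hyperplanes), and it maps the isotropic lines (lines of light propagation) of $C^n_1$ to the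 rectilinear generators of $Q^n_1$, i.e. the projective lines of $P^{n+1}$ contained in $Q^n_1$. Lightlike hypersurface. A hypersurface $V^{n-1}\subset C^n_1$ is a smooth, connected and simply connected submanifold of dimension $n-1$. It is lightlike (isotropic) if at each of its points $x$ the tangent hyperplane $T_x(V^{n-1})$ is tangent to the isotropic cone $C_x$; equivalently, the restriction of the conformal metric to $V^{n-1}$ is everywhere degenerate, of signature $(n-2,0)$ (positive semidefinite of rank $n-2$). Ruled, tangentially degenerate. An $(n-1)$-dimensional submanifold $U$ of $P^{n+1}$ is ruled and tangentially degenerate of rank $n-2$ if it is swept out by an $(n-2)$-parameter family of straight lines $\ell(u)$ (its rectilinear generators) such that the embedded tangent $(n-1)$-plane of $U$ is the same projective subspace $T(u)$ at all regular points of $\ell(u)$, and $T(u)$ depends on exactly $n-2$ parameters (the Gauss map has rank $n-2$). As is usual in this local theory, $V^{n-1}$ and $U^{n-1}$ are considered prolonged along the full straight lines: the generator through a point of $U^{n-1}$ means the entire projective line. Singular points and multiplicity. Locally write $\ell(u)=P(\mathrm{span}(a(u),b(u)))$ with smooth $a,b$ with values in $\mathbb{R}^{n+2}$, where $u$ ranges over an open set of $\mathbb{R}^{n-2}$. Let $\hat\ell(u)=\mathrm{span}(a(u),b(u))$ and let $\hat T(u)\subset\mathbb{R}^{n+2}$ be the $n$-dimensional linear subspace with $P(\hat T(u))=T(u)$. The point $[s\,a(u)+t\,b(u)]$ of $\ell(u)$ is singular if the parametrization $(u,[s:t])\mapsto[s\,a(u)+t\,b(u)]$ is not an immersion there (the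 tangent subspace has dimension less than $n-1$). Equivalently, the linear map $D_u(s,t):\mathbb{R}^{n-2}\to \hat T(u)/\hat\ell(u)$, $v\mapsto s\,da(v)+t\,db(v) \bmod \hat\ell(u)$, is not invertible. Its determinant is a homogeneous polynomial of degree $n-2$ in $(s,t)$, and the multiplicity of a singular point is its multiplicity as a zero $[s:t]$ of this polynomial. Singular points of the lightlike hypersurface $V^{n-1}$ are defined in the same way: they are the points of its isotropic lines at which the parametrization of $V^{n-1}$ by its $(n-2)$-parameter family of isotropic lines fails to be an immersion into $C^n_1$. *)

(* Defs.v *)
From HB Require Import structures.
From mathcomp Require Import all_boot all_order all_algebra.
From mathcomp Require Import all_classical all_reals all_analysis.
From mathcomp Require Import ring.
Import Order.TTheory GRing.Theory Num.Theory.
Import numFieldNormedType.Exports.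
Set Implicit Arguments.
Unset Strict Implicit.
Unset Printing Implicit Defensive.
Local Open Scope classical_set_scope.
Local Open Scope ring_scope.

Section Smooth.
Context {R : realType}.

Fixpoint Ck (k d : nat) (W : normedModType R) (A : set 'rV[R]_d)
    (f : 'rV[R]_d -> W) : Prop :=
  if k is k'.+1 then
    (forall x, A x -> differentiable f x) /\
    (forall i, Ck k' A (fun x => 'D_(delta_mx 0 i) f x))
  else forall x, A x -> {for x, continuous f}.

Definition smooth_on (d : nat) (W : normedModType R) (A : set 'rV[R]_d)
  (f : 'rV[R]_d -> W) : Prop := forall k, Ck k A f.

(* [F] restricted to the open set [W] is injective and maps open sets to
   relatively open subsets of [V]; for continuous [F] this says that [F] is a
   homeomorphism of [W] onto a relatively open subset of [V]. *)
Definition open_embedding (d : nat) (X : topologicalType) (W : set 'rV[R]_d)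
    (F : 'rV[R]_d -> X) (V : set X) : Prop :=
  set_inj W F /\
  forall W', open W' -> W' `<=` W ->
    exists2 O, open O & F @` W' = V `&` O.

Definition loops_contractible (X : topologicalType) (V : set X) : Prop :=
  forall c : R -> X,
    {within `[0, 1], continuous c} -> c @` `[0, 1] `<=` V -> c 0 = c 1 ->
    exists H : R * R -> X,
      [/\ {within `[0, 1] `*` `[0, 1], continuous H},
          H @` (`[0, 1] `*` `[0, 1]) `<=` V,
          forall t, t \in `[0, 1] -> H (0, t) = c t /\ H (1, t) = c 0 &
          forall s, s \in `[0, 1] -> H (s, 0) = c 0 /\ H (s, 1) = c 0].

End Smooth.

Section ProjectiveSpace.
Context {R : realType}.

Definition pspace (k : nat) := {L : {vspace 'rV[R]_k.+1} | \dim L == 1%N}.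
HB.instance Definition _ k := Choice.on (pspace k).

Lemma pspace_default_subproof k :
  \dim <[(delta_mx 0%R 0%R : 'rV[R]_k.+1)]>%VS == 1%N.
Proof.
rewrite dim_vline; suff -> : (delta_mx 0 0 : 'rV[R]_k.+1) != 0 by [].
apply/eqP => /matrixP /(_ 0 0); rewrite !mxE !eqxx => /eqP.
by rewrite oner_eq0.
Qed.

(* [pt v] is the point [v] for [v != 0] (and an irrelevant point if [v = 0]). *)
Definition pt (k : nat) (v : 'rV[R]_k.+1) : pspace k :=
  insubd (exist _ <[delta_mx 0%R 0%R]>%VS (pspace_default_subproof k) : pspace k)
    <[v]>%VS.

Definition rep (k : nat) (p : pspace k) : 'rV[R]_k.+1 := vpick (val p).

Lemma val_pt k (v : 'rV[R]_k.+1) : v != 0 -> val (pt v) = <[v]>%VS.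
Proof. by move=> v0; rewrite val_insubd dim_vline v0. Qed.

Lemma rep_neq0 k (p : pspace k) : rep p != 0.
Proof. by rewrite /rep vpick0 -dimv_eq0 (eqP (valP p)). Qed.

Lemma pt_eq k (u v : 'rV[R]_k.+1) (t : R) : v != 0 -> t != 0 -> u = t *: v ->
  pt u = pt v.
Proof.
move=> v0 t0 ->; apply: val_inj; rewrite !val_pt//; last by rewrite scaler_eq0 negb_or t0.
apply/eqP; rewrite eqEsubv -!memvE; apply/andP; split.
  by rewrite memvZ// memv_line.
by rewrite -[X in X \in _](scalerK t0) memvZ// memv_line.
Qed.

Lemma pt_eqP k (u v : 'rV[R]_k.+1) : u != 0 -> v != 0 -> pt u = pt v ->
  exists t, u = t *: v.
Proof.
move=> u0 v0 /(congr1 val); rewrite !val_pt// => e.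
have /vlineP[t ->] : u \in <[v]>%VS by rewrite -e memv_line.
by exists t.
Qed.

Lemma pt_rep k (p : pspace k) : pt (rep p) = p.
Proof.
apply: val_inj; rewrite val_pt ?rep_neq0//; apply/eqP.
by rewrite eqEdim -memvE memv_pick dim_vline rep_neq0 (eqP (valP p)).
Qed.

Definition pspace_open (k : nat) (O : set (pspace k)) : Prop :=
  open [set v : 'rV[R]_k.+1 | v != 0 /\ O (pt v)].

Lemma nonzero_open k : open [set v : 'rV[R]_k.+1 | v != 0].
Proof.
have -> : [set v : 'rV[R]_k.+1 | v != 0] = ~` [set 0].
  by apply/seteqP; split=> v /= /eqP.
by apply: closed_openC; apply: accessible_closed_set1; exact: hausdorff_accessible.
Qed.

Lemma pspace_openT k : pspace_open [set: pspace k].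
Proof.
rewrite /pspace_open; have -> : [set v : 'rV[R]_k.+1 | v != 0 /\ setT (pt v)] =
  [set v : 'rV[R]_k.+1 | v != 0] by apply/seteqP; split=> v //= [].
exact: nonzero_open.
Qed.

Lemma pspace_openI k (A B : set (pspace k)) :
  pspace_open A -> pspace_open B -> pspace_open (A `&` B).
Proof.
rewrite /pspace_open => oA oB.
have -> : [set v : 'rV[R]_k.+1 | v != 0 /\ (A `&` B) (pt v)] =
  [set v | v != 0 /\ A (pt v)] `&` [set v | v != 0 /\ B (pt v)].
  by apply/seteqP; split=> v /=; [case=> ? []|case=> -[? ?] []].
exact: openI.
Qed.

Lemma pspace_open_bigU k (I : Type) (f : I -> set (pspace k)) :
  (forall i, pspace_open (f i)) -> pspace_open (\bigcup_i f i).
Proof.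
rewrite /pspace_open => of_.
have -> : [set v : 'rV[R]_k.+1 | v != 0 /\ (\bigcup_i f i) (pt v)] =
  \bigcup_i [set v | v != 0 /\ f i (pt v)].
  apply/seteqP; split=> v /=; first by case=> ? [i _ ?]; exists i.
  by case=> i _ [? ?]; split=> //; exists i.
by apply: bigcup_open => i _; exact: of_.
Qed.

HB.instance Definition _ k := @isOpenTopological.Build (pspace k) (@pspace_open k)
  (@pspace_openT k) (@pspace_openI k) (@pspace_open_bigU k).

(* The differential of [w |-> [F w]] at [w] is injective iff [F w] and the
   partial derivatives of [F] are linearly independent. *)
Definition pspace_submanifold (d k : nat) (U : set (pspace k)) : Prop :=
  forall p, U p -> exists (W : set 'rV[R]_d) (F : 'rV[R]_d -> 'rV[R]_k.+1),
    [/\ open W, smooth_on W F,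
        (forall w, W w -> \rank (col_mx (F w) ('J F w)) = d.+1),
        open_embedding W (fun w => pt (F w)) U &
        ((fun w => pt (F w)) @` W) p].

(* Families of lines l(u) = P(span(a u, b u)); a pair [z = (s, t)] stands for
   the vector s a(u) + t b(u). *)
Definition span_mx (r k : nat) (a b : 'rV[R]_r -> 'rV[R]_k.+1)
  (u : 'rV[R]_r) : 'M[R]_(1 + 1, k.+1) := col_mx (a u) (b u).

Definition line_point (r k : nat) (a b : 'rV[R]_r -> 'rV[R]_k.+1)
  (u : 'rV[R]_r) (z : 'rV[R]_2) : pspace k := pt (z *m span_mx a b u).

Definition proj_line (r k : nat) (a b : 'rV[R]_r -> 'rV[R]_k.+1)
    (u : 'rV[R]_r) : set (pspace k) :=
  [set line_point a b u z | z in [set z | z != 0]].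

(* The matrix of v |-> s da(v) + t db(v). *)
Definition dline (r k : nat) (a b : 'rV[R]_r -> 'rV[R]_k.+1)
    (u : 'rV[R]_r) (z : 'rV[R]_2) : 'M[R]_(r, k.+1) :=
  z 0 0 *: 'J a u + z 0 1 *: 'J b u.

(* Its row space is the embedded tangent subspace at [s a(u) + t b(u)]. *)
Definition tangent_mx (r k : nat) (a b : 'rV[R]_r -> 'rV[R]_k.+1)
    (u : 'rV[R]_r) (z : 'rV[R]_2) : 'M[R]_(1 + 1 + r, k.+1) :=
  col_mx (span_mx a b u) (dline a b u z).

(* (u, [s : t]) |-> [s a(u) + t b(u)] is an immersion at (u, z). *)
Definition line_regular (r k : nat) (a b : 'rV[R]_r -> 'rV[R]_k.+1)
    (u : 'rV[R]_r) (z : 'rV[R]_2) : Prop :=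
  \rank (tangent_mx a b u z) = r.+2.

Definition sweeps (r k : nat) (U : set (pspace k))
    (a b : 'rV[R]_r -> 'rV[R]_k.+1) (u : 'rV[R]_r) (z : 'rV[R]_2) : Prop :=
  [/\ z != 0, line_regular a b u z &
      \forall u' \near u & z' \near z, U (line_point a b u' z')].

(* Rank at [u] of a map u |-> T(u) into a Grassmannian, given by a smooth
   frame (the rows of [T u]): the rank of its differential
   v |-> (dT(v) mod T(u)) with values in Hom(T(u), R^(k+1) / T(u)). *)
Definition gauss_rank (r m k : nat) (T : 'rV[R]_r -> 'M[R]_(m, k.+1))
    (u : 'rV[R]_r) : nat :=
  \rank (\matrix_(i < r) mxvec ('D_(delta_mx 0 i) T u *m cokermx (T u))).

(* A smooth [r]-parameter family of rectilinear generators of [U], with the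
   common tangent subspace T(u) along the whole line l(u). The lines are
   complete: only an open piece of each of them has to lie in [U]. *)
Definition ruling (r k : nat) (U : set (pspace k)) (A : set 'rV[R]_r)
    (a b : 'rV[R]_r -> 'rV[R]_k.+1) (T : 'rV[R]_r -> 'M[R]_(r.+2, k.+1)) :
    Prop :=
  [/\ open A, smooth_on A a, smooth_on A b, smooth_on A T &
      forall u, A u ->
        [/\ row_free (span_mx a b u),
            exists z, sweeps U a b u z,
            row_free (T u),
            forall z, z != 0 -> line_regular a b u z ->
              (tangent_mx a b u z == T u)%MS &
            gauss_rank T u = r]].

Definition ruled_tangentially_degenerate (r k : nat) (U : set (pspace k)) :
    Prop :=
  pspace_submanifold r.+1 U /\
  forall p, U p -> exists (A : set 'rV[R]_r) (a b : 'rV[R]_r -> 'rV[R]_k.+1)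
      (T : 'rV[R]_r -> 'M[R]_(r.+2, k.+1)) (O : set (pspace k)),
    [/\ ruling U A a b T, open O, O p &
        forall q, U q -> O q -> exists u z,
          [/\ A u, sweeps U a b u z & q = line_point a b u z]].

Definition singular_points (r k : nat) (a b : 'rV[R]_r -> 'rV[R]_k.+1)
    (u : 'rV[R]_r) : set (pspace k) :=
  [set line_point a b u z | z in
    [set z | z != 0 /\ ~ line_regular a b u z]].

(* x |-> x *m C induces linear coordinates on the quotient T / l. *)
Definition quotient_coordinates (m l r k : nat) (T : 'M[R]_(m, k.+1))
    (L : 'M[R]_(l, k.+1)) (C : 'M[R]_(k.+1, r)) : Prop :=
  forall x : 'rV[R]_k.+1, (x <= T)%MS -> (x *m C == 0) = (x <= L)%MS.

(* The determinant of D_u is a binary form P(s, t). The multiplicity of its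
   zero [s0 : t0] is the order at X = 0 of P(s0 - X t0, t0 + X s0), where X is
   an affine coordinate of the projective line centred at [s0 : t0]. *)
Definition singular_multiplicity (r k : nat) (C : 'M[R]_(k.+1, r))
    (a b : 'rV[R]_r -> 'rV[R]_k.+1) (u : 'rV[R]_r) (z : 'rV[R]_2) : nat :=
  let z' := \row_(j < 2) (if j == 0 then - z 0 1 else z 0 0) in
  let D y := map_mx polyC (dline a b u y *m C) in
  mup 0 (\det (D z + 'X *: D z')).

(* l(u) has exactly [m] real singular points, counted with multiplicity. *)
Definition carries_singular_points (m r k : nat)
    (a b : 'rV[R]_r -> 'rV[R]_k.+1) (T : 'rV[R]_r -> 'M[R]_(r.+2, k.+1))
    (u : 'rV[R]_r) : Prop :=
  exists (C : 'M[R]_(k.+1, r)) (zs : seq (pspace 1)),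
    [/\ quotient_coordinates (T u) (span_mx a b u) C,
        uniq zs,
        forall zeta, zeta \in zs <-> ~ line_regular a b u (rep zeta) &
        (\sum_(zeta <- zs) singular_multiplicity C a b u (rep zeta))%N = m].

End ProjectiveSpace.
Arguments pspace R k : clear implicits.

Section ConformalSpace.
Context {R : realType} {n : nat}.
Variable G : 'M[R]_n.

Definition has_signature (p q : nat) : Prop :=
  G^T = G /\ exists2 P : 'M[R]_n, P \in unitmx &
    P *m G *m P^T =
    diag_mx (\row_(i < n) if (i < p)%N then 1
                          else if (i < p + q)%N then -1 else 0).

Definition qform (x y : 'rV[R]_n) : R := (x *m G *m y^T) 0 0.

(* The ideal points form a projective cone over the isotropic directions of
   [G], with vertex [1 : 0] (the point at infinity). The point [c : y] with
   y != 0 compactifies the isotropic hyperplane g(x, y) = c: its light cone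
   meets R^n in this hyperplane. *)
Definition ideal_cone (L : pspace R n) : Prop :=
  forall v : 'rV[R]_(1 + n), v \in val L -> qform (rsubmx v) (rsubmx v) = 0.

Inductive cspace : Type :=
| Fin of 'rV[R]_n
| Ideal (L : pspace R n) of ideal_cone L.

HB.instance Definition _ := gen_eqMixin cspace.
HB.instance Definition _ := gen_choiceMixin cspace.

Definition ideal_vec (c : R) (y : 'rV[R]_n) : 'rV[R]_n.+1 :=
  row_mx (c%:M : 'rV[R]_1) y.

Lemma ideal_cone_pt c y : ideal_vec c y != 0 -> qform y y = 0 ->
  ideal_cone (pt (ideal_vec c y)).
Proof.
move=> v0 gy v; rewrite val_pt// => /vlineP[t ->].
have -> : rsubmx (t *: ideal_vec c y : 'rV[R]_(1 + n)) = t *: y.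
  by rewrite linearZ /= row_mxKr.
rewrite /qform [(t *: y)^T]linearZ /= -!scalemxAl -scalemxAr scalerA mxE.
by rewrite -[X in _ * X]/(qform y y) gy mulr0.
Qed.

Lemma inversion_ideal (p w : 'rV[R]_n) : ideal_vec (1 + qform p w) w != 0.
Proof.
apply/eqP => h; have w0 : w = 0.
  by rewrite -[w](row_mxKr ((1 + qform p w)%:M : 'rV[R]_1)) -/(ideal_vec _ _) h linear0.
have : lsubmx (ideal_vec (1 + qform p w) w : 'rV[R]_(1 + n)) = 0 by rewrite h linear0.
rewrite row_mxKl w0 /qform trmx0 mulmx0 mxE addr0 => /matrixP /(_ 0 0).
by rewrite !mxE eqxx mulr1n => /eqP; rewrite oner_eq0.
Qed.

(* The inversion w |-> p + 2 w / g(w, w), extended to the isotropic cone of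
   the origin, where it takes ideal values ([w = 0] goes to infinity). *)
Definition inversion (p w : 'rV[R]_n) : cspace :=
  match pselect (qform w w = 0) with
  | left gw => Ideal (ideal_cone_pt (inversion_ideal p w) gw)
  | right _ => Fin (p + (2 / qform w w) *: w)
  end.

(* The conformal atlas of the space: the affine chart and all inversions. The
   conformal metric is represented by [G] in each of these charts. *)
Definition chart (c : option 'rV[R]_n) : 'rV[R]_n -> cspace :=
  if c is Some p then inversion p else Fin.

Definition cspace_open (O : set cspace) : Prop :=
  forall c, open (chart c @^-1` O).

Lemma cspace_openT : cspace_open setT.
Proof. by move=> c; rewrite preimage_setT; exact: openT. Qed.

Lemma cspace_openI (A B : set cspace) :
  cspace_open A -> cspace_open B -> cspace_open (A `&` B).
Proof. by move=> oA oB c; rewrite preimage_setI; apply: openI. Qed.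

Lemma cspace_open_bigU (I : Type) (f : I -> set cspace) :
  (forall i, cspace_open (f i)) -> cspace_open (\bigcup_i f i).
Proof.
by move=> of_ c; rewrite preimage_bigcup; apply: bigcup_open => i _; exact: of_.
Qed.

HB.instance Definition _ := @isOpenTopological.Build cspace cspace_open
  cspace_openT cspace_openI cspace_open_bigU.

Definition local_param (V : set cspace) (c : option 'rV[R]_n)
    (W : set 'rV[R]_n.-1) (h : 'rV[R]_n.-1 -> 'rV[R]_n) : Prop :=
  [/\ open W, smooth_on W h,
      (forall w, W w -> \rank ('J h w) = n.-1) &
      open_embedding W (chart c \o h) V].

Definition hypersurface (V : set cspace) : Prop :=
  [/\ forall q, V q -> exists c W h,
        local_param V c W h /\ ((chart c \o h) @` W) q,
      connected V &
      loops_contractible (R := R) V].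

(* The hyperplane spanned by the rows of [H] is tangent to the isotropic cone
   g(xi, xi) = 0, along the generator spanned by [xi]. *)
Definition tangent_to_cone (m : nat) (H : 'M[R]_(m, n)) : Prop :=
  exists xi : 'rV[R]_n, [/\ xi != 0, qform xi xi = 0 &
    forall eta : 'rV[R]_n, (eta <= H)%MS <-> qform xi eta = 0].

Definition lightlike (V : set cspace) : Prop :=
  forall c W h, local_param V c W h -> forall w, W w -> tangent_to_cone ('J h w).

(* Homogeneous coordinates x^0, (x^1, .., x^n), x^(n+1) of R^(n+2). *)
Definition hvec (s : R) (x : 'rV[R]_n) (t : R) : 'rV[R]_(n + 1).+1 :=
  row_mx (s%:M : 'rV[R]_1) (row_mx x (t%:M : 'rV[R]_1)).

Definition darboux (q : cspace) : pspace R (n + 1) :=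
  match q with
  | Fin x => pt (hvec 1 x (qform x x / 2))
  | Ideal L _ =>
      let v : 'rV[R]_(1 + n) := rep L in
      pt (hvec 0 (rsubmx v) (lsubmx v 0 0))
  end.

Definition darboux_quadric : set (pspace R (n + 1)) :=
  [set p : pspace R (n + 1) |
     forall s x t, hvec s x t \in val p -> qform x x - 2 * s * t = 0].

Lemma hvec_inj (s s' t t' : R) (x x' : 'rV[R]_n) : hvec s x t = hvec s' x' t' ->
  [/\ s = s', x = x' & t = t'].
Proof.
rewrite /hvec => h; have [h1 h2] := @eq_row_mx _ 1 1 (n+1) _ _ _ _ h; have [h3 h4] := eq_row_mx h2.
move/matrixP: h1 => /(_ 0 0); move/matrixP: h4 => /(_ 0 0).
by rewrite !mxE !eqxx.
Qed.

Lemma hvecZ (c s t : R) (x : 'rV[R]_n) : c *: hvec s x t = hvec (c * s) (c *: x) (c * t).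
Proof.
apply: etrans (@scale_row_mx R 1 1 (n + 1) c _ _) _.
by rewrite scale_row_mx !scale_scalar_mx.
Qed.

Lemma hvecE (v : 'rV[R]_(n+1).+1) : exists s x t, v = hvec s x t.
Proof.
pose w : 'rV_(1 + (n + 1)) := v.
exists (lsubmx w 0 0), (lsubmx (rsubmx w)), (rsubmx (rsubmx w) 0 0).
by rewrite /hvec -!mx11_scalar !hsubmxK.
Qed.

Lemma hvec0 : hvec 0 (0 : 'rV[R]_n) 0 = 0.
Proof. by rewrite /hvec !raddf0 !row_mx0. Qed.

Lemma hvec_eq0 s t (x : 'rV[R]_n) : hvec s x t = 0 -> [/\ s = 0, x = 0 & t = 0].
Proof. by rewrite -hvec0 => /hvec_inj. Qed.

Lemma qformZ c (x : 'rV[R]_n) : qform (c *: x) (c *: x) = c * c * qform x x.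
Proof.
by rewrite /qform [(c *: x)^T]linearZ /= -!scalemxAl -scalemxAr scalerA mxE.
Qed.

Lemma ideal_rep (L : pspace R n) : forall v : 'rV[R]_(1 + n), v = rep L ->
  hvec 0 (rsubmx v) (lsubmx v 0 0) != 0.
Proof.
move=> v ev; apply/eqP => /hvec_eq0[_ h1 h2]; have /eqP[] := rep_neq0 L.
rewrite -[LHS](@hsubmxK _ 1 1 n) -ev h1 [lsubmx v]mx11_scalar h2.
by rewrite raddf0 row_mx0.
Qed.

Lemma fin_neq0 (x : 'rV[R]_n) (c : R) : hvec 1 x c != 0.
Proof. by apply/eqP => /hvec_eq0[/eqP]; rewrite oner_eq0. Qed.

Lemma darboux_bij : set_bij setT darboux_quadric darboux.
Proof.
split.
- move=> [x|L h] _ /= s y t.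
    rewrite val_pt ?fin_neq0// => /vlineP[c]; rewrite hvecZ => /hvec_inj[-> -> ->].
    by rewrite qformZ; field.
  rewrite val_pt ?(@ideal_rep _ _ erefl)// => /vlineP[c]; rewrite hvecZ => /hvec_inj[-> -> ->].
  rewrite qformZ h; last exact: memv_pick.
  by rewrite !mulr0 mul0r subr0.
- move=> [x|L h] [y|L' h'] _ _ //=.
  + move=> /pt_eqP -/(_ (fin_neq0 _ _) (fin_neq0 _ _))[c].
    rewrite hvecZ => /hvec_inj[e -> _]; move: e; rewrite mulr1 => <-.
    by rewrite scale1r.
  + move=> /pt_eqP -/(_ (fin_neq0 _ _) (@ideal_rep _ _ erefl))[c].
    by rewrite hvecZ mulr0 => /hvec_inj[/eqP]; rewrite oner_eq0.
  + move=> /esym /pt_eqP -/(_ (fin_neq0 _ _) (@ideal_rep _ _ erefl))[c].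
    by rewrite hvecZ mulr0 => /hvec_inj[/eqP]; rewrite oner_eq0.
  + move=> /pt_eqP -/(_ (@ideal_rep _ _ erefl) (@ideal_rep _ _ erefl))[c].
    rewrite hvecZ => /hvec_inj[_ e1 e2].
    have e : rep L = c *: rep L'.
      rewrite -[LHS](@hsubmxK _ 1 1 n) -[X in _ *: X](@hsubmxK _ 1 1 n).
      apply: etrans _ (esym (@scale_row_mx R 1 1 n c _ _)); rewrite e1; congr row_mx.
      by rewrite [LHS]mx11_scalar e2 -scale_scalar_mx -mx11_scalar.
    have c0 : c != 0.
      by apply/eqP => c0; move: (rep_neq0 L); rewrite e c0 scale0r eqxx.
    have LL : L = L' by rewrite -(pt_rep L) -(pt_rep L'); exact: pt_eq (rep_neq0 _) c0 e.
    by subst L'; congr Ideal; exact: Prop_irrelevance.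
- move=> p hp; have [s [x [t e]]] := hvecE (rep p).
  have v0 := rep_neq0 p; have q0 : qform x x - 2 * s * t = 0.
    by apply: hp; rewrite -e memv_pick.
  have [s0|s0] := eqVneq s 0.
    have i0 : ideal_vec t x != 0.
      apply/eqP => h; have h' : ideal_vec t x = row_mx (0 : 'rV[R]_1) (0 : 'rV_n) by rewrite h row_mx0.
      have [/matrixP /(_ 0 0) h1 h2] := @eq_row_mx _ 1 1 n _ _ _ _ h'.
      move: h1; rewrite !mxE eqxx mulr1n => h1.
      by move: v0; rewrite e s0 h2 h1 hvec0 eqxx.
    have qx : qform x x = 0 by rewrite -q0 s0 mulr0 mul0r subr0.
    exists (Ideal (ideal_cone_pt i0 qx)) => //=.
    have [c] : exists c, rep (pt (ideal_vec t x)) = c *: ideal_vec t x.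
      by apply/vlineP; rewrite -val_pt// memv_pick.
    move=> ec; have c0 : c != 0.
      by apply/eqP => c0; move: (rep_neq0 (pt (ideal_vec t x))); rewrite ec c0 scale0r eqxx.
    rewrite -[RHS]pt_rep e s0; apply: (pt_eq _ c0).
      by rewrite -s0 -e.
    rewrite hvecZ ec !linearZ /= mulr0 mxE row_mxKr row_mxKl; congr (hvec _ _ (_ * _)).
    by rewrite mxE eqxx.
  exists (Fin (s^-1 *: x)) => //=; rewrite -[RHS]pt_rep e.
  apply: (@pt_eq _ _ _ _ s^-1); first by rewrite -e.
    by rewrite invr_eq0.
  rewrite hvecZ mulVf// qformZ; congr hvec.
  move/eqP: q0; rewrite subr_eq0 => /eqP ->; field.
  exact: s0.
Qed.

(* The line x + t w together with its ideal point. *)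
Definition affine_isotropic_line (x w : 'rV[R]_n) : set cspace :=
  [set q | match q with
           | Fin y => exists t : R, y = x + t *: w
           | Ideal L _ => L = pt (ideal_vec (qform x w) w)
           end].

Definition isotropic_line_at_infinity (w : 'rV[R]_n) : set cspace :=
  [set q | match q with
           | Fin _ => False
           | Ideal L _ =>
               (val L <= <[ideal_vec 1 0]> + <[ideal_vec 0 w]>)%VS
           end].

Definition isotropic_line (L : set cspace) : Prop :=
  exists w : 'rV[R]_n, [/\ w != 0, qform w w = 0 &
    (exists x, L = affine_isotropic_line x w) \/
    L = isotropic_line_at_infinity w].

(* Near [u0], the lines L(u) are represented in the chart [c] by the affine
   isotropic lines x(u) + t w(u). *)
Definition line_expression (r : nat) (L : 'rV[R]_r -> set cspace)
    (u0 : 'rV[R]_r) (c : option 'rV[R]_n) (A : set 'rV[R]_r)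
    (x w : 'rV[R]_r -> 'rV[R]_n) : Prop :=
  [/\ open A, A u0, smooth_on A x, smooth_on A w &
      forall u, A u -> [/\ w u != 0, qform (w u) (w u) = 0 &
        forall t : R, L u (chart c (x u + t *: w u))]].

(* (u, t) |-> x(u) + t w(u) is an immersion at (u, t). *)
Definition expression_regular (r : nat) (x w : 'rV[R]_r -> 'rV[R]_n)
    (u : 'rV[R]_r) (t : R) : Prop :=
  \rank (col_mx (w u) ('J x u + t *: 'J w u)) = r.+1.

(* A smooth family of (complete) isotropic lines which locally parametrizes
   the hypersurface [V]. *)
Definition isotropic_family (r : nat) (V : set cspace) (A : set 'rV[R]_r)
    (L : 'rV[R]_r -> set cspace) : Prop :=
  open A /\ forall u, A u -> isotropic_line (L u) /\
    exists c B x w (t : R), [/\ line_expression L u c B x w,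
      expression_regular x w u t &
      \forall u' \near u & t' \near t, V (chart c (x u' + t' *: w u'))].

Definition isotropic_singular_points (r : nat) (L : 'rV[R]_r -> set cspace)
    (u : 'rV[R]_r) : set cspace :=
  [set q | exists c B x w (t : R), [/\ line_expression L u c B x w,
      q = chart c (x u + t *: w u) & ~ expression_regular x w u t]].

End ConformalSpace.
Arguments cspace {R n} G.
Arguments darboux {R n G} q.
Arguments darboux_quadric {R n} G.

(* Main.v *)
(** In Minkowskian coordinates a lightlike hypersurface is the graph of a function
    f with |grad f| = 1. The gradient of such a function is constant along the
    straight lines with direction grad f, so that the hypersurface is ruled by
    isotropic lines. In R^(n+2) such a line is a totally isotropic plane l, and
    the tangent space along it is the orthogonal complement of l: this space T
    is constant along the line and determines it, whence the rank of the Gauss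
    map. The form induced on T / l is positive definite, and in it, second
    derivatives being symmetric, the maps D_u(s, t) become a pencil of symmetric
    matrices containing a positive definite one. Its determinant is therefore a
    product of n - 2 real linear forms in (s, t). Finally, the regularity of a
    point depends only on the family of lines, neither on the frame nor on the
    chart, so the singular points of both families correspond. *)
Require Import Defs.
From HB Require Import structures.
From mathcomp Require Import all_boot all_order all_algebra.
From mathcomp Require Import all_classical all_reals all_analysis.
From mathcomp Require Import ring lra complex.
Import Order.TTheory GRing.Theory Num.Theory.
Import numFieldNormedType.Exports.
Set Implicit Arguments.
Unset Strict Implicit.
Unset Printing Implicit Defensive.
Local Open Scope classical_set_scope.
Local Open Scope ring_scope.

(** * Smooth maps on open sets *)

(** The eikonal equation yields one ruling near a given point, whereas the claims about singular
    points concern every family satisfying [ruling], with an arbitrary frame and only an open piece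
    of each line in the hypersurface. For such a family isotropy and orthogonality are recovered
    from the definition alone: the form of the quadric vanishes on an open piece of a plane, hence
    on the plane, and a tangent space constant along the line, combined with differentiated
    isotropy, is orthogonal to the whole line. Positivity on T / l comes from the maximality of l:
    the ambient form has exactly two negative directions, and l uses both. The linear coordinates on
    T / l may be chosen freely; pairing with the derivatives at one regular point makes the matrices
    of D_u(s, t) Gram matrices, which is where both symmetry and definiteness come from. Ideal
    points get no separate treatment: every conformal chart is the affine one followed by a linear
    isometry of R^(n+2), and every point is finite in some chart. *)

Section SmoothCalculus.
Context {R : realType}.

Lemma near_eq_differentiable (V W : normedModType R) (f g : V -> W) x :
  (\forall y \near x, f y = g y) -> differentiable f x -> differentiable g x.
Proof.
move=> fg df.
have fgx : f x = g x by exact: nbhs_singleton fg.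
have sfg : \forall h \near (0 : V), f (h + x) = g (h + x).
  by move: fg; rewrite (near_shift 0)/= subr0.
have [c /eqaddoP dfx] := (diff_locallyP x f).1 df.
have e : g \o shift x = cst (g x) + 'd f x +o_ 0 id.
  apply/eqaddoE/eqaddoP => _/posnumP[e].
  apply: filterS2 sfg (dfx e%:num (gt0 e)) => y.
  by rewrite !fctE/= fgx => ->.
by apply/diff_locallyP; rewrite (diff_unique c e).
Qed.

Lemma differentiable_mxP (V : normedModType R) m n (f : V -> 'M[R]_(m, n)) x :
  differentiable f x <-> forall i j, differentiable (fun y => f y i j) x.
Proof.
split=> [df i j|df].
  apply: (@differentiable_comp _ _ _ _ f (fun N : 'M[R]_(m, n) => N i j)) => //.
  exact: differentiable_coord.
have -> : f = \sum_(i < m) \sum_(j < n) (fun y => f y i j *: delta_mx i j).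
  apply/funext => y; rewrite [LHS]matrix_sum_delta fct_sumE; apply: eq_bigr => i _.
  by rewrite fct_sumE.
apply: differentiable_sum => i; apply: differentiable_sum => j.
exact: differentiableZl.
Qed.

Lemma continuous_mxP (T : topologicalType) m n (f : T -> 'M[R]_(m, n)) x :
  {for x, continuous f} <-> forall i j, {for x, continuous (fun y => f y i j)}.
Proof.
split=> [cf i j|cf].
  apply: (@continuous_comp _ _ _ f (fun N : 'M[R]_(m, n) => N i j)) => //.
  exact: coord_continuous.
apply/cvgrPdist_le => /= e e0; near=> y.
rewrite /Num.Def.normr/= mx_normrE (bigmax_le _ (ltW e0))//= => i _.
rewrite !mxE/=; move: i; near: y; apply: filter_forall => /= i.
exact: ((cvgrPdist_le _ _).1 (cf i.1 i.2)).
Unshelve. all: by end_near. Qed.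

Variable d : nat.
Implicit Types (A B : set 'rV[R]_d).
Local Notation pd i f := (fun x => 'D_(delta_mx 0 i) f x).

(** Openness of [A] makes the equality hold near each point of [A], so it passes to all partial
    derivatives. Derivative formulas that are valid on [A] only are always used through this
    lemma. *)
Lemma eq_Ck k A (W : normedModType R) (f g : 'rV[R]_d -> W) :
  open A -> (forall x, A x -> f x = g x) -> Ck k A f -> Ck k A g.
Proof.
move=> oA; elim: k f g => [|k IH] f g fg /=.
  move=> cf x Ax; have nfg : \forall y \near x, f y = g y.
    by apply: filterS (open_nbhs_nbhs (conj oA Ax)) => y; exact: fg.
  rewrite /prop_for /continuous_at -(fg x Ax); apply: cvg_trans (cf x Ax).
  exact: (near_eq_cvg nfg).
have nfg x : A x -> \forall y \near x, f y = g y.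
  by move=> Ax; apply: filterS (open_nbhs_nbhs (conj oA Ax)) => y; exact: fg.
move=> [df cf]; split=> [x Ax|i].
  exact: near_eq_differentiable (nfg x Ax) (df x Ax).
by apply: IH (cf i) => x Ax; exact: near_eq_derive (nfg x Ax).
Qed.

Lemma Ck_subset k A B (W : normedModType R) (f : 'rV[R]_d -> W) :
  A `<=` B -> Ck k B f -> Ck k A f.
Proof.
move=> AB; elim: k f => [|k IH] f /= cf; first by move=> x /AB; exact: cf.
by split=> [x /AB|i]; [exact: cf.1|exact: IH (cf.2 i)].
Qed.

Lemma CkS k A (W : normedModType R) (f : 'rV[R]_d -> W) : Ck k.+1 A f -> Ck k A f.
Proof.
elim: k f => [|k IH] f [df cf].
  by move=> x Ax; apply: differentiable_continuous; exact: df.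
by split=> // i; exact: IH (cf i).
Qed.

Lemma derive_mxE (V : normedModType R) (m n : nat) (f : V -> 'M[R]_(m, n)) x v i j :
  differentiable f x -> 'D_v f x i j = 'D_v (fun y => f y i j) x.
Proof. by move=> df; rewrite derive_mx ?mxE//; exact: diff_derivable. Qed.

Lemma Ck_mxP k A (m n : nat) (f : 'rV[R]_d -> 'M[R]_(m, n)) : open A ->
  Ck k A f <-> forall i j, Ck k A (fun y => f y i j).
Proof.
move=> oA; elim: k f => [|k IH] f /=.
  split=> [cf i j x Ax|cf x Ax].
    exact: (continuous_mxP _ _).1 (cf x Ax) i j.
  by apply/continuous_mxP => i j; exact: cf.
split=> [[df cf] i j|cf]; last split => [x Ax|l].
- split=> [x Ax|l]; first exact: (differentiable_mxP _ _).1 (df x Ax) i j.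
  apply: eq_Ck ((IH _).1 (cf l) i j) => //= x Ax.
  by rewrite derive_mxE//; exact: df.
- by apply/differentiable_mxP => i j; exact: (cf i j).1.
apply/IH => i j; apply: eq_Ck ((cf i j).2 l) => //= x Ax.
by rewrite derive_mxE//; apply/differentiable_mxP => i' j'; exact: (cf i' j').1.
Qed.

Lemma Ck_cst k A (W : normedModType R) (c : W) : Ck k A (cst c : 'rV[R]_d -> W).
Proof.
elim: k c => [|k IH] c /=; first by move=> x _; exact: cst_continuous.
split=> [x _|i]; first exact: differentiable_cst.
rewrite (_ : pd i _ = cst 0); first exact: IH.
by apply/funext => x; exact: derive_cst.
Qed.

Lemma CkD k A (W : normedModType R) (f g : 'rV[R]_d -> W) :
  open A -> Ck k A f -> Ck k A g -> Ck k A (fun x => f x + g x).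
Proof.
move=> oA; elim: k f g => [|k IH] f g /=.
  by move=> cf cg x Ax; exact: (continuousD (cf x Ax) (cg x Ax)).
move=> [df cf] [dg cg]; split=> [x Ax|i].
  by apply: differentiableD; [exact: df|exact: dg].
apply: eq_Ck (IH _ _ (cf i) (cg i)) => // x Ax.
by rewrite -[RHS]/('D__ (f + g) x) deriveD//; apply: diff_derivable; [exact: df|exact: dg].
Qed.

Implicit Types f g : 'rV[R]_d -> R.

(** In the product rule one factor stays undifferentiated and is needed at the lower order of
    regularity only, whence [CkS] in the induction. *)
Lemma CkM k A f g :
  open A -> Ck k A f -> Ck k A g -> Ck k A (fun x => f x * g x).
Proof.
move=> oA; elim: k f g => [|k IH] f g.
  by move=> cf cg x Ax; exact: (continuousM (cf x Ax) (cg x Ax)).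
move=> Cf Cg; have [df cf] := Cf; have [dg cg] := Cg; split=> [x Ax|i].
  by apply: (@differentiableM _ _ f g); [exact: df|exact: dg].
apply: eq_Ck (CkD oA (IH _ _ (CkS Cf) (cg i)) (IH _ _ (CkS Cg) (cf i))) => // x Ax.
rewrite -[RHS]/('D__ (f * g) x) deriveM//; apply: diff_derivable; [exact: df|exact: dg].
Qed.

Lemma CkN k A f : open A -> Ck k A f -> Ck k A (fun x => - f x).
Proof.
move=> oA cf; apply: eq_Ck (CkM oA (@Ck_cst k A _ (-1 : R)) cf) => // x _.
by rewrite /= mulN1r.
Qed.

Lemma Ck_sum k A (I : Type) (r : seq I) (P : pred I) (F : I -> 'rV[R]_d -> R) :
  open A -> (forall i, P i -> Ck k A (F i)) -> Ck k A (fun x => \sum_(i <- r | P i) F i x).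
Proof.
move=> oA CF; elim: r => [|i r IH].
  by apply: eq_Ck (@Ck_cst k A _ (0 : R)) => // x _; rewrite big_nil.
case Pi: (P i); last by apply: eq_Ck IH => // x _; rewrite big_cons Pi.
by apply: eq_Ck (CkD oA (CF i Pi) IH) => // x _; rewrite big_cons Pi.
Qed.

Lemma Ck_prod k A (I : Type) (r : seq I) (P : pred I) (F : I -> 'rV[R]_d -> R) :
  open A -> (forall i, P i -> Ck k A (F i)) -> Ck k A (fun x => \prod_(i <- r | P i) F i x).
Proof.
move=> oA CF; elim: r => [|i r IH].
  by apply: eq_Ck (@Ck_cst k A _ (1 : R)) => // x _; rewrite big_nil.
case Pi: (P i); last by apply: eq_Ck IH => // x _; rewrite big_cons Pi.
by apply: eq_Ck (CkM oA (CF i Pi) IH) => // x _; rewrite big_cons Pi.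
Qed.

Lemma CkV k A f : open A -> (forall x, A x -> f x != 0) ->
  Ck k A f -> Ck k A (fun x => (f x)^-1).
Proof.
move=> oA f0; elim: k => [|k IH].
  by move=> cf x Ax; exact: (continuousV (f0 x Ax) (cf x Ax)).
move=> Cf; have [df cf] := Cf; split=> [x Ax|i].
  by apply: differentiableV; [exact: df|exact: f0].
have Cg := IH (CkS Cf).
apply: eq_Ck (CkN oA (CkM oA (CkM oA Cg Cg) (cf i))) => // x Ax.
rewrite (deriveV (f0 x Ax)); last by apply: diff_derivable; exact: df.
by rewrite -scaleNr expr2 invfM scaleNr.
Qed.

Lemma Ck_coord k A i : Ck k A (fun x : 'rV[R]_d => x 0 i).
Proof.
case: k => [|k]; first by move=> x _; exact: coord_continuous.
split=> [x _|j]; first exact: differentiable_coord.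
have -> : pd j (fun x : 'rV[R]_d => x 0 i) = cst ((delta_mx 0 j : 'rV[R]_d) 0 i).
  apply/funext => x; rewrite -(@derive_mxE 'rV[R]_d _ _ id) ?derive_id//.
exact: Ck_cst.
Qed.

End SmoothCalculus.

(** * Matrix-valued maps: product and chain rules, closure properties of smoothness *)

Section MatrixCalculus.
Context {R : realType}.

Lemma mulmx_entry_fct (V : normedModType R) m n p (M : V -> 'M[R]_(m, n))
    (N : V -> 'M[R]_(n, p)) i j :
  (fun y => (M y *m N y) i j) = \sum_(k < n) ((fun y => M y i k) * (fun y => N y k j)).
Proof. by apply/funext => y; rewrite mxE fct_sumE. Qed.

Lemma differentiable_mulmx (V : normedModType R) m n p (M : V -> 'M[R]_(m, n))
    (N : V -> 'M[R]_(n, p)) x :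
  differentiable M x -> differentiable N x -> differentiable (fun y => M y *m N y) x.
Proof.
move=> dM dN; apply/differentiable_mxP => i j.
have {}dM := (differentiable_mxP M x).1 dM; have {}dN := (differentiable_mxP N x).1 dN.
rewrite mulmx_entry_fct; apply: differentiable_sum => k; exact: differentiableM.
Qed.

Lemma derive_mulmx (V : normedModType R) m n p (M : V -> 'M[R]_(m, n))
    (N : V -> 'M[R]_(n, p)) x v :
  differentiable M x -> differentiable N x ->
  'D_v (fun y => M y *m N y) x = 'D_v M x *m N x + M x *m 'D_v N x.
Proof.
move=> dM dN; have dMN := differentiable_mulmx dM dN.
rewrite !derive_mx; [|exact: diff_derivable..].
apply/matrixP => i j; rewrite !mxE.
rewrite mulmx_entry_fct.
have {}dM := (differentiable_mxP M x).1 dM; have {}dN := (differentiable_mxP N x).1 dN.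
rewrite derive_sum; last by move=> k; apply/diff_derivable/differentiableM.
rewrite -big_split/=; apply: eq_bigr => k _.
rewrite deriveM; [|exact: diff_derivable..].
by rewrite !mxE addrC; congr (_ + _); rewrite /GRing.scale/= mulrC.
Qed.

Lemma derive_comp m n (W : normedModType R) (f : 'rV[R]_m -> W) (g : 'rV[R]_n -> 'rV[R]_m) x v :
  differentiable g x -> differentiable f (g x) ->
  'D_v (f \o g) x = 'D_('D_v g x) f (g x).
Proof.
move=> dg df; rewrite deriveE; last exact: differentiable_comp.
by rewrite diff_comp//= !deriveE.
Qed.

Lemma derive_rowE m (W : normedModType R) (f : 'rV[R]_m -> W) x v :
  differentiable f x -> 'D_v f x = \sum_j v 0 j *: 'D_(delta_mx 0 j) f x.
Proof.
move=> df; rewrite deriveE// [v in LHS]row_sum_delta linear_sum; apply: eq_bigr => j _.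
by rewrite linearZ/= deriveE.
Qed.

Lemma row_jacobian m n (f : 'rV[R]_m -> 'rV[R]_n) x i :
  differentiable f x -> row i ('J f x) = 'D_(delta_mx 0 i) f x.
Proof. by move=> df; rewrite deriveEjacobian// -rowE. Qed.

Lemma jacobianE m n (f : 'rV[R]_m -> 'rV[R]_n) x i j :
  differentiable f x -> 'J f x i j = 'D_(delta_mx 0 i) (fun y => f y 0 j) x.
Proof.
by move=> df; have /matrixP/(_ 0 j) := row_jacobian i df; rewrite mxE derive_mxE.
Qed.

Lemma jacobian_mulmx m n p (f : 'rV[R]_m -> 'rV[R]_n) (M : 'M[R]_(n, p)) x :
  differentiable f x -> 'J (fun y => f y *m M) x = 'J f x *m M.
Proof.
move=> df; apply/row_matrixP => i.
have dM : differentiable (fun y : 'rV[R]_m => M) x by exact: differentiable_cst.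
rewrite row_mul !row_jacobian//; last exact: differentiable_mulmx.
by rewrite derive_mulmx// derive_cst mulmx0 addr0.
Qed.

Lemma differentiable_mulmxr (V : normedModType R) m n p (M : V -> 'M[R]_(m, n))
    (N : 'M[R]_(n, p)) x :
  differentiable M x -> differentiable (fun y => M y *m N) x.
Proof. by move=> dM; apply: differentiable_mulmx => //; exact: differentiable_cst. Qed.

(** Induction on the chain rule in coordinates, with [f] generalised: a partial derivative of the
    composite is a sum of products of partial derivatives of [g] with partial derivatives of [f]
    composed with [g]. *)
Lemma Ck_comp k m n (A : set 'rV[R]_m) (B : set 'rV[R]_n)
    (f : 'rV[R]_m -> R) (g : 'rV[R]_n -> 'rV[R]_m) :
  open A -> open B -> (forall x, B x -> A (g x)) ->
  Ck k A f -> Ck k B g -> Ck k B (f \o g).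
Proof.
move=> oA oB gAB; elim: k f => [|k IH] f.
  move=> cf cg x Bx; apply: continuous_comp; first exact: (cg x Bx).
  exact: (cf _ (gAB x Bx)).
move=> [df cf] Cg; have [dg cg] := Cg; split=> [x Bx|i].
  by apply: differentiable_comp; [exact: dg|exact/df/gAB].
have C j : Ck k B (fun x => 'D_(delta_mx 0 i) g x 0 j * 'D_(delta_mx 0 j) f (g x)).
  apply: CkM => //; first exact: ((Ck_mxP k _ oB).1 (cg i) 0 j).
  by apply: IH (cf j) (CkS Cg).
have S := @Ck_sum _ _ k B _ (index_enum 'I_m) xpredT _ oB (fun j _ => C j).
apply: eq_Ck oB _ S => x Bx.
have dfx := df _ (gAB x Bx).
by rewrite (derive_comp _ (dg x Bx) dfx) (derive_rowE _ dfx).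
Qed.

Section Smooth.
Variables (d : nat) (A : set 'rV[R]_d).
Hypothesis oA : open A.

Lemma smooth_mxP m n (f : 'rV[R]_d -> 'M[R]_(m, n)) :
  smooth_on A f <-> forall i j, smooth_on A (fun x => f x i j).
Proof.
split=> [sf i j k|sf k]; first exact: ((Ck_mxP k _ oA).1 (sf k) i j).
by apply/(Ck_mxP k _ oA) => i j; exact: sf.
Qed.

Lemma eq_smooth (W : normedModType R) (f g : 'rV[R]_d -> W) :
  (forall x, A x -> f x = g x) -> smooth_on A f -> smooth_on A g.
Proof. by move=> fg sf k; exact: eq_Ck (sf k). Qed.

Lemma smooth_differentiable (W : normedModType R) (f : 'rV[R]_d -> W) x :
  smooth_on A f -> A x -> differentiable f x.
Proof. by move=> sf Ax; exact: (sf 1).1. Qed.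

Lemma smooth_continuous (W : normedModType R) (f : 'rV[R]_d -> W) x :
  smooth_on A f -> A x -> {for x, continuous f}.
Proof. by move=> sf; exact: sf 0 x. Qed.

Lemma smooth_derive (W : normedModType R) (f : 'rV[R]_d -> W) i :
  smooth_on A f -> smooth_on A (fun x => 'D_(delta_mx 0 i) f x).
Proof. by move=> sf k; exact: (sf k.+1).2. Qed.

Lemma smooth_cst (W : normedModType R) (c : W) : smooth_on A (fun _ : 'rV[R]_d => c).
Proof. by move=> k; exact: Ck_cst. Qed.

Lemma smoothD (W : normedModType R) (f g : 'rV[R]_d -> W) :
  smooth_on A f -> smooth_on A g -> smooth_on A (fun x => f x + g x).
Proof. by move=> sf sg k; exact: CkD. Qed.

Lemma smoothM (f g : 'rV[R]_d -> R) :
  smooth_on A f -> smooth_on A g -> smooth_on A (fun x => f x * g x).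
Proof. by move=> sf sg k; exact: CkM. Qed.

Lemma smoothV (f : 'rV[R]_d -> R) : (forall x, A x -> f x != 0) ->
  smooth_on A f -> smooth_on A (fun x => (f x)^-1).
Proof. by move=> f0 sf k; exact: CkV. Qed.

Lemma smooth_id : smooth_on A (fun x : 'rV[R]_d => x).
Proof. by apply/smooth_mxP => i j k; rewrite ord1; exact: Ck_coord. Qed.

Lemma smooth_sum (I : Type) (r : seq I) (P : pred I) (F : I -> 'rV[R]_d -> R) :
  (forall i, smooth_on A (F i)) -> smooth_on A (fun x => \sum_(i <- r | P i) F i x).
Proof. by move=> sF k; apply: Ck_sum => // i _; exact: sF. Qed.

Lemma smooth_prod (I : Type) (r : seq I) (P : pred I) (F : I -> 'rV[R]_d -> R) :
  (forall i, smooth_on A (F i)) -> smooth_on A (fun x => \prod_(i <- r | P i) F i x).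
Proof. by move=> sF k; apply: Ck_prod => // i _; exact: sF. Qed.

Lemma smooth_mulmx m n p (M : 'rV[R]_d -> 'M[R]_(m, n)) (N : 'rV[R]_d -> 'M[R]_(n, p)) :
  smooth_on A M -> smooth_on A N -> smooth_on A (fun x => M x *m N x).
Proof.
move=> /smooth_mxP sM /smooth_mxP sN; apply/smooth_mxP => i j.
apply: eq_smooth (smooth_sum (index_enum 'I_n) xpredT (fun k => smoothM (sM i k) (sN k j))).
by move=> x _; rewrite mxE.
Qed.

Lemma smooth_mulmxr m n p (M : 'rV[R]_d -> 'M[R]_(m, n)) (N : 'M[R]_(n, p)) :
  smooth_on A M -> smooth_on A (fun x => M x *m N).
Proof. by move=> sM; apply: smooth_mulmx => //; exact: smooth_cst. Qed.

Lemma smoothZ m n (c : 'rV[R]_d -> R) (M : 'rV[R]_d -> 'M[R]_(m, n)) :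
  smooth_on A c -> smooth_on A M -> smooth_on A (fun x => c x *: M x).
Proof.
move=> sc /smooth_mxP sM; apply/smooth_mxP => i j.
by apply: eq_smooth (smoothM sc (sM i j)) => x _; rewrite mxE.
Qed.

Lemma smooth_scalar (c : 'rV[R]_d -> R) :
  smooth_on A c -> smooth_on A (fun x => (c x)%:M : 'M[R]_1).
Proof.
move=> sc; apply/smooth_mxP => i j; rewrite !ord1.
by apply: eq_smooth sc => x _; rewrite mxE eqxx.
Qed.

Lemma smooth_row_mx m n1 n2 (M : 'rV[R]_d -> 'M[R]_(m, n1)) (N : 'rV[R]_d -> 'M[R]_(m, n2)) :
  smooth_on A M -> smooth_on A N -> smooth_on A (fun x => row_mx (M x) (N x)).
Proof.
move=> /smooth_mxP sM /smooth_mxP sN; apply/smooth_mxP => i j.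
case: (split_ordP j) => k ->.
  by apply: eq_smooth (sM i k) => x _; rewrite row_mxEl.
by apply: eq_smooth (sN i k) => x _; rewrite row_mxEr.
Qed.

Lemma smooth_col_mx m1 m2 n (M : 'rV[R]_d -> 'M[R]_(m1, n)) (N : 'rV[R]_d -> 'M[R]_(m2, n)) :
  smooth_on A M -> smooth_on A N -> smooth_on A (fun x => col_mx (M x) (N x)).
Proof.
move=> /smooth_mxP sM /smooth_mxP sN; apply/smooth_mxP => i j.
case: (split_ordP i) => k ->.
  by apply: eq_smooth (sM k j) => x _; rewrite col_mxEu.
by apply: eq_smooth (sN k j) => x _; rewrite col_mxEd.
Qed.

Lemma smooth_trmx m n (M : 'rV[R]_d -> 'M[R]_(m, n)) :
  smooth_on A M -> smooth_on A (fun x => (M x)^T).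
Proof.
move=> /smooth_mxP sM; apply/smooth_mxP => i j.
by apply: eq_smooth (sM j i) => x _; rewrite mxE.
Qed.

Lemma smooth_det n (M : 'rV[R]_d -> 'M[R]_n) :
  smooth_on A M -> smooth_on A (fun x => \det (M x)).
Proof.
move=> /smooth_mxP sM; rewrite /determinant; apply: smooth_sum => s.
apply: smoothM; first exact: smooth_cst.
by apply: smooth_prod => i; exact: sM.
Qed.

(** Cramer's formula: cofactors and determinant are polynomial in the entries. *)
Lemma smooth_invmx n (M : 'rV[R]_d -> 'M[R]_n) :
  (forall x, A x -> M x \in unitmx) ->
  smooth_on A M -> smooth_on A (fun x => invmx (M x)).
Proof.
move=> uM sM.
have sadj : smooth_on A (fun x => \adj (M x)).
  move/smooth_mxP: sM => sM; apply/smooth_mxP => i j.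
  suff : smooth_on A (fun x => cofactor (M x) j i).
    by apply: eq_smooth => x _; rewrite mxE.
  apply: smoothM; first exact: smooth_cst.
  apply: smooth_det; apply/smooth_mxP => i' j'.
  by apply: eq_smooth (sM (lift j i') (lift i j')) => x _; rewrite !mxE.
apply: eq_smooth (smoothZ (smoothV _ (smooth_det sM)) sadj).
  by move=> x Ax; rewrite /invmx uM.
by move=> x /uM; rewrite unitmxE unitfE.
Qed.

Lemma smooth_jacobian n (f : 'rV[R]_d -> 'rV[R]_n) :
  smooth_on A f -> smooth_on A (fun x => 'J f x).
Proof.
move=> sf; apply/smooth_mxP => i j.
apply: eq_smooth ((smooth_mxP _).1 (smooth_derive i sf) 0 j) => x Ax.
by rewrite -row_jacobian ?mxE//; exact: smooth_differentiable.
Qed.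

Lemma smooth_comp m p q (B : set 'rV[R]_m) (f : 'rV[R]_m -> 'M[R]_(p, q))
    (g : 'rV[R]_d -> 'rV[R]_m) :
  open B -> (forall x, A x -> B (g x)) ->
  smooth_on B f -> smooth_on A g -> smooth_on A (fun x => f (g x)).
Proof.
move=> oB gAB sf sg k; apply/(Ck_mxP k _ oA) => i j.
exact: Ck_comp oB oA gAB ((Ck_mxP k _ oB).1 (sf k) i j) (sg k).
Qed.

Lemma smooth_subset B (W : normedModType R) (f : 'rV[R]_d -> W) :
  B `<=` A -> smooth_on A f -> smooth_on B f.
Proof. by move=> BA sf k; exact: Ck_subset (sf k). Qed.

End Smooth.
End MatrixCalculus.

(** * Mean value and inverse function theorems *)

Section MeanValue.
Context {R : realType}.

Lemma le_mx_norm m n (M : 'M[R]_(m, n)) i j : `|M i j| <= `|M|.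
Proof.
rewrite [leRHS]/Num.Def.normr/= mx_normrE.
by rewrite (le_trans _ (le_bigmax _ _ (i, j))).
Qed.

Lemma mx_norm_le m n (M : 'M[R]_(m, n)) c :
  0 <= c -> (forall i j, `|M i j| <= c) -> `|M| <= c.
Proof.
move=> c0 Mc; rewrite /Num.Def.normr/= mx_normrE.
by apply: bigmax_le => // -[i j] _; exact: Mc.
Qed.

Lemma norm_mulmx m n (v : 'rV[R]_m) (M : 'M[R]_(m, n)) :
  `|v *m M| <= m%:R * `|M| * `|v|.
Proof.
apply: mx_norm_le => [|i j]; first by rewrite !mulr_ge0.
rewrite mxE (le_trans (ler_norm_sum _ _ _))//.
rewrite (@le_trans _ _ (\sum_(k < m) `|M| * `|v|))//.
  apply: ler_sum => k _; rewrite normrM mulrC.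
  by rewrite ler_pM//; exact: le_mx_norm.
by rewrite sumr_const card_ord -mulrA mulr_natl.
Qed.

Lemma mean_value (V : normedModType R) (f : V -> R) a v :
  (forall t : R, 0 <= t <= 1 -> differentiable f (a + t *: v)) ->
  exists2 t : R, 0 < t < 1 & f (a + v) - f a = 'D_v f (a + t *: v).
Proof.
move=> df; pose p (t : R) := a + t *: v.
pose l (t : R) := t *: v.
have dl t : is_diff t l l := is_diff_scalel t v.
have dp t : differentiable p t.
  exact: differentiableD (differentiable_cst a t) (@ex_diff _ _ _ _ _ _ _ (dl t)).
have dp1 t : 'd p t 1 = v.
  rewrite (diffD (differentiable_cst a t) (@ex_diff _ _ _ _ _ _ _ (dl t)))/= diff_cst add0r.
  by rewrite (@diff_val _ _ _ _ _ _ _ (dl t)) /l scale1r.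
have dfp (t : R) : 0 <= t <= 1 -> differentiable (f \o p) t.
  by move=> t01; apply: differentiable_comp => //; exact: df.
have [||t] := @MVT R (f \o p) (fun t => 'D_v f (p t)) 0 1 ltr01.
- move=> t; rewrite in_itv/= => /andP[/ltW t0 /ltW t1].
  have dft : differentiable f (p t) by apply: df; rewrite t0.
  have dfpt : differentiable (f \o p) t by apply: dfp; rewrite t0.
  apply: DeriveDef; first exact: diff_derivable.
  rewrite deriveE// diff_comp//= deriveE//.
  by rewrite dp1.
- apply: continuous_in_subspaceT => t; rewrite inE/= in_itv/= => t01.
  exact/differentiable_continuous/dfp.
- by rewrite in_itv/= => t01; rewrite /p scale1r scale0r addr0 subr0 mulr1; exists t.
Qed.

Lemma segment_ball (V : normedModType R) (x a v : V) r t :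
  ball x r a -> ball x r (a + v) -> 0 <= t <= 1 -> ball x r (a + t *: v).
Proof.
rewrite -ball_normE /ball_/= => xa xav /andP[t0 t1].
have -> : x - (a + t *: v) = (1 - t) *: (x - a) + t *: (x - (a + v)).
  by rewrite !opprD !addrA scalerBl scale1r [in t *: (_ - v)]scalerBr addrA subrK.
apply: (le_lt_trans (ler_normD _ _)); rewrite !normrZ ger0_norm ?subr_ge0// ger0_norm//.
have [->|t0'] := eqVneq t 0; first by rewrite subr0 mul1r mul0r addr0.
rewrite (@lt_le_trans _ _ ((1 - t) * r + t * r))//; last first.
  by rewrite -mulrDl subrK mul1r.
rewrite ler_ltD//; first by rewrite ler_wpM2l ?subr_ge0// ltW.
by rewrite ltr_pM2l// lt_neqAle eq_sym t0'.
Qed.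

(** Each coordinate has its own intermediate point; the norm being the maximum of the coordinates,
    the scalar theorem still gives the constant [c] without loss. *)
Lemma mean_value_mx m n (f : 'rV[R]_m -> 'rV[R]_n) x r c a b :
  (forall y, ball x r y -> differentiable f y) ->
  (forall y v, ball x r y -> `|'D_v f y| <= c * `|v|) ->
  ball x r a -> ball x r b -> `|f b - f a| <= c * `|b - a|.
Proof.
move=> df dfc xa xb; have xab : ball x r (a + (b - a)) by rewrite addrC subrK.
have c0 : 0 <= c * `|b - a| by apply: le_trans (dfc _ _ xa).
apply: mx_norm_le => // i j; rewrite ord1 !mxE.
have [|t /andP[t0 t1]] := @mean_value _ (fun y => f y 0 j) a (b - a).
  move=> t t01; apply: (differentiable_mxP _ _).1.
  exact/df/segment_ball.
have xt : ball x r (a + t *: (b - a)) by apply: segment_ball => //; rewrite !ltW.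
rewrite [a + (b - a)]addrC subrK => ->.
rewrite -(derive_mxE _ _ _ (df _ xt)).
exact: le_trans (le_mx_norm _ _ _) (dfc _ _ xt).
Qed.

Lemma derive_comp_shift (V W : normedModType R) (f : V -> W) a x v :
  'D_v (fun y => f (y + a)) x = 'D_v f (x + a).
Proof.
rewrite /derive; set F := (X in lim (X @ _) = _); set G := (X in _ = lim (X @ _)).
by have -> // : F = G; apply/funext => h; rewrite /F /G /= addrA.
Qed.

Lemma differentiable_shift (V W : normedModType R) (f : V -> W) a x :
  differentiable f (x + a) -> differentiable (fun y => f (y + a)) x.
Proof.
move=> df; apply: (@differentiable_comp _ _ _ _ (shift a) f) => //.
Qed.

Lemma derive_scale (V W : normedModType R) (f : V -> W) x v (h : R) :
  differentiable f x -> 'D_(h *: v) f x = h *: 'D_v f x.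
Proof. by move=> df; rewrite !deriveE// linearZ. Qed.

(* The second difference of [f] along [u], [v] is [h ^+ 2] times a value of
   either mixed derivative close to [x]. *)
Lemma second_difference d (A : set 'rV[R]_d) (f : 'rV[R]_d -> R) x i j (r h : R) :
  Ck 2 A f -> ball x r `<=` A -> 0 < h -> h * 2 < r ->
  exists2 y, `|x - y| <= h * 2 &
    f (x + h *: delta_mx 0 i + h *: delta_mx 0 j) - f (x + h *: delta_mx 0 i)
      - (f (x + h *: delta_mx 0 j) - f x)
    = h * (h * 'D_(delta_mx 0 j) (fun y => 'D_(delta_mx 0 i) f y) y).
Proof.
move=> Cf rA h0 hr; set u := delta_mx 0 i; set v := delta_mx 0 j.
have nd k (t : R) : `|t *: (delta_mx 0 k : 'rV[R]_d)| <= `|t|.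
  rewrite normrZ -[leRHS]mulr1 ler_wpM2l//; apply: mx_norm_le => // k1 k2.
  by rewrite mxE; case: (_ && _); rewrite ?normr1 ?normr0.
have xn (s t : R) : 0 <= s <= 1 -> 0 <= t <= 1 ->
    `|x - (x + s *: (h *: u) + t *: (h *: v))| <= h * 2.
  move=> /andP[s0 s1] /andP[t0 t1]; rewrite -addrA opprD addNKr normrN.
  rewrite (le_trans (ler_normD _ _))// mulrDr mulr1.
  rewrite !scalerA lerD// (le_trans (nd _ _))// ger0_norm ?mulr_ge0 ?(ltW h0)//.
    by rewrite ler_piMl// ltW.
  by rewrite ler_piMl// ltW.
have xA (s t : R) : 0 <= s <= 1 -> 0 <= t <= 1 ->
    ball x r (x + s *: (h *: u) + t *: (h *: v)).
  by move=> s01 t01; rewrite -ball_normE /ball_/= (le_lt_trans (xn _ _ _ _)).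
have df y : ball x r y -> differentiable f y by move=> /rA; exact: Cf.1.
have df' y : ball x r y -> differentiable (fun y => 'D_u f y) y.
  by move=> /rA; exact: (Cf.2 i).1.
pose F y := f (y + h *: v) - f y.
have d1 (t : R) : 0 <= t <= 1 -> differentiable f (x + t *: (h *: u)).
  move=> t01; apply: df; have := xA t 0 t01; rewrite scale0r addr0; apply.
  by rewrite lexx ler01.
have d2 (t : R) : 0 <= t <= 1 -> differentiable f (x + t *: (h *: u) + h *: v).
  move=> t01; apply: df; have := xA t 1 t01; rewrite scale1r; apply.
  by rewrite lexx ler01.
have dF (t : R) : 0 <= t <= 1 -> differentiable F (x + t *: (h *: u)).
  move=> t01; apply: differentiableB; last exact: d1.
  exact/differentiable_shift/d2.
have [s s01 Es] := mean_value dF.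
have {}s01 : 0 <= s <= 1 by case/andP: s01 => *; rewrite !ltW.
have [|t t01 Et] := @mean_value _ (fun y => 'D_u f y) (x + s *: (h *: u)) (h *: v).
  by move=> t t01; apply: df'; exact: xA.
have {}t01 : 0 <= t <= 1 by case/andP: t01 => *; rewrite !ltW.
have xst := xA s t s01 t01.
exists (x + s *: (h *: u) + t *: (h *: v)); first exact: xn.
rewrite -[LHS]/(F (x + h *: u) - F x) Es derive_scale; last exact: dF.
rewrite -[X in h * X](derive_scale _ _ (df' _ xst)) -Et.
congr (h * _); rewrite deriveB; last 2 first.
- exact/diff_derivable/differentiable_shift/d2.
- exact/diff_derivable/d1.
by rewrite derive_comp_shift.
Qed.

(** The second difference is symmetric in its two directions, so the two mixed derivatives take a
    common value at points [y] and [z] arbitrarily close to [x]; both are continuous at [x]. *)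
Lemma derive_symmetric d (A : set 'rV[R]_d) (f : 'rV[R]_d -> R) x i j :
  open A -> smooth_on A f -> A x ->
  'D_(delta_mx 0 j) (fun y => 'D_(delta_mx 0 i) f y) x =
  'D_(delta_mx 0 i) (fun y => 'D_(delta_mx 0 j) f y) x.
Proof.
move=> oA sf Ax.
set g := (fun z => 'D_(delta_mx 0 j) (fun y => 'D_(delta_mx 0 i) f y) z); set k := (fun z => 'D_(delta_mx 0 i) (fun y => 'D_(delta_mx 0 j) f y) z).
suff : g x = k x by [].
have cg : {for x, continuous g}.
  exact: (smooth_continuous (smooth_derive _ (smooth_derive _ sf)) Ax).
have ck : {for x, continuous k}.
  exact: (smooth_continuous (smooth_derive _ (smooth_derive _ sf)) Ax).
apply/eqP; rewrite -subr_eq0 -normr_le0; apply/ler_addgt0Pr => e e0; rewrite add0r.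
have e20 : 0 < e / 2 by rewrite divr_gt0.
have ng : \forall z \near x, `|g x - g z| < e / 2 by move/cvgrPdist_lt: cg; apply.
have nk : \forall z \near x, `|k x - k z| < e / 2 by move/cvgrPdist_lt: ck; apply.
have nA : \forall z \near x, A z by exact: open_nbhs_nbhs.
have : \forall z \near x, A z /\ (`|k x - k z| < e / 2 /\ `|g x - g z| < e / 2).
  by apply: filterS3 nA nk ng => z Az kz gz; split.
move=> /nbhs_ballP[r /= r0 rP].
have rA : ball x r `<=` A by move=> z /rP[].
pose h := r / 4; have h0 : 0 < h by rewrite divr_gt0.
have hr : h * 2 < r by rewrite /h; lra.
have [y xy Ey] := second_difference i j (sf 2) rA h0 hr.
have [z xz Ez] := second_difference j i (sf 2) rA h0 hr.
have subrACA (a b c c' : R) : a - b - (c - c') = a - c - (b - c') by ring.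
have gk : g y = k z.
  have : h * (h * g y) = h * (h * k z).
    apply: (etrans (esym Ey)); apply: etrans _ Ez; rewrite subrACA.
    by rewrite [x + h *: delta_mx 0 j + _]addrAC.
  by move/(mulfI (lt0r_neq0 h0))/(mulfI (lt0r_neq0 h0)).
have by' : ball x r y by rewrite -ball_normE /ball_/= (le_lt_trans xy).
have bz : ball x r z by rewrite -ball_normE /ball_/= (le_lt_trans xz).
have [_ [_ gy]] := rP _ by'; have [_ [kz _]] := rP _ bz.
move: gy kz gk; move: (g x) (g y) (k x) (k z) => gx gy kx kz lg lk gk.
rewrite (_ : gx - kx = (gx - gy) - (kx - kz)); last by rewrite gk; ring.
by rewrite (le_trans (ler_normB _ _))// [e]splitr lerD// ltW.
Qed.

Lemma mulmxr_continuous m n (L : 'M[R]_(m, n)) : continuous (mulmxr L : 'rV[R]_m -> 'rV[R]_n).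
Proof.
move=> x; apply: (@smooth_continuous _ _ [set: 'rV[R]_m] _ _ x _ I).
by apply: smooth_mulmxr; [exact: openT|exact/smooth_id/openT].
Qed.

Lemma differentiable_mulmx_approx m n (f : 'rV[R]_m -> 'rV[R]_n) (L : 'M[R]_(m, n)) x :
  (forall e, 0 < e -> \forall y \near x, `|f y - f x - (y - x) *m L| <= e * `|y - x|) ->
  differentiable f x /\ 'J f x = L.
Proof.
move=> fL; have cL := mulmxr_continuous (L := L).
have E e : 0 < e ->
    \forall h \near (0 : 'rV[R]_m), `|f (h + x) - (f x + mulmxr L h)| <= e * `|h|.
  move=> e0; have := fL e e0; rewrite (near_shift 0)/= subr0; apply: filterS => y /=.
  by rewrite addrK opprD addrA.
have dE : 'd f x = mulmxr L :> ('rV[R]_m -> 'rV[R]_n).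
  by apply: diff_unique => //; apply/eqaddoE/eqaddoP.
split; first by apply/diff_locallyP; rewrite dE; split=> //; apply/eqaddoE/eqaddoP.
by apply/row_matrixP => i; rewrite rowE [row i L]rowE /jacobian mul_rV_lin1 dE.
Qed.

Lemma differentiable_approx m n (f : 'rV[R]_m -> 'rV[R]_n) x e :
  differentiable f x -> 0 < e ->
  \forall y \near x, `|f y - f x - (y - x) *m 'J f x| <= e * `|y - x|.
Proof.
move=> df e0; have [_ /eqaddoP dfx] := (diff_locallyP x f).1 df.
rewrite (near_shift 0) subr0; apply: filterS (dfx e e0) => y /=.
by rewrite addrK !fctE/= opprD addrA /jacobian mul_rV_lin1.
Qed.


(** The displacement [|p y - y|] attains its minimum on the compact closed ball. Applying [p] once
    more to the minimiser would halve it, so the minimum is zero. *)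
Lemma contraction_fixed d (p : 'rV[R]_d -> 'rV[R]_d) x r :
  0 < r -> (forall y, `|x - y| <= r -> {for y, continuous p}) ->
  (forall y, `|x - y| <= r -> `|x - p y| <= r) ->
  (forall y z, `|x - y| <= r -> `|x - z| <= r -> `|p z - p y| <= 2^-1 * `|z - y|) ->
  exists2 y, `|x - y| <= r & p y = y.
Proof.
move=> r0 cp pK pC; pose K := [set y : 'rV[R]_d | `|x - y| <= r].
have KE : K = closed_ball x r by rewrite closed_ballE.
have cK : compact K.
  apply: bounded_closed_compact; last by rewrite KE; exact: closed_ball_closed.
  exists (`|x| + r); split; first by rewrite num_real.
  move=> M xrM y /= Ky; rewrite (le_trans _ (ltW xrM))//.
  rewrite -[y](subrK x) addrC (le_trans (ler_normD _ _))// lerD2l.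
  by rewrite distrC.
have [||c Kc cmin] := @EVT_min_rV R d (fun y => `|p y - y|) K _ cK.
- by exists x; rewrite /K/= subrr normr0 ltW.
- apply: continuous_in_subspaceT => y; rewrite inE => Ky.
  apply: (@continuous_comp _ _ _ (fun z => p z - z) (fun z => `|z|)); last exact: norm_continuous.
  by apply: continuousB; [exact: cp|exact: cvg_id].
rewrite inE in Kc; exists c => //.
have Kpc := pK _ Kc.
have := cmin (p c); rewrite inE => /(_ Kpc) le1.
have := le_trans le1 (pC _ _ Kc Kpc) => le2.
apply/eqP; rewrite -subr_eq0 -normr_le0.
have := normr_ge0 (p c - c); lra.
Qed.

Lemma near_lipschitz_continuous (V V' : normedModType R) (f : V -> V') x c :
  0 < c -> (\forall y \near x, `|f y - f x| <= c * `|y - x|) -> {for x, continuous f}.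
Proof.
move=> c0 fc; rewrite /prop_for /continuous_at; apply/cvgrPdist_le => e e0.
have nb : \forall y \near x, ball x (e / c) y by apply: nbhsx_ballx; rewrite divr_gt0.
apply: filterS2 fc nb => y fy; rewrite -ball_normE /ball_/= => xy.
by rewrite distrC (le_trans fy)// mulrC -ler_pdivlMr// distrC ltW.
Qed.

(** * The smooth local inverse *)

Section InverseFunction.

Lemma near_unit_perturbation (T : topologicalType) d (J : T -> 'M[R]_d) w0 c :
  {for w0, continuous (fun w => \det (J w))} ->
  {for w0, continuous (fun w => 1%:M - J w *m invmx (J w0))} ->
  J w0 \in unitmx -> 0 < c ->
  \forall w \near w0, J w \in unitmx /\ `|1%:M - J w *m invmx (J w0)| < c.
Proof.
move=> cdet cE u0 c0.
have det0 : \det (J w0) != 0 by rewrite -unitfE -unitmxE.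
have nE : \forall w \near w0, `|1%:M - J w *m invmx (J w0)| < c.
  move/cvgrPdist_lt : cE => /(_ _ c0); rewrite (mulmxV u0) subrr.
  by apply: filterS => w; rewrite sub0r normrN.
have ndet : \forall w \near w0, \det (J w) != 0 by exact: (cvgr_neq0 _ cdet det0).
by apply: filterS2 ndet nE => w; rewrite unitmxE unitfE.
Qed.

Variables (d : nat) (W : set 'rV[R]_d) (s : 'rV[R]_d -> 'rV[R]_d) (w0 : 'rV[R]_d).
Hypotheses (oW : open W) (ss : smooth_on W s) (Ww0 : W w0) (u0 : 'J s w0 \in unitmx).

Let M := invmx ('J s w0).

(** Near [w0] the map [w - s w *m M] has a derivative of norm at most 1/2. This single estimate
    gives injectivity, openness of the image and the Lipschitz bound of the inverse. *)
Lemma inverse_ball : exists2 r, 0 < r & [/\ ball w0 r `<=` W,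
  forall w : 'rV[R]_d, ball w0 r w -> 'J s w \in unitmx &
  forall (w v : 'rV[R]_d), ball w0 r w -> `|v - v *m ('J s w *m M)| <= 2^-1 * `|v|].
Proof.
have cJ : {for w0, continuous (fun w => 'J s w)}.
  exact: (smooth_continuous (smooth_jacobian oW ss) Ww0).
have cdet : {for w0, continuous (fun w => \det ('J s w))}.
  exact: (smooth_continuous (smooth_det oW (smooth_jacobian oW ss)) Ww0).
have cE : {for w0, continuous (fun w => 1%:M - 'J s w *m M)}.
  apply: continuousB; first exact: cst_continuous.
  exact: (smooth_continuous (smooth_mulmxr oW M (smooth_jacobian oW ss)) Ww0).
(* For the maximum norm, [norm_mulmx] costs a factor [d]; taking d + 1 keeps the denominator
   positive when [d] is 0. *)
have e0 : (0 : R) < (2 * d.+1%:R)^-1 by rewrite invr_gt0 mulr_gt0.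
have nJ := @near_unit_perturbation _ _ (fun w => 'J s w) w0 _ cdet cE u0 e0.
have nW : \forall w \near w0, W w by exact: open_nbhs_nbhs.
have : \forall w \near w0, [/\ W w, 'J s w \in unitmx &
    `|1%:M - 'J s w *m M| < (2 * d.+1%:R)^-1].
  by apply: filterS2 nW nJ => w Ww [].
move=> /nbhs_ballP[r /= r0 rP]; exists r; [exact: r0|split].
- by move=> w /rP[].
- by move=> w /rP[].
move=> w v /rP[_ _ /ltW h].
rewrite -[X in X - _]mulmx1 -mulmxBr (le_trans (norm_mulmx _ _))//.
rewrite ler_wpM2r// (le_trans (ler_wpM2l _ h))// invfM mulrCA ler_piMr//.
by rewrite ler_pdivrMr// mul1r ler_nat.
Qed.

Lemma inverse_function : exists (B Y : set 'rV[R]_d) (k : 'rV[R]_d -> 'rV[R]_d),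
  [/\ [/\ open B, B w0 & B `<=` W], open Y /\ smooth_on Y k,
      forall w, B w -> [/\ Y (s w), k (s w) = w & 'J s w \in unitmx] &
      forall y, Y y -> B (k y) /\ s (k y) = y].
Proof.
have [r r0 [rW ru rC]] := inverse_ball.
pose B := ball w0 r.
have ds w : B w -> differentiable s w by move=> /rW; exact: (smooth_differentiable ss).
have dM w : B w -> differentiable (fun w => s w *m M) w.
  by move=> Bw; apply: differentiable_mulmxr; exact: ds.
pose q w := w - s w *m M.
have dq w : B w -> differentiable q w by move=> Bw; apply: differentiableB => //; exact: dM.
have qC a b : B a -> B b -> `|q b - q a| <= 2^-1 * `|b - a|.
  apply: mean_value_mx => // y v By.
  rewrite deriveB; [|exact: derivable_id|exact/diff_derivable/dM].
  rewrite derive_id deriveEjacobian; last exact: dM.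
  by rewrite jacobian_mulmx; [exact: rC|exact: ds].
(* Lipschitz constant of the inverse: half of |b - a| is absorbed by the contraction [q], and the
   other half is at most d |M| |s b - s a|. The summand 1 makes it positive. *)
pose C := 2 * (d%:R * `|M|) + 1.
have C0 : 0 < C by rewrite ltr_wpDl// !mulr_ge0.
have sC a b : B a -> B b -> `|b - a| <= C * `|s b - s a|.
  move=> Ba Bb; have h := qC _ _ Ba Bb.
  have E : b - a = (q b - q a) + (s b - s a) *m M.
    rewrite /q mulmxBl; move: (s b *m M) (s a *m M) => P Q.
    by apply/matrixP => i j; rewrite !mxE; ring.
  have : `|b - a| <= 2^-1 * `|b - a| + d%:R * `|M| * `|s b - s a|.
    by rewrite {1}E (le_trans (ler_normD _ _))// lerD//; exact: norm_mulmx.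
  rewrite /C mulrDl mul1r; have := normr_ge0 (s b - s a); lra.
have sinj a b : B a -> B b -> s a = s b -> a = b.
  move=> Ba Bb sab; apply/esym/eqP; rewrite -subr_eq0 -normr_le0.
  by rewrite (le_trans (sC _ _ Ba Bb))// sab subrr normr0 mulr0.
have oB : open B by exact: ball_open.
pose Y := s @` B.
have Mu : M \in unitmx by rewrite unitmx_inv.
have oY : open Y.
  rewrite openE => _ [w1 Bw1 <-]; rewrite /interior.
  have /nbhs_ballP[e /= e0 eB] : nbhs w1 B by exact: open_nbhs_nbhs.
  pose h := e / 2; have h0 : 0 < h by rewrite divr_gt0.
  have hB w : `|w1 - w| <= h -> B w.
    move=> wh; apply: eB; rewrite -ball_normE /ball_/= (le_lt_trans wh)//.
    by rewrite /h; lra.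
  apply/nbhs_ballP; exists (h / C); first by rewrite /= divr_gt0.
  move=> y; rewrite -ball_normE /ball_/= => yw1.
  (* Its fixed points are the solutions of [s w = y]. For [y] within [h / C] of [s w1], the centre
     moves by at most [h / 2] and the contraction accounts for the other half, so the ball of radius
     [h] is preserved. *)
  pose p w := q w + y *m M.
  have pB a b : p b - p a = q b - q a by rewrite /p opprD addrACA subrr addr0.
  have [||||w wh pw] := @contraction_fixed d p w1 h.
  - exact: h0.
  - move=> w /hB Bw; apply: continuousD; last exact: cst_continuous.
    exact/differentiable_continuous/dq.
  - move=> w wh; rewrite (_ : w1 - p w = (w1 - p w1) + (p w1 - p w)); last by rewrite addrA subrK.
    rewrite (le_trans (ler_normD _ _))// pB (@le_trans _ _ (h / 2 + 2^-1 * h))//; last by lra.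
    rewrite lerD//; last first.
      by rewrite (le_trans (qC _ _ (hB _ wh) Bw1))// ler_wpM2l// invr_ge0.
    rewrite /p /q opprD opprB addrA [w1 + _]addrC subrK.
    rewrite -mulmxBl (le_trans (norm_mulmx _ _))//.
    have /ltW := yw1; rewrite ler_pdivlMr// => hC.
    have := normr_ge0 (s w1 - y); move: hC; rewrite /C.
    move: (d%:R * `|M|) (`|s w1 - y|) => t u; lra.
  - by move=> a b wa wb; rewrite pB; exact: qC (hB _ wa) (hB _ wb).
  exists w; first exact: hB.
  have : (s w - y) *m M = 0.
    apply/eqP; rewrite -oppr_eq0; apply/eqP; apply: (addrI w).
    by rewrite addr0 -[RHS]pw /p /q mulmxBl opprB addrA addrAC.
  move/(congr1 (mulmx^~ (invmx M))); rewrite mulmxK// mul0mx => /eqP.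
  by rewrite subr_eq0 => /eqP.
(* [w0] is only the default value outside [Y]. *)
pose k y := xget w0 [set w | B w /\ s w = y].
have kY y : Y y -> B (k y) /\ s (k y) = y.
  move=> [w Bw sw]; rewrite /k; case: xgetP => [w' -> //|/(_ w)].
  by move=> /(_ (conj Bw sw)).
have sk w : B w -> k (s w) = w.
  move=> Bw; have Ysw : Y (s w) by exists w.
  by have [Bk e] := kY _ Ysw; exact: sinj.
have kC y z : Y y -> Y z -> `|k z - k y| <= C * `|z - y|.
  by move=> /kY[By ey] /kY[Bz ez]; rewrite -{2}ez -{2}ey; exact: sC.
have ck y : Y y -> {for y, continuous k}.
  move=> Yy; apply: (near_lipschitz_continuous C0).
  have nY : \forall z \near y, Y z by exact: open_nbhs_nbhs.
  by apply: filterS nY => z Yz; exact: kC.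
have dk y : Y y -> differentiable k y /\ 'J k y = invmx ('J s (k y)).
  move=> Yy; have [Bk sky] := kY y Yy; set L := invmx _.
  apply: differentiable_mulmx_approx => e e0.
  (* The expansion of [s] at [k y] with error [e / (D + 1)] becomes one of [k] at [y] with error
     [e], since the increments of [k] are controlled by [C] and [L] multiplies norms by at most d
     |L|. *)
  pose D := d%:R * `|L| * C; have D0 : 0 <= D by rewrite !mulr_ge0// ltW.
  have e'0 : 0 < e / (D + 1) by rewrite divr_gt0// ltr_wpDl.
  have nY : nbhs y Y by exact: open_nbhs_nbhs.
  have := ck y Yy _ (differentiable_approx (ds _ Bk) e'0).
  apply: filterS2 nY => z Yz /=; have [Bz skz] := kY z Yz.
  rewrite skz sky => h.
  have -> : k z - k y - (z - y) *m L = - ((z - y - (k z - k y) *m 'J s (k y)) *m L).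
    have KL : (k z - k y) *m 'J s (k y) *m L = k z - k y by exact: mulmxK (ru _ Bk) _.
    by rewrite [in RHS]mulmxBl KL opprB.
  rewrite normrN (le_trans (norm_mulmx _ _))// (le_trans (ler_wpM2l _ h)) ?mulr_ge0//.
  rewrite (@le_trans _ _ (D * (e / (D + 1) * `|z - y|)))//.
    have := kC _ _ Yy Yz; have := ltW e'0.
    have : 0 <= d%:R * `|L| by rewrite mulr_ge0.
    move: (e / (D + 1)) `|k z - k y| `|z - y| => E t t'; rewrite /D.
    move: (d%:R * `|L|) => p p0 E0 tt'.
    rewrite -mulrA ler_wpM2l// [leRHS]mulrCA; exact: ler_wpM2l.
  rewrite mulrA ler_wpM2r// mulrA ler_pdivrMr ?ltr_wpDl//.
  by rewrite mulrC ler_wpM2l ?lerDl// ltW.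
(* Bootstrapping: the partial derivatives of [k] are the entries of the inverse Jacobian of [s]
   composed with [k], so each order of regularity of [k] yields the next. *)
have Ckk n j : Ck n Y (fun y => k y 0 j).
  elim: n j => [|n IH] j.
    by move=> y Yy; apply: (continuous_mxP _ _).1; exact: ck.
  split=> [y Yy|i]; first exact: (differentiable_mxP _ _).1 (dk y Yy).1 0 j.
  have si : smooth_on B (fun w => invmx ('J s w) i j).
    have sJ : smooth_on B (fun w => 'J s w).
      exact: smooth_subset rW (smooth_jacobian oW ss).
    exact: ((smooth_mxP oB _).1 (smooth_invmx oB ru sJ)).
  have Cn : Ck n Y k by apply/(Ck_mxP n _ oY) => a b; rewrite ord1; exact: IH.
  have kB y : Y y -> B (k y) by move=> /kY[].
  apply: eq_Ck oY _ (Ck_comp oB oY kB (si n) Cn) => y Yy /=.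
  by have [dky Jky] := dk y Yy; rewrite -(jacobianE _ _ dky) Jky.
exists B, Y, k; split; [split|split| |exact: kY].
- exact: oB.
- exact: ballxx.
- exact: rW.
- exact: oY.
- by apply/(smooth_mxP oY) => i j n; rewrite ord1; exact: Ckk.
- by move=> w Bw; split; [exists w|exact: sk|exact: ru].
Qed.

End InverseFunction.
End MeanValue.

(** * The eikonal equation *)

Section Transpose.
Context {R : realType}.

Lemma trmx_entry (T : Type) m n (M : T -> 'M[R]_(m, n)) k l :
  (fun z => (M z)^T k l) = (fun z => M z l k).
Proof. by apply/funext => z; rewrite mxE. Qed.

Lemma differentiable_trmx (V : normedModType R) m n (M : V -> 'M[R]_(m, n)) x :
  differentiable M x -> differentiable (fun z => (M z)^T) x.
Proof.
move=> dM; apply/differentiable_mxP => k l.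
by rewrite trmx_entry; exact: (differentiable_mxP _ _).1 dM l k.
Qed.

Lemma derive_trmx (V : normedModType R) m n (M : V -> 'M[R]_(m, n)) x v :
  differentiable M x -> 'D_v (fun z => (M z)^T) x = ('D_v M x)^T.
Proof.
move=> dM; have dT := differentiable_trmx dM.
rewrite !derive_mx; [|exact: diff_derivable..].
by apply/matrixP => k l; rewrite !mxE trmx_entry.
Qed.


Lemma near_norm_le (T : topologicalType) (V : normedModType R) (g : T -> V) x :
  {for x, continuous g} -> \forall z \near x, `|g z| <= `|g x| + 1.
Proof.
move=> /cvgrPdist_le /(_ 1 ltr01); apply: filterS => z h.
by rewrite -[g z](subrK (g x)) addrC (le_trans (ler_normD _ _))// lerD2l distrC.
Qed.

Lemma mx_norm_attained m (v : 'rV[R]_m) : v != 0 -> exists j, `|v| = `|v 0 j|.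
Proof.
move=> v0; have /mx_norm_neq0[[i j]] : mx_norm v != 0 by rewrite -[mx_norm v]/`|v| normr_eq0.
by rewrite (ord1 i) => e; exists j; exact: e.
Qed.

Lemma dotZl m (c : R) (u v : 'rV[R]_m) : (c *: u *m v^T) 0 0 = c * (u *m v^T) 0 0.
Proof. by rewrite -scalemxAl mxE. Qed.

End Transpose.

Section Eikonal.
Context {R : realType} {d : nat}.

Definition grad (f : 'rV[R]_d -> R) (y : 'rV[R]_d) : 'rV[R]_d :=
  \row_j 'D_(delta_mx 0 j) f y.

Definition dot m (u v : 'rV[R]_m) : R := (u *m v^T) 0 0.

Lemma derive_grad (f : 'rV[R]_d -> R) y v :
  differentiable f y -> 'D_v f y = dot v (grad f y).
Proof.
move=> df; rewrite derive_rowE// /dot mxE; apply: eq_bigr => j _.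
by rewrite !mxE.
Qed.

Lemma dotE m (u v : 'rV[R]_m) : dot u v = \sum_j u 0 j * v 0 j.
Proof. by rewrite /dot mxE; apply: eq_bigr => j _; rewrite mxE. Qed.

Lemma dot_ge0 m (u : 'rV[R]_m) : 0 <= dot u u.
Proof. by rewrite dotE; apply: sumr_ge0 => i _; rewrite -expr2 sqr_ge0. Qed.

Lemma dot_eq0 m (u : 'rV[R]_m) : dot u u = 0 -> u = 0.
Proof.
move=> /eqP; rewrite dotE psumr_eq0; last by move=> i _; rewrite -expr2 sqr_ge0.
move=> /allP u0; apply/rowP => j; rewrite mxE; apply/eqP.
by have := u0 j (mem_index_enum j); rewrite mulf_eq0 orbb.
Qed.

Lemma unit_norm_le1 m (u : 'rV[R]_m) : dot u u = 1 -> `|u| <= 1.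
Proof.
move=> u1; apply: mx_norm_le => // i j; rewrite ord1.
rewrite -(@ler_pXn2r _ 2) ?nnegrE// expr1n -normrX ger0_norm ?sqr_ge0// -u1 dotE.
rewrite (bigD1 j)//= -expr2 lerDl sumr_ge0// => k _; by rewrite -expr2 sqr_ge0.
Qed.

Variables (Y : set 'rV[R]_d) (f : 'rV[R]_d -> R).
Hypotheses (oY : open Y) (sf : smooth_on Y f).

Lemma smooth_grad : smooth_on Y (grad f).
Proof.
apply/(smooth_mxP oY) => i j.
by apply: (eq_smooth oY _ (smooth_derive j sf)) => x _; rewrite mxE.
Qed.

Lemma grad_entry k : (fun z => grad f z 0 k) = (fun z => 'D_(delta_mx 0 k) f z).
Proof. by apply/funext => z; rewrite mxE. Qed.

Lemma jacobian_grad_sym y : Y y -> ('J (grad f) y)^T = 'J (grad f) y.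
Proof.
move=> Yy; have dg := smooth_differentiable smooth_grad Yy.
apply/matrixP => i j; rewrite mxE !(jacobianE _ _ dg).
have E k l : 'D_(delta_mx 0 l) (fun y => grad f y 0 k) y =
    'D_(delta_mx 0 l) (fun y => 'D_(delta_mx 0 k) f y) y.
  by rewrite grad_entry.
rewrite !E; exact: derive_symmetric oY sf Yy.
Qed.

Hypothesis unit_grad : forall y, Y y -> dot (grad f y) (grad f y) = 1.

(* Differentiating |grad f|^2 = 1 and using the symmetry of the Hessian. *)
Lemma grad_hessian y : Y y -> grad f y *m 'J (grad f) y = 0.
Proof.
move=> Yy; have dg := smooth_differentiable smooth_grad Yy.
have dgT : differentiable (fun z => (grad f z)^T) y.
  exact: smooth_differentiable (smooth_trmx oY smooth_grad) Yy.
rewrite -[LHS]trmxK trmx_mul jacobian_grad_sym//.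
suff -> : 'J (grad f) y *m (grad f y)^T = 0 by rewrite trmx0.
apply/row_matrixP => i; rewrite row_mul row0 row_jacobian//.
have DT : 'D_(delta_mx 0 i) (fun z => (grad f z)^T) y = ('D_(delta_mx 0 i) (grad f) y)^T.
  exact: derive_trmx.
have : 'D_(delta_mx 0 i) (fun z => grad f z *m (grad f z)^T) y = 0.
  rewrite -[RHS](@derive_cst _ _ _ (1%:M : 'M[R]_1) y (delta_mx 0 i)).
  apply: near_eq_derive; have nY : \forall z \near y, Y z by exact: open_nbhs_nbhs.
  by apply: filterS nY => z Yz; rewrite [LHS]mx11_scalar -/(dot _ _) unit_grad.
rewrite derive_mulmx// DT => /matrixP/(_ 0 0) E.
apply/matrixP => a b; rewrite !ord1 [RHS]mxE.
move: E; rewrite mxE [X in _ + X = _](_ : _ = ('D_(delta_mx 0 i) (grad f) y *m (grad f y)^T) 0 0); last first.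
  by rewrite -[in RHS](trmxK ('D_(delta_mx 0 i) (grad f) y)) -trmx_mul [RHS]mxE.
rewrite [RHS]mxE; lra.
Qed.

(* [u s = grad f (y + s *: grad f y) - grad f y] solves a linear ODE with zero
   initial value, hence vanishes; this is Gronwall's argument on a short
   interval. *)
Lemma eikonal_lines y0 : Y y0 -> exists2 e, 0 < e &
  forall y (s : R), ball y0 e y -> `|s| < e ->
    [/\ Y (y + s *: grad f y), f (y + s *: grad f y) = f y + s &
        grad f (y + s *: grad f y) = grad f y].
Proof.
move=> Yy0; set N := grad f.
have cJ : {for y0, continuous (fun z => 'J N z)}.
  exact: (smooth_continuous (smooth_jacobian oY smooth_grad) Yy0).
pose M := `|'J N y0| + 1; have M0 : 0 < M by rewrite ltr_wpDl.
have nM : \forall z \near y0, `|'J N z| <= M.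
  exact: near_norm_le cJ.
have nY : \forall z \near y0, Y z by exact: open_nbhs_nbhs.
have : \forall z \near y0, Y z /\ `|'J N z| <= M by apply: filterS2 nY nM.
move=> /nbhs_ballP[r /= r0 rP].
(* [M] bounds the Hessian near [y0]; with this [D] the radius satisfies e d M <= 1/2, which is the
   halving factor in [uE]. *)
pose D := 2 * (d%:R * M) + 1; have D0 : 0 < D by rewrite ltr_wpDl// !mulr_ge0// ltW.
pose e := Num.min (r / 2) D^-1; have e0 : 0 < e by rewrite lt_min divr_gt0//= invr_gt0.
exists e => // y s yb se; set n0 := N y.
have er : e <= r / 2 by rewrite /e ge_min lexx.
have eD : e <= D^-1 by rewrite /e ge_min lexx orbT.
have Yy : Y y by apply: (rP y _).1; apply: le_ball yb; rewrite (le_trans er)//; lra.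
have n01 : `|n0| <= 1 by apply: unit_norm_le1; exact: unit_grad.
have br (t : R) : `|t| <= `|s| -> ball y0 r (y + t *: n0).
  move=> ts; move: yb; rewrite -!ball_normE /ball_/= => yb.
  rewrite opprD addrA (le_lt_trans (ler_normB _ _))// normrZ.
  have : `|t| * `|n0| <= `|t| by rewrite ler_piMr.
  lra.
have dN z : Y z -> differentiable N z by exact: smooth_differentiable smooth_grad.
pose u (t : R) := N (y + t *: n0) - n0.
have eM : e * (d%:R * M) <= 2^-1.
  rewrite (le_trans (ler_wpM2r _ eD)) ?mulr_ge0 ?(ltW M0)//.
  rewrite mulrC ler_pdivrMr// /D; have : 0 <= d%:R * M by rewrite mulr_ge0// ltW.
  lra.
have uE (t : R) : `|t| <= `|s| -> exists2 t' : R, `|t'| <= `|t| &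
    `|u t| <= 2^-1 * `|u t'|.
  move=> ts; have [ut|ut] := eqVneq (u t) 0.
    by exists t => //; rewrite ut normr0 mulr0.
  have [j Ej] := mx_norm_attained ut.
  have tt (t' : R) : 0 <= t' <= 1 -> `|t' * t| <= `|t|.
    by move=> /andP[t0 t1]; rewrite normrM ger0_norm// ler_piMl.
  have dz (t' : R) : 0 <= t' <= 1 -> ball y0 r (y + t' *: (t *: n0)).
    by move=> t01; rewrite scalerA; apply: br; rewrite (le_trans (tt _ t01)).
  have [t' t01|t' /andP[t0 t1] E] := @mean_value _ _ (fun z => N z 0 j) y (t *: n0).
    by apply: (differentiable_mxP N _).1; apply: dN; exact: (rP _ (dz _ t01)).1.
  have t01 : 0 <= t' <= 1 by rewrite !ltW.
  exists (t' * t); first exact: tt.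
  have [Yz JM] := rP _ (dz _ t01).
  have E2 : u t 0 j = (t *: n0 *m 'J N (y + t' *: (t *: n0))) 0 j.
    rewrite -(deriveEjacobian _ (dN _ Yz)) (derive_mxE _ _ _ (dN _ Yz)).
    by apply: etrans E; rewrite !mxE.
  have H : N (y + t' *: (t *: n0)) *m 'J N (y + t' *: (t *: n0)) = 0 := grad_hessian Yz.
  move: JM E2 H; move: ('J N _) => J JM E2 H.
  (* By [grad_hessian] the Hessian at the intermediate point annihilates the gradient there. Hence
     [n0] may be replaced by its difference with that gradient, which is [- u (t' * t)]. *)
  have {}E : u t 0 j = ((- t) *: u (t' * t) *m J) 0 j.
    by rewrite E2 /u -scalerA scaleNr -scalerN opprB scalerBr mulmxBl -![t *: _ *m _]scalemxAl H scaler0 subr0.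
  rewrite Ej E (le_trans (le_mx_norm _ _ _))// (le_trans (norm_mulmx _ _))//.
  rewrite normrZ normrN mulrA ler_wpM2r// (le_trans _ eM)//.
  rewrite mulrC ler_pM ?mulr_ge0//; first by rewrite (le_trans ts)// ltW.
  by rewrite ler_wpM2l.
(* At a maximum [c] of |u| on the interval, |u c| <= |u t'| / 2 <= |u c| / 2, so [u] vanishes. *)
have u0 (t : R) : `|t| <= `|s| -> u t = 0.
  have ss : - `|s| <= `|s| by rewrite (le_trans _ (normr_ge0 s))// oppr_le0.
  have [|c] := @EVT_max R (fun t => `|u t|) _ _ ss.
    apply: continuous_in_subspaceT => t'; rewrite inE/= in_itv/= -ler_norml => t's.
    apply: (@continuous_comp _ _ _ u (fun z => `|z|)); last exact: norm_continuous.
    apply: continuousB; last exact: cst_continuous.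
    apply: (@continuous_comp R 'rV[R]_d 'rV[R]_d (fun t : R => y + t *: n0) N).
      by apply: continuousD; [exact: cst_continuous|exact: scalel_continuous].
    by apply: differentiable_continuous; apply: dN; exact: (rP _ (br _ t's)).1.
  rewrite in_itv/= -ler_norml => cs cmax ts.
  have [t' t'c h] := uE c cs.
  have le1 := cmax t; rewrite in_itv/= -ler_norml in le1.
  have le2 := cmax t'; rewrite in_itv/= -ler_norml in le2.
  have {}le1 := le1 ts; have {}le2 := le2 (le_trans t'c cs).
  apply/eqP; rewrite -normr_le0.
  by move: le1 le2 h; move: `|u t| `|u c| `|u t'| => p q p' ? ? ?; lra.
have NE (t : R) : `|t| <= `|s| -> N (y + t *: n0) = n0.
  by move=> /u0/eqP; rewrite subr_eq0 => /eqP.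
split; [exact: (rP _ (br _ _)).1| |exact: NE].
have st (t : R) : 0 <= t <= 1 -> `|t * s| <= `|s|.
  by move=> /andP[t0 t1]; rewrite normrM ger0_norm// ler_piMl.
have [t t01|t /andP[t0 t1] E] := @mean_value _ _ f y (s *: n0).
  by rewrite scalerA; apply: (smooth_differentiable sf); exact: (rP _ (br _ (st _ t01))).1.
have ts : `|t * s| <= `|s| by apply: st; rewrite !ltW.
have Yz := (rP _ (br _ ts)).1.
rewrite scalerA in E; move/eqP: E; rewrite subr_eq => /eqP ->; rewrite addrC; congr (_ + _).
rewrite derive_grad; last exact: (smooth_differentiable sf).
by rewrite -/N NE// /dot dotZl -/(dot _ _) unit_grad// mulr1.
Qed.

End Eikonal.

(** * Symmetric pencils *)

Section SymmetricPencil.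
Context {R : realType}.

Definition posdef r (K : 'M[R]_r) : Prop :=
  forall x : 'rV[R]_r, x != 0 -> 0 < (x *m K *m x^T) 0 0.

(** Symmetric Gaussian elimination. The first pivot is positive; its Schur complement [K2] is again
    positive definite, being the form evaluated on the vectors [row_mx 0 x *m L]. *)
Lemma posdef_congruent r (K : 'M[R]_r) : K^T = K -> posdef K ->
  exists2 P, P \in unitmx & P *m K *m P^T = 1%:M.
Proof.
elim: r K => [|r IH] K Ks Kp.
  by exists 1%:M; [exact: unitmx1|apply/matrixP => -[]].
pose K' : 'M[R]_(1 + r) := K.
pose a := ulsubmx K'; pose b := ursubmx K'; pose D := drsubmx K'.
have Ks' : K'^T = K' := Ks.
have KE : K' = block_mx a b b^T D.
  by rewrite -[LHS]submxK; congr block_mx; rewrite /b trmx_ursub Ks'.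
have DT : D^T = D by rewrite /D trmx_drsub Ks'.
pose v0 : 'rV[R]_(1 + r) := row_mx 1%:M 0.
have a0 : 0 < a 0 0.
  have := Kp v0; rewrite -[X in _ *m X *m _]/K' KE /v0.
  rewrite (@mul_row_block _ 1 1 r 1 r) (@tr_row_mx _ 1 1 r) (@mul_row_col _ 1 1 r).
  rewrite !mul1mx !mul0mx !addr0 tr_scalar_mx mulmx1 trmx0 mulmx0 addr0; apply.
  apply/eqP => /(congr1 (@lsubmx _ 1 1 r)); rewrite row_mxKl raddf0.
  by move/matrixP/(_ 0 0); rewrite !mxE eqxx => /eqP; rewrite oner_eq0.
pose al := a 0 0; have aE : a = al%:M by rewrite [LHS]mx11_scalar.
have al0 : al != 0 by rewrite gt_eqF.
pose K2 := D - al^-1 *: (b^T *m b).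
have K2s : K2^T = K2 by rewrite /K2 linearB linearZ/= trmx_mul trmxK DT.
pose L : 'M[R]_(1 + r) := block_mx 1%:M 0 (- al^-1 *: b^T) 1%:M.
have LKL : L *m K' *m L^T = block_mx a 0 0 K2.
  rewrite KE /L (@tr_block_mx _ 1 r 1 r) !(@mulmx_block _ 1 r 1 r 1 r).
  rewrite !tr_scalar_mx trmx0 !mul1mx !mul0mx !mulmx1 !mulmx0 !addr0 ?add0r.
  rewrite linearZ/= trmxK aE.
  have E1 : (- al^-1 *: b^T) *m al%:M + b^T = 0.
    by rewrite mul_mx_scalar scalerA mulrN divff// scaleN1r addNr.
  have E2 : al%:M *m (- al^-1 *: b) + b = 0.
    by rewrite mul_scalar_mx scalerA mulrN divff// scaleN1r addNr.
  rewrite E1 E2 mul0mx add0r /K2; congr block_mx.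
  by rewrite -scalemxAl scaleNr addrC.
have K2p : posdef K2.
  move=> x x0; pose y : 'rV[R]_(1 + r) := row_mx 0 x *m L.
  have y0 : y != 0.
    rewrite /y /L (@mul_row_block _ 1 1 r 1 r) mul0mx mulmx1 mulmx0 !add0r.
    apply: contra_neq x0 => /(congr1 (@rsubmx _ 1 1 r)).
    by rewrite row_mxKr raddf0.
  have := Kp y y0; rewrite -[X in _ *m X *m _]/K'.
  have -> : y *m K' *m y^T = row_mx 0 x *m (L *m K' *m L^T) *m (row_mx 0 x)^T.
    by rewrite /y trmx_mul !mulmxA.
  rewrite LKL (@mul_row_block _ 1 1 r 1 r) (@tr_row_mx _ 1 1 r) (@mul_row_col _ 1 1 r).
  by rewrite trmx0 !mul0mx mulmx0 !add0r.
have [P2 P2u P2E] := IH K2 K2s K2p.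
pose c := (Num.sqrt al)^-1.
have sal0 : Num.sqrt al != 0 by rewrite sqrtr_eq0 -ltNge.
pose Q : 'M[R]_(1 + r) := block_mx c%:M 0 0 P2.
exists (Q *m L : 'M[R]_(1 + r)).
  rewrite unitmx_mul; apply/andP; split; rewrite unitmxE.
    rewrite /Q (@det_ublock _ 1 r) unitrM -[in X in _ && X]unitmxE P2u andbT.
    by rewrite det_scalar1 unitfE invr_eq0.
  by rewrite /L (@det_lblock _ 1 r) !det1 mulr1 unitr1.
have -> : Q *m L *m K *m (Q *m L)^T = Q *m (L *m K' *m L^T) *m Q^T.
  by rewrite trmx_mul !mulmxA.
rewrite LKL /Q (@tr_block_mx _ 1 r 1 r) !(@mulmx_block _ 1 r 1 r 1 r).
rewrite tr_scalar_mx !trmx0 !mul0mx !mulmx0 !addr0 !add0r P2E aE.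
rewrite !mul0mx -!scalar_mxM; apply: etrans _ (esym (@scalar_mx_block _ 1 r 1)).
congr block_mx.
rewrite -[al]sqr_sqrtr ?(ltW a0)// /c expr2; congr (_%:M).
by field.
Qed.

(** Over R[i] the matrix is Hermitian, hence unitarily diagonalisable with a real spectrum; the
    identity descends because the map of polynomials from R to R[i] is injective. The coefficients
    [p] and [q] are polynomials because multiplicities are read off a pencil that moves with 'X. *)
Lemma symmetric_pencil_id r (S : 'M[R]_r) : S^T = S -> exists l : 'I_r -> R,
  forall p q : {poly R},
    \det (p%:M + q *: map_mx polyC S) = \prod_i (p + q * (l i)%:P).
Proof.
move=> Ss; pose SC := map_mx (real_complex R) S.
have SCs : SC \is hermsymmx.
  apply: realsym_hermsym.
    apply/is_hermitianmxP; rewrite expr0 scale1r; apply/matrixP => i j.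
    by rewrite !mxE/= -[in LHS]Ss mxE.
  by apply/mxOverP => i j; rewrite mxE; apply/complex_realP; exists (S i j).
have /orthomx_spectralP SE := hermitian_normalmx SCs.
have /mxOverP lreal := hermitian_spectral_diag_real SCs.
pose l i := complex.Re (spectral_diag SC 0 i).
have lE i : spectral_diag SC 0 i = (real_complex R) (l i).
  by rewrite /l RRe_real.
exists l => p q.
apply: (map_poly_inj (real_complex R)).
pose PC := map_mx polyC (spectralmx SC).
have PCu : PC \in unitmx by rewrite map_unitmx// spectral_unit.
rewrite -det_map_mx rmorph_prod/=.
have -> : map_mx (map_poly (real_complex R)) (p%:M + q *: map_mx polyC S) =
    invmx PC *m (\matrix_(i, j) (if i == j then map_poly (real_complex R) (p + q * (l i)%:P) else 0)) *m PC.
  have -> : (\matrix_(i, j) (if i == j then map_poly (real_complex R) (p + q * (l i)%:P) else 0)) =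
     (map_poly (real_complex R) p)%:M + map_poly (real_complex R) q *: map_mx polyC (diag_mx (spectral_diag SC)).
    apply/matrixP => i j; rewrite !mxE; case: eqP => [->|_]; last by rewrite !mulr0n polyC0 mulr0 addr0.
    by rewrite !mulr1n rmorphD rmorphM/= map_polyC/= lE.
  rewrite mulmxDr mulmxDl -scalemxAr -scalemxAl mul_mx_scalar -scalemxAl mulVmx// -map_invmx.
  rewrite -!map_mxM -SE; apply/matrixP => i j; rewrite !mxE rmorphD rmorphM/= map_polyC/=.
  by rewrite raddfMn mulr_natr.
rewrite !det_mulmx mulrAC -det_mulmx mulVmx// det1 mul1r.
rewrite (_ : (\matrix_(_, _) _) = diag_mx (\row_i map_poly (real_complex R) (p + q * (l i)%:P))).
  by rewrite det_diag; apply: eq_bigr => i _; rewrite mxE.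
by apply/matrixP => i j; rewrite !mxE; case: eqP => [->|_]; rewrite ?mulr1n ?mulr0n.
Qed.

(** Simultaneous reduction: a congruence by [P] brings [K] to the identity and keeps [S] symmetric.
    It multiplies the determinant of every member of the pencil by the same constant, the inverse of
    [\det K]. *)
Lemma symmetric_pencil r (K S : 'M[R]_r) : K^T = K -> S^T = S -> posdef K ->
  \det K != 0 /\ exists l : 'I_r -> R, forall p q : {poly R},
    \det (p *: map_mx polyC K + q *: map_mx polyC S) =
    (\det K)%:P * \prod_i (p + q * (l i)%:P).
Proof.
move=> Ks Ss Kp; have [P Pu PE] := posdef_congruent Ks Kp.
have detE : \det P * \det K * \det P = 1.
  by rewrite -[X in _ * X]det_tr -!det_mulmx PE det1.
have P0 : \det P != 0 by rewrite -unitfE -unitmxE.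
split; first by apply/eqP => K0; move: detE; rewrite K0 mulr0 mul0r => /eqP; rewrite eq_sym oner_eq0.
pose S' := P *m S *m P^T.
have [|l lE] := @symmetric_pencil_id r S'.
  by rewrite /S' !trmx_mul trmxK Ss mulmxA.
exists l => p q; rewrite -lE /S'.
have -> : p%:M + q *: map_mx polyC (P *m S *m P^T) =
    map_mx polyC P *m (p *: map_mx polyC K + q *: map_mx polyC S) *m (map_mx polyC P)^T.
  rewrite mulmxDr mulmxDl -!scalemxAr -!scalemxAl map_trmx -!map_mxM PE map_mx1.
  by rewrite scalemx1.
rewrite !det_mulmx det_tr det_map_mx; set Dt := \det (p *: _ + _).
have -> : (\det K)%:P * ((\det P)%:P * Dt * (\det P)%:P) =
    Dt * ((\det P)%:P * (\det K)%:P * (\det P)%:P) by ring.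
by rewrite -!polyCM detE mulr1.
Qed.



(** The quarter turn, which completes [z != 0] to an orthogonal basis of R^2. It is the second
    vector in the definition of [singular_multiplicity]. *)
Definition perp2 (z : 'rV[R]_2) : 'rV[R]_2 :=
  \row_(j < 2) (if j == 0 then - z 0 1 else z 0 0).

Lemma rV2P (u v : 'rV[R]_2) : u 0 0 = v 0 0 -> u 0 1 = v 0 1 -> u = v.
Proof.
move=> h0 h1; apply/rowP => -[[|[|//]] j].
  by rewrite (_ : Ordinal _ = 0)//; exact: val_inj.
by rewrite (_ : Ordinal _ = 1)//; exact: val_inj.
Qed.

Lemma dot2E (u v : 'rV[R]_2) : dot u v = u 0 0 * v 0 0 + u 0 1 * v 0 1.
Proof. by rewrite dotE big_ord_recl big_ord1; congr (_ + u 0 _ * v 0 _); exact: val_inj. Qed.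

Lemma perp2E (z : 'rV[R]_2) : (perp2 z 0 0 = - z 0 1) * (perp2 z 0 1 = z 0 0).
Proof. by rewrite !mxE. Qed.

Lemma perp2_decomposition (z l : 'rV[R]_2) :
  dot l l *: z = dot z l *: l + dot z (perp2 l) *: perp2 l.
Proof. by apply: rV2P; rewrite !mxE/= !dot2E !perp2E; ring. Qed.

Lemma dot_neq0 (l : 'rV[R]_2) : l != 0 -> dot l l != 0.
Proof. by apply: contra_neq; exact: dot_eq0. Qed.

Lemma perp2_neq0 (z : 'rV[R]_2) : z != 0 -> perp2 z != 0.
Proof.
apply: contra_neq => h; apply: dot_eq0.
have -> : dot z z = dot (perp2 z) (perp2 z) by rewrite !dot2E !perp2E; ring.
by rewrite h dot2E !mxE; ring.
Qed.

Lemma dot_perp2_eq0 (z l : 'rV[R]_2) : z != 0 -> dot z l = 0 -> dot (perp2 z) l = 0 -> l = 0.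
Proof.
move=> z0 h1 h2; apply: (scalerI (dot_neq0 z0)).
have dotC (u v : 'rV[R]_2) : dot u v = dot v u by rewrite !dot2E; ring.
by rewrite scaler0 perp2_decomposition dotC h1 dotC h2 !scale0r addr0.
Qed.

Lemma dot_rep_eq0 (zeta : pspace R 1) (l : 'rV[R]_2) : l != 0 ->
  (dot (rep zeta) l == 0) = (zeta == pt (perp2 l)).
Proof.
move=> l0; have ll := dot_neq0 l0; have pl := perp2_neq0 l0; apply/eqP/eqP => [h|e].
  pose c := (dot l l)^-1 * dot (rep zeta) (perp2 l).
  have zE : rep zeta = c *: perp2 l.
    apply: (scalerI ll); rewrite perp2_decomposition h scale0r add0r.
    by rewrite scalerA /c mulVKf.
  have c0 : c != 0.
    by apply/eqP => c0; move: (rep_neq0 zeta); rewrite zE c0 scale0r eqxx.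
  by rewrite -[zeta]pt_rep; exact: pt_eq c0 zE.
have [t ->] : exists t, rep zeta = t *: perp2 l.
  by apply: pt_eqP => //; [exact: rep_neq0|rewrite pt_rep].
by rewrite dot2E !mxE/=; ring.
Qed.

(* Each nonzero linear form vanishes at exactly one point of the line. *)
Lemma count_linear_zeros r (l : 'I_r -> 'rV[R]_2) : (forall i, l i != 0) ->
  exists zs : seq (pspace R 1), [/\ uniq zs,
    forall zeta, (zeta \in zs) = [exists i, dot (rep zeta) (l i) == 0] &
    (\sum_(zeta <- zs) \sum_(i < r) (dot (rep zeta) (l i) == 0%R))%N = r].
Proof.
move=> l0; pose s := [seq pt (perp2 (l i)) | i <- enum 'I_r].
have sE i : pt (perp2 (l i)) \in undup s.
  by rewrite mem_undup; apply/mapP; exists i => //; rewrite mem_enum.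
exists (undup s); split; first exact: undup_uniq.
  move=> zeta; rewrite mem_undup; apply/mapP/existsP; move=> [ i ].
    by move=> _ ->; exists i; rewrite dot_rep_eq0.
  by rewrite dot_rep_eq0// => /eqP ->; exists i => //; rewrite mem_enum.
rewrite exchange_big/= -[RHS]card_ord -sum1_card; apply: eq_bigr => i _.
rewrite (bigD1_seq _ (sE i) (undup_uniq _))/= dot_rep_eq0// eqxx.
by rewrite big1 ?addn0// => zeta; rewrite dot_rep_eq0// => /negbTE ->.
Qed.

Lemma mup_linear (c e : R) : (c != 0) || (e != 0) ->
  mup 0 (c%:P + 'X * e%:P) = (c == 0).
Proof.
have [->|c0] /= := eqVneq c 0; last first.
  move=> _; apply: mupNroot; by rewrite rootE !hornerE.
move=> e0; rewrite polyC0 add0r mulrC.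
rewrite mupM ?polyC_eq0 ?polyX_eq0//.
rewrite mupNroot ?rootC// add0n -[X in mup _ X]subr0 -polyC0 -['X - _]expr1.
by rewrite mup_XsubCX eqxx.
Qed.

Lemma mup_prod_linear (k : R) r (c e : 'I_r -> R) : k != 0 ->
  (forall i, (c i != 0) || (e i != 0)) ->
  mup 0 (k%:P * \prod_i ((c i)%:P + 'X * (e i)%:P)) = (\sum_i (c i == 0%R))%N.
Proof.
move=> k0 ce.
have nz i : (c i)%:P + 'X * (e i)%:P != 0.
  apply: contraTneq (ce i) => h; rewrite negb_or !negbK.
  have := congr1 (fun p : {poly R} => p`_0) h; have := congr1 (fun p : {poly R} => p`_1) h.
  by rewrite !coefD !coefC !coefXM !coefC/= add0r addr0 => -> ->; rewrite eqxx.
rewrite mupM ?polyC_eq0//; last by apply/prodf_neq0.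
rewrite mupNroot ?rootC// add0n.
(* Multiplicities add up for nonzero factors, so nonvanishing is carried along the product. *)
pose K (p : {poly R}) m := p != 0 /\ mup 0 p = m.
suff : K (\prod_i ((c i)%:P + 'X * (e i)%:P)) (\sum_i (c i == 0%R))%N by case.
apply: (big_ind2 K) => [|p m q m' [p0 pE] [q0 qE]|i _].
- by split; [exact: oner_neq0|rewrite mupNroot// root1].
- by split; [rewrite mulf_neq0|rewrite mupM// pE qE].
by split; [exact: nz|rewrite mup_linear].
Qed.

(** In the basis [z0], [perp2 z0] the pencil consists of the combinations of a positive definite
    matrix and a symmetric one. Its determinant therefore splits into real linear forms, whose zeros
    are counted by [count_linear_zeros]. *)
Lemma pencil_zeros r (A B : 'M[R]_r) (z0 : 'rV[R]_2) :
  let D (z : 'rV[R]_2) := z 0 0 *: A + z 0 1 *: B in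
  z0 != 0 -> (D z0)^T = D z0 -> (D (perp2 z0))^T = D (perp2 z0) -> posdef (D z0) ->
  exists zs : seq (pspace R 1), [/\ uniq zs,
    forall zeta, zeta \in zs <-> \det (D (rep zeta)) = 0 &
    (\sum_(zeta <- zs) mup 0 (\det (map_mx polyC (D (rep zeta)) +
       'X *: map_mx polyC (D (perp2 (rep zeta))))))%N = r].
Proof.
move=> D z00 Ks Ss Kp; have [k0 [l lE]] := symmetric_pencil Ks Ss Kp.
have ll := dot_neq0 z00.
(* The linear form with value 1 at [z0] and [l i] at [perp2 z0]; none of them is zero, since none
   vanishes at [z0]. *)
pose L i := (dot z0 z0)^-1 *: (z0 + l i *: perp2 z0).
have DE z : D z = ((dot z0 z0)^-1 * dot z z0) *: D z0 +
    ((dot z0 z0)^-1 * dot z (perp2 z0)) *: D (perp2 z0).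
  rewrite /D; apply/matrixP => i j; rewrite dot2E in ll.
  by rewrite !mxE/= !dot2E !perp2E; field.
have LE z i : dot z (L i) =
    (dot z0 z0)^-1 * dot z z0 + (dot z0 z0)^-1 * dot z (perp2 z0) * l i.
  by move: ll; rewrite /L !dot2E !mxE/= ?dot2E => ?; field.
have L0 i : L i != 0.
  suff : dot z0 (L i) != 0 by apply: contra_neq => ->; rewrite dot2E !mxE; ring.
  have p0 : dot z0 (perp2 z0) = 0 by rewrite dot2E !perp2E; ring.
  by rewrite LE p0 mulr0 mul0r addr0 mulVf// oner_neq0.
have [zs [zu zE zsum]] := count_linear_zeros L0.
have polyE (z z' : 'rV[R]_2) :
    \det (map_mx polyC (D z) + 'X *: map_mx polyC (D z')) =
    (\det (D z0))%:P * \prod_i ((dot z (L i))%:P + 'X * (dot z' (L i))%:P).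
  pose al (z : 'rV[R]_2) := (dot z0 z0)^-1 * dot z z0.
  pose be (z : 'rV[R]_2) := (dot z0 z0)^-1 * dot z (perp2 z0).
  have -> : map_mx polyC (D z) + 'X *: map_mx polyC (D z') =
      ((al z)%:P + 'X * (al z')%:P) *: map_mx polyC (D z0) +
      ((be z)%:P + 'X * (be z')%:P) *: map_mx polyC (D (perp2 z0)).
    rewrite (DE z) (DE z') -/(al z) -/(al z') -/(be z) -/(be z').
    move: (D z0) (D (perp2 z0)) => K S; apply/matrixP => i j; rewrite !mxE.
    by rewrite !polyCD !polyCM; ring.
  rewrite lE; congr (_ * _); apply: eq_bigr => i _; rewrite !LE -/(al z) -/(al z') -/(be z) -/(be z').
  by rewrite !polyCD !polyCM; ring.
(* Evaluation of the polynomial identity at 'X = 0. *)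
have detE (z : 'rV[R]_2) : \det (D z) = \det (D z0) * \prod_i dot z (L i).
  have := congr1 (fun p => p.[0]) (polyE z z).
  rewrite -horner_evalE -det_map_mx hornerM hornerC horner_prod => E.
  transitivity (\det (map_mx (horner_eval 0) (map_mx polyC (D z) + 'X *: map_mx polyC (D z)))).
    congr (\det _); apply/matrixP => i j; rewrite !mxE /horner_eval !hornerE; ring.
  by rewrite E; congr (_ * _); apply: eq_bigr => i _; rewrite !hornerE; ring.
exists zs; split => //.
  move=> zeta; rewrite zE detE; split.
    by move=> /existsP[i /eqP zi]; rewrite (bigD1 i)//= zi mul0r mulr0.
  move/eqP; rewrite mulf_eq0 (negbTE k0)/= => /prodf_eq0[i _ zi].
  by apply/existsP; exists i.
rewrite -[RHS]zsum; apply: eq_bigr => zeta _; rewrite polyE mup_prod_linear// => i.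
(* A linear form vanishing at a vector and at its quarter turn is zero, so every factor has
   multiplicity 0 or 1 at the origin. *)
rewrite -negb_and; apply/negP => /andP[/eqP h1 /eqP h2].
by have := dot_perp2_eq0 (rep_neq0 zeta) h1 h2 => Li; move: (L0 i); rewrite Li eqxx.
Qed.

End SymmetricPencil.

(** * The ambient quadratic form *)

Section Signature.
Context {R : realType}.

Lemma mulmx_row_eq0 m p (M : 'M[R]_(m, p)) : (forall x : 'rV[R]_m, x *m M = 0 -> x = 0) -> row_free M.
Proof.
move=> h; rewrite -kermx_eq0; apply/eqP/row_matrixP => i; rewrite row0.
by apply: h; rewrite -row_mul mulmx_ker row0.
Qed.

(* [x |-> (x *m E, x *m F)] are coordinates in which the form is Minkowskian;
   [K] and [k] give the inverse change of coordinates. *)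
Definition minkowskian r (G : 'M[R]_r.+2) (E : 'M[R]_(r.+2, r.+1)) (F : 'cV[R]_r.+2)
    (K : 'M[R]_(r.+1, r.+2)) (k : 'rV[R]_r.+2) : Prop :=
  [/\ G = E *m E^T - F *m F^T, E *m K + F *m k = 1%:M &
   [/\ K *m E = 1%:M, K *m F = 0, k *m E = 0 & k *m F = 1%:M]].

(** [E0] and [F0] select the first r + 1 coordinates and the last one in the basis that diagonalises
    the form; [P] transports them to the given coordinates. *)
Lemma signature_minkowski r (G : 'M[R]_r.+2) : has_signature G r.+1 1 ->
  exists E F K k, minkowskian G E F K k.
Proof.
move=> [Gs [P Pu PGP]].
pose E0 : 'M[R]_(r.+2, r.+1) := \matrix_(i, j) (i == lift ord_max j)%:R.
pose F0 : 'cV[R]_r.+2 := delta_mx ord_max 0.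
have E0E0 : E0^T *m E0 = 1%:M.
  apply/matrixP => i j; rewrite !mxE (bigD1 (lift ord_max i))//= big1 => [|k ki].
    by rewrite !mxE eqxx mul1r addr0 (inj_eq lift_inj).
  by rewrite !mxE (negbTE ki) mul0r.
have E0F0 : E0^T *m F0 = 0.
  apply/matrixP => i j; rewrite !mxE big1// => k _; rewrite !mxE ord1 andbT.
  case: eqP => [->|_]; last by rewrite mul0r.
  by rewrite (negbTE (neq_lift _ _)) mulr0 || rewrite eq_sym (negbTE (neq_lift _ _)) mulr0.
have F0F0 : F0^T *m F0 = 1%:M by rewrite trmx_delta mul_delta_mx; apply/matrixP => i j; rewrite !ord1 !mxE.
have F0E0 : F0^T *m E0 = 0 by rewrite -[LHS]trmxK trmx_mul trmxK E0F0 trmx0.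
have S0 : E0 *m E0^T + F0 *m F0^T = 1%:M.
  apply/matrixP => i j; rewrite !mxE big_ord1 !mxE.
  case: (unliftP ord_max i) => [i'|] ->.
    rewrite (bigD1 i')//= big1 => [|k ki]; last first.
      by rewrite !mxE (inj_eq lift_inj) eq_sym (negbTE ki) mul0r.
    rewrite !mxE eqxx mul1r addr0 [_ == ord_max]eq_sym (negbTE (neq_lift _ _)) mul0r addr0.
    by rewrite eq_sym.
  rewrite big1 => [|k _]; last by rewrite !mxE (negbTE (neq_lift _ _)) mul0r.
  by rewrite eqxx mul1r add0r andbT eq_sym.
have D0 : diag_mx (\row_(i < r.+2) if (i < r.+1)%N then 1
    else if (i < r.+1 + 1)%N then -1 else 0) = E0 *m E0^T - F0 *m F0^T.
  apply/matrixP => i j; have /matrixP/(_ i j) := S0; rewrite !mxE big_ord1 !mxE !andbT.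
  case: (unliftP ord_max i) => [i'|] ->.
    rewrite lift_max ltn_ord [_ == ord_max]eq_sym (negbTE (neq_lift _ _)) mul0r.
    by rewrite subr0 addr0 => ->.
  rewrite ltnn addn1 ltnSn big1 => [|k _]; last by rewrite !mxE (negbTE (neq_lift _ _)) mul0r.
  by rewrite !add0r => ->; rewrite mulNrn.
exists (invmx P *m E0), (invmx P *m F0), (E0^T *m P), (F0^T *m P); split; last split.
- rewrite !trmx_mul -!mulmxA -mulmxBr !mulmxA -mulmxBl.
  apply: (can_inj (mulKmx Pu)); apply: (can_inj (@mulmxK _ _ _ P^T _)); first by rewrite unitmx_tr.
  by rewrite PGP D0 (mulKVmx Pu) trmx_inv mulmxKV ?unitmx_tr.
- by rewrite !mulmxA -mulmxDl -!mulmxA -mulmxDr S0 mulmx1 mulVmx.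
- by rewrite -mulmxA (mulKVmx Pu).
- by rewrite -mulmxA (mulKVmx Pu).
- by rewrite -mulmxA (mulKVmx Pu).
- by rewrite -mulmxA (mulKVmx Pu).
Qed.

Variables (r : nat) (G : 'M[R]_r.+2) (E : 'M[R]_(r.+2, r.+1)) (F : 'cV[R]_r.+2)
  (K : 'M[R]_(r.+1, r.+2)) (k : 'rV[R]_r.+2).
Hypothesis mG : minkowskian G E F K k.

Lemma minkowski_sym : G^T = G.
Proof. by have [-> _ _] := mG; rewrite linearB/= !trmx_mul !trmxK. Qed.

Lemma minkowski_eq0 (x : 'rV[R]_r.+2) : x *m E = 0 -> x *m F = 0 -> x = 0.
Proof.
have [_ e _] := mG; move=> xE xF.
by rewrite -[x]mulmx1 -e mulmxDr !mulmxA xE xF !mul0mx addr0.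
Qed.

Lemma minkowski_qform (x y : 'rV[R]_r.+2) :
  qform G x y = dot (x *m E) (y *m E) - (x *m F) 0 0 * (y *m F) 0 0.
Proof.
have [-> _ _] := mG; rewrite /qform mulmxBr mulmxBl [LHS]mxE; congr (_ + _).
  by rewrite /dot trmx_mul !mulmxA.
by rewrite mxE !mulmxA -[_ *m y^T]mulmxA -trmx_mul mxE big_ord1 [X in _ * X]mxE.
Qed.

(** Pairing a vector of the radical with the time vector [k] kills its time coordinate; pairing it
    with its own spatial part then kills the rest. *)
Lemma minkowski_unit : G \in unitmx.
Proof.
rewrite -row_free_unit; apply: mulmx_row_eq0 => x xG.
have q y : qform G x y = 0 by rewrite /qform xG mul0mx mxE.
have [_ _ [KE KF kE kF]] := mG.
apply: minkowski_eq0; last first.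
  apply/matrixP => i j; rewrite !ord1 [RHS]mxE; have := q k.
  have k1 : (1%:M : 'M[R]_1) 0 0 = 1 by rewrite mxE eqxx.
  rewrite minkowski_qform kE kF k1 mulr1 /dot trmx0 mulmx0 [X in X - _]mxE sub0r.
  by move/eqP; rewrite oppr_eq0 => /eqP.
apply: dot_eq0; have := q (x *m E *m K).
by rewrite minkowski_qform -[_ *m K *m E]mulmxA KE mulmx1 -[_ *m K *m F]mulmxA KF mulmx0 [X in _ * X]mxE mulr0 subr0.
Qed.

Lemma minkowski_isotropic_time (x : 'rV[R]_r.+2) :
  qform G x x = 0 -> x *m F = 0 -> x = 0.
Proof.
move=> qx xF; apply: minkowski_eq0 => //; apply: dot_eq0.
by move: qx; rewrite minkowski_qform xF mxE mulr0 subr0.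
Qed.

End Signature.

Section Ambient.
Context {R : realType} {n : nat}.
Variable G : 'M[R]_n.
Local Notation N := (n + 1).+1.

(* The Gram matrix of [qform x x - 2 s t] in the coordinates [hvec s x t]. *)
Definition ambient : 'M[R]_N :=
  block_mx (0 : 'M[R]_1) (row_mx 0 (-1)%:M) (col_mx 0 (-1)%:M) (block_mx G 0 0 0).

Definition bil (u v : 'rV[R]_N) : R := (u *m ambient *m v^T) 0 0.

Definition mid_mx : 'M[R]_(N, n) := col_mx (0 : 'M[R]_(1, n)) (col_mx 1%:M 0).

Lemma hvec_mid s t (x : 'rV[R]_n) : hvec s x t *m mid_mx = x.
Proof.
rewrite /hvec /mid_mx (@mul_row_col _ 1 1 (n + 1)) mulmx0 add0r mul_row_col.
by rewrite mulmx1 mulmx0 addr0.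
Qed.

Lemma hvec00 s t (x : 'rV[R]_n) : hvec s x t 0 0 = s.
Proof.
rewrite /hvec (_ : 0 = lshift (n + 1) (0 : 'I_1)); last exact: val_inj.
by rewrite (@row_mxEl _ 1 1 (n + 1)) mxE eqxx.
Qed.

Lemma hvecD s s' t t' (x x' : 'rV[R]_n) :
  hvec s x t + hvec s' x' t' = hvec (s + s') (x + x') (t + t').
Proof.
rewrite /hvec; apply: etrans (@add_row_mx R 1 1 (n + 1) _ _ _ _) _.
by rewrite add_row_mx -!raddfD.
Qed.

Lemma hvec_dot s s' t t' (x x' : 'rV[R]_n) :
  dot (hvec s x t) (hvec s' x' t') = s * s' + dot x x' + t * t'.
Proof.
rewrite /dot /hvec (@tr_row_mx _ 1 1 (n + 1)) (@mul_row_col _ 1 1 (n + 1)).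
rewrite tr_row_mx mul_row_col !tr_scalar_mx -!scalar_mxM !mxE eqxx !mulr1n.
by rewrite addrA.
Qed.

Lemma hvec_ambient s t (x : 'rV[R]_n) : hvec s x t *m ambient = hvec (- t) (x *m G) (- s).
Proof.
rewrite /hvec /ambient; apply: etrans (@mul_row_block _ 1 1 (n + 1) 1 (n + 1) _ _ _ _ _ _) _.
rewrite mulmx0 add0r mul_row_col mulmx0 add0r mul_mx_row mulmx0 mul_row_block !mulmx0 !addr0.
by rewrite add_row_mx add0r addr0 -!scalar_mxM !mulrN1.
Qed.

Lemma bil_hvec s s' t t' (x x' : 'rV[R]_n) :
  bil (hvec s x t) (hvec s' x' t') = qform G x x' - s * t' - t * s'.
Proof.
rewrite /bil hvec_ambient -/(dot _ _) hvec_dot /qform -/(dot _ _); ring.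
Qed.

Lemma bilZl c u v : bil (c *: u) v = c * bil u v.
Proof. by rewrite /bil -!scalemxAl mxE. Qed.

Lemma bilZr c u v : bil u (c *: v) = c * bil u v.
Proof. by rewrite /bil linearZ/= -scalemxAr mxE. Qed.

Lemma bilC u v : G^T = G -> bil u v = bil v u.
Proof.
move=> Gs; have [s [x [t ->]]] := hvecE u; have [s' [x' [t' ->]]] := hvecE v.
rewrite !bil_hvec; suff -> : qform G x x' = qform G x' x by ring.
by rewrite /qform -[in RHS](trmxK (x' *m G *m x^T)) [in RHS]mxE !trmx_mul trmxK Gs mulmxA.
Qed.

Lemma ambient_sym : G^T = G -> ambient^T = ambient.
Proof.
move=> Gs; apply/matrixP => i j; rewrite mxE.
have E a b : ambient a b = bil (delta_mx 0 a) (delta_mx 0 b).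
  by rewrite /bil trmx_delta -rowE -colE !mxE.
by rewrite !E bilC.
Qed.

Lemma ambient_unit : G \in unitmx -> ambient \in unitmx.
Proof.
move=> Gu; rewrite -row_free_unit; apply: mulmx_row_eq0 => v.
have [s [x [t ->]]] := hvecE v.
rewrite hvec_ambient => /hvec_eq0[/eqP t0 /eqP xG /eqP s0].
move: t0 s0 xG; rewrite !oppr_eq0 mulmx_free_eq0 ?row_free_unit// => /eqP -> /eqP -> /eqP ->.
exact: hvec0.
Qed.

(** The quadratic form is affine in the last coordinate, with slope -2 x^0: where x^0 != 0 its value
    determines that coordinate. *)
Lemma hvecP (u v : 'rV[R]_N) : u 0 0 = v 0 0 -> u *m mid_mx = v *m mid_mx ->
  bil u u = bil v v -> u 0 0 != 0 -> u = v.
Proof.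
have [s [x [t ->]]] := hvecE u; have [s' [x' [t' ->]]] := hvecE v.
rewrite !hvec00 !hvec_mid !bil_hvec => <- <- h s0; congr hvec.
by apply: (mulfI s0); lra.
Qed.

End Ambient.

(** * Charts and the Darboux mapping *)

Section Charts.
Context {R : realType} {n : nat}.
Variable G : 'M[R]_n.
Hypotheses (Gs : G^T = G) (Gu : G \in unitmx).
Local Notation N := (n + 1).+1.
Local Notation g := (qform G).

Lemma qformC (x y : 'rV[R]_n) : g x y = g y x.
Proof.
by rewrite /qform -[in RHS](trmxK (y *m G *m x^T)) [in RHS]mxE !trmx_mul trmxK Gs mulmxA.
Qed.

Lemma qformDl (x y z : 'rV[R]_n) : g (x + y) z = g x z + g y z.
Proof. by rewrite /qform !mulmxDl mxE. Qed.

Lemma qformDr (x y z : 'rV[R]_n) : g z (x + y) = g z x + g z y.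
Proof. by rewrite /qform linearD/= mulmxDr mxE. Qed.

Lemma qformZl c (x z : 'rV[R]_n) : g (c *: x) z = c * g x z.
Proof. by rewrite /qform -!scalemxAl mxE. Qed.

Lemma qformZr c (x z : 'rV[R]_n) : g z (c *: x) = c * g z x.
Proof. by rewrite /qform linearZ/= -scalemxAr mxE. Qed.

Definition flift (x : 'rV[R]_n) : 'rV[R]_N := hvec 1 x (g x x / 2).

(** The linear isometry behind a chart. Exchanging x^0 and x^(n+1) induces the inversion w |-> 2 w /
    g(w, w) on the quadric; it is followed by the isometry that induces the translation by [p]. *)
Definition chart_mx (c : option 'rV[R]_n) : 'M[R]_N :=
  if c is Some p then
    col_mx (row_mx (0 : 'M[R]_1) (row_mx 0 1%:M))
      (col_mx (row_mx 0 (row_mx 1%:M (p *m G)^T))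
              (row_mx 1%:M (row_mx p (g p p / 2)%:M)))
  else 1%:M.

Lemma chart_mx_Some p s t (x : 'rV[R]_n) :
  hvec s x t *m chart_mx (Some p) = hvec t (t *: p + x) (t * (g p p / 2) + g p x + s).
Proof.
rewrite /chart_mx /hvec; apply: etrans (@mul_row_col _ 1 1 (n + 1) N _ _ _ _) _.
rewrite mul_row_col (@mul_mx_row _ 1 1 1 (n + 1)) (@mul_mx_row _ 1 n 1 (n + 1)).
rewrite (@mul_mx_row _ 1 1 1 (n + 1)) !mul_mx_row.
rewrite !(@add_row_mx _ 1 1 (n + 1)) !add_row_mx !mulmx0 !add0r !mulmx1 mul_scalar_mx.
rewrite [x + _]addrC; have -> : x *m (p *m G)^T = (g p x)%:M.
  rewrite [LHS]mx11_scalar /qform -[in RHS](trmxK (p *m G *m x^T)) [in RHS]mxE.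
  by rewrite [in RHS]trmx_mul trmxK.
have -> : t * (g p p / 2) + g p x + s = s + (g p x + t * (g p p / 2)) by ring.
by rewrite -scalar_mxM -!raddfD.
Qed.

Lemma bil_chart_mx c u v : bil G (u *m chart_mx c) (v *m chart_mx c) = bil G u v.
Proof.
case: c => [p|]; last by rewrite !mulmx1.
have [s [x [t ->]]] := hvecE u; have [s' [x' [t' ->]]] := hvecE v.
rewrite !chart_mx_Some !bil_hvec !(qformDl, qformDr, qformZl, qformZr).
by rewrite (qformC x p); field.
Qed.

Lemma chart_mx_unit c : chart_mx c \in unitmx.
Proof.
case: c => [p|]; last exact: unitmx1.
rewrite -row_free_unit; apply: mulmx_row_eq0 => v.
have [s [x [t ->]]] := hvecE v; rewrite chart_mx_Some => /hvec_eq0[t0].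
rewrite t0 scale0r add0r => x0; rewrite x0 mul0r add0r.
have -> : g p 0 = 0 by rewrite /qform trmx0 mulmx0 mxE.
by rewrite add0r => ->; rewrite hvec0.
Qed.

Lemma flift_neq0 x : flift x != 0.
Proof. exact: fin_neq0. Qed.

Lemma flift_chart_neq0 c x : flift x *m chart_mx c != 0.
Proof.
apply: contra_neq (flift_neq0 x) => h.
by rewrite -(mulmxK (chart_mx_unit c) (flift x)) h mul0mx.
Qed.

Lemma bil_flift x : bil G (flift x) (flift x) = 0.
Proof. by rewrite bil_hvec; field. Qed.

Lemma darboux_Ideal_pt c y (h : ideal_cone G (pt (ideal_vec c y))) :
  ideal_vec c y != 0 -> darboux (Ideal h) = pt (hvec 0 y c).
Proof.
move=> i0 /=; have [k] : exists k, rep (pt (ideal_vec c y)) = k *: ideal_vec c y.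
  by apply: pt_eqP => //; [exact: rep_neq0|rewrite pt_rep].
move=> ec; have k0 : k != 0.
  by apply/eqP => k0; move: (rep_neq0 (pt (ideal_vec c y))); rewrite ec k0 scale0r eqxx.
have h0 : hvec 0 y c != 0.
  apply: contra_neq i0 => /hvec_eq0[_ -> ->].
  by rewrite /ideal_vec raddf0 row_mx0.
apply: (pt_eq h0 k0); rewrite hvecZ ec !linearZ/= mulr0 mxE row_mxKr row_mxKl.
by congr (hvec _ _ (_ * _)); rewrite mxE eqxx.
Qed.

(** In an inversion chart the coordinate x^0 of the image is g(x, x) / 2. Its vanishing is exactly
    the ideal case of [inversion]; otherwise, dividing by it gives the inversion formula. *)
Lemma darboux_chart c x : darboux (chart G c x) = pt (flift x *m chart_mx c).
Proof.
case: c => [p|]; last by rewrite mulmx1.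
rewrite /chart /inversion chart_mx_Some; case: pselect => [gx|gx].
  rewrite darboux_Ideal_pt; last exact: inversion_ideal.
  rewrite gx mul0r scale0r mul0r !add0r addrC; congr (pt (hvec _ _ _)).
have q0 : g x x != 0 by exact/eqP.
have c0 : 2 / g x x != 0 by rewrite mulf_neq0// invr_eq0.
rewrite /=; apply: (@pt_eq _ _ _ _ (2 / g x x)) => //.
  by apply/eqP => /hvec_eq0[/eqP]; rewrite mulf_eq0 (negbTE q0)/= invr_eq0 pnatr_eq0.
rewrite hvecZ scalerDr scalerA !(qformDl, qformDr, qformZl, qformZr) (qformC x p).
have e1 : 2 / g x x * (g x x / 2) = 1 by field.
rewrite e1 scale1r; congr hvec; field.
exact: q0.
Qed.

Lemma darboux_quadricE v : v != 0 -> darboux_quadric G (pt v) <-> bil G v v = 0.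
Proof.
move=> v0; rewrite /darboux_quadric /= val_pt//; split=> [h|h s x t].
  have [s [x [t e]]] := hvecE v; rewrite e bil_hvec -(h s x t); first by ring.
  by rewrite -e memv_line.
move=> /vlineP[k]; have [s' [x' [t' e]]] := hvecE v.
rewrite e hvecZ => /hvec_inj[-> -> ->].
by move: h; rewrite e bil_hvec qformZl qformZr => h; rewrite -[RHS](mulr0 (k * k)) -h; ring.
Qed.

(** If x^0 = 0, the inversion centred at the origin makes [v] finite when x^(n+1) != 0. Otherwise x
    != 0, and any centre [y] with g(y, x) != 0 works, because the new x^0 is -g(y, x). *)
Lemma chart_cover (v : 'rV[R]_N) : v != 0 -> exists c : option 'rV[R]_n, (v *m invmx (chart_mx c)) 0 0 != 0.
Proof.
have [s [x [t ->]]] := hvecE v => v0.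
have [s0|s0] := eqVneq s 0; last by exists None; rewrite invmx1 mulmx1 hvec00.
have E p : hvec s x t *m invmx (chart_mx (Some p)) = hvec (t - s * (g p p / 2) - g p (x - s *: p)) (x - s *: p) s.
  rewrite -[RHS](mulmxK (chart_mx_unit (Some p))) chart_mx_Some; congr (hvec _ _ _ *m _).
    by rewrite addrC subrK.
  by ring.
have [t0|t0] := eqVneq t 0; last first.
  exists (Some 0); rewrite E hvec00 s0 mul0r subr0.
  by rewrite (_ : g 0 _ = 0) ?subr0// /qform !mul0mx mxE.
have x0 : x != 0 by apply: contra_neq v0 => ->; rewrite s0 t0 hvec0.
have [y gy] : exists y, g y x != 0.
  exists (x *m invmx G); rewrite /qform mulmxKV//; exact: contra_neq (@dot_eq0 _ _ x) x0.
exists (Some y); rewrite E hvec00 s0 t0 mul0r subr0 sub0r scale0r subr0.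
by rewrite oppr_eq0.
Qed.

(** Inverse of the chart [c], read on homogeneous vectors. It is meaningful where the leading
    coordinate in that chart is nonzero and takes the value 0 elsewhere. *)
Definition chart_coord c (v : 'rV[R]_N) : 'rV[R]_n :=
  ((v *m invmx (chart_mx c)) 0 0)^-1 *: (v *m invmx (chart_mx c) *m mid_mx).

Lemma chart_coordE c v : bil G v v = 0 -> (v *m invmx (chart_mx c)) 0 0 != 0 ->
  v = (v *m invmx (chart_mx c)) 0 0 *: (flift (chart_coord c v) *m chart_mx c).
Proof.
move=> bv; rewrite /chart_coord; set u := v *m invmx _ => u0.
have vE : v = u *m chart_mx c by rewrite mulmxKV// chart_mx_unit.
rewrite [LHS]vE scalemxAl; congr (_ *m _); apply: (@hvecP _ _ G _ _ _ _ _ u0).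
- by rewrite [RHS]mxE /flift hvec00 mulr1.
- by rewrite -scalemxAl hvec_mid scalerA divff// scale1r.
rewrite bilZl bilZr bil_flift !mulr0.
by rewrite -(bil_chart_mx c) -vE.
Qed.

Lemma chart_coord_flift c x k : k != 0 -> chart_coord c (k *: (flift x *m chart_mx c)) = x.
Proof.
move=> k0; rewrite /chart_coord -scalemxAl mulmxK ?chart_mx_unit// mxE hvec00 mulr1.
by rewrite -scalemxAl hvec_mid scalerA mulVf// scale1r.
Qed.

Lemma darboux_inj (p q : cspace G) : darboux p = darboux q -> p = q.
Proof.
by move=> e; have [_ inj _] := darboux_bij G; apply: inj => //; rewrite inE.
Qed.

Lemma chart_surj (q : cspace G) : exists c x, q = chart G c x.
Proof.
have [im _ _] := darboux_bij G.
have [v v0 qE] : exists2 v, v != 0 & darboux q = pt v.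
  by exists (rep (darboux q)); [exact: rep_neq0|rewrite pt_rep].
have bv : bil G v v = 0 by apply/(darboux_quadricE v0); rewrite -qE; exact: im.
have [c c0] := chart_cover v0; exists c, (chart_coord c v); apply: darboux_inj.
by rewrite darboux_chart qE; apply: pt_eq c0 (chart_coordE bv c0); exact: flift_chart_neq0.
Qed.

End Charts.

(** * The Darboux mapping is open onto the quadric *)

Section DarbouxTopology.
Context {R : realType} {n : nat}.
Variable G : 'M[R]_n.
Hypotheses (Gs : G^T = G) (Gu : G \in unitmx).
Local Notation N := (n + 1).+1.

Lemma chart_coordZ c k (v : 'rV[R]_N) : k != 0 -> chart_coord G c (k *: v) = chart_coord G c v.
Proof.
move=> k0; rewrite /chart_coord -!scalemxAl scalerA mxE invfM.
by rewrite mulrAC mulVf// mul1r.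
Qed.

Lemma pt_repE k (v : 'rV[R]_k.+1) : v != 0 -> exists2 t, t != 0 & rep (pt v) = t *: v.
Proof.
move=> v0; have [t e] : exists t, rep (pt v) = t *: v.
  by apply: pt_eqP => //; [exact: rep_neq0|rewrite pt_rep].
exists t => //; apply/eqP => t0; move: (rep_neq0 (pt v)).
by rewrite e t0 scale0r eqxx.
Qed.

Lemma open_preimage_on (T S : topologicalType) (D : set T) (f : T -> S) (O : set S) :
  open D -> (forall x, D x -> {for x, continuous f}) -> open O ->
  open [set x | D x /\ O (f x)].
Proof.
move=> oD cf oO; rewrite openE => x [Dx Ofx]; rewrite /interior.
have nD : nbhs x D by exact: open_nbhs_nbhs.
have nO : nbhs (f x) O by exact: open_nbhs_nbhs.
have := cf x Dx O nO; exact: filterI nD.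
Qed.

Lemma mulmx_continuous m p q (M : 'M[R]_(p, q)) : continuous (fun v : 'M[R]_(m, p) => v *m M).
Proof.
move=> v; apply/differentiable_continuous/differentiable_mulmxr.
exact: (@ex_diff _ _ _ _ _ _ _ (is_diff_id v)).
Qed.

(** This carries relatively open subsets of a hypersurface to relatively open subsets of its image.
    The set [O'] is defined in the whole projective space, by asking that some chart coordinate, a
    continuous function homogeneous of degree 0, lie in [O]; on the quadric all charts agree. *)
Lemma darboux_open (O : set (cspace G)) : open O ->
  exists2 O' : set (pspace R (n + 1)), open O' & forall q, O q <-> O' (darboux q).
Proof.
move=> oO; pose D c := [set v : 'rV[R]_N | (v *m invmx (chart_mx G c)) 0 0 != 0].
have oD c : open (D c).
  have -> : D c = (fun v : 'rV[R]_N => (v *m invmx (chart_mx G c)) 0 0) @^-1` [set t | t != 0] by [].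
  apply: open_comp; last exact: open_neq.
  move=> v _; apply: (@continuous_comp _ _ _ (fun v : 'rV[R]_N => v *m invmx (chart_mx G c)) (fun w => w 0 0)).
    exact: mulmx_continuous.
  exact: coord_continuous.
pose O' := [set p : pspace R (n + 1) | exists c, D c (rep p) /\ O (chart G c (chart_coord G c (rep p)))].
have O'E v : v != 0 -> O' (pt v) <-> exists c, D c v /\ (chart G c @^-1` O) (chart_coord G c v).
  move=> v0; have [t t0 e] := pt_repE v0.
  have De c : D c (rep (pt v)) <-> D c v.
    by rewrite /D/= e -scalemxAl mxE mulf_eq0 (negbTE t0).
  by split=> -[c [/De Dv Ov]]; exists c; split=> //; move: Ov; rewrite e chart_coordZ.
exists O'.
  rewrite /open/= /pspace_open.
  have -> : [set v : 'rV[R]_N | v != 0 /\ O' (pt v)] =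
      \bigcup_c [set v | D c v /\ (chart G c @^-1` O) (chart_coord G c v)].
    apply/seteqP; split=> v /=.
      by move=> [v0 /(O'E _ v0)[c ?]]; exists c.
    move=> [c _ [Dv Ov]]; have v0 : v != 0.
      by apply/eqP => v0; move: Dv; rewrite /D/= v0 mul0mx mxE eqxx.
    by split=> //; apply/(O'E _ v0); exists c.
  apply: bigcup_open => c _; apply: open_preimage_on => [//|v Dv|]; last exact: oO.
  rewrite /chart_coord; apply: continuousZ.
    apply: continuousV => //.
    apply: (@continuous_comp _ _ _ (fun v : 'rV[R]_N => v *m invmx (chart_mx G c)) (fun w => w 0 0)).
      exact: mulmx_continuous.
    exact: coord_continuous.
  apply: (@continuous_comp _ _ _ (fun v : 'rV[R]_N => v *m invmx (chart_mx G c)) (fun w => w *m mid_mx)).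
    exact: mulmx_continuous.
  exact: mulmx_continuous.
move=> q; split=> [Oq|].
  have [c [x qE]] := chart_surj Gs Gu q.
  rewrite qE darboux_chart//; apply/O'E; first exact: flift_chart_neq0.
  exists c; rewrite /D/= mulmxK ?chart_mx_unit// hvec00 oner_neq0; split=> //.
  by rewrite -[flift G x *m _]scale1r chart_coord_flift ?oner_neq0// -qE.
move=> [c [Dv Ov]]; suff -> : q = chart G c (chart_coord G c (rep (darboux q))) by [].
have v0 := rep_neq0 (darboux q); apply: darboux_inj.
rewrite darboux_chart// -[LHS]pt_rep; apply: (@pt_eq _ _ _ _ _ _ Dv).
  exact: flift_chart_neq0.
apply: (chart_coordE Gs) => //; apply/(darboux_quadricE _ v0); rewrite pt_rep.
by have [im _ _] := darboux_bij G; exact: im.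
Qed.

End DarbouxTopology.

(** * Derivatives of homogeneous lifts *)

Section AmbientCalculus.
Context {R : realType} {n : nat}.
Variable G : 'M[R]_n.
Local Notation N := (n + 1).+1.

Lemma differentiable_row_mx (V : normedModType R) m n1 n2 (M : V -> 'M[R]_(m, n1))
    (M' : V -> 'M[R]_(m, n2)) x :
  differentiable M x -> differentiable M' x -> differentiable (fun y => row_mx (M y) (M' y)) x.
Proof.
move=> dM dM'; apply/differentiable_mxP => i j.
case: (split_ordP j) => k ->.
  rewrite (_ : (fun y => _) = (fun y => M y i k)); last by apply/funext => y; rewrite row_mxEl.
  exact: (differentiable_mxP _ _).1.
rewrite (_ : (fun y => _) = (fun y => M' y i k)); last by apply/funext => y; rewrite row_mxEr.
exact: (differentiable_mxP _ _).1.
Qed.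

Lemma derive_row_mx (V : normedModType R) m n1 n2 (M : V -> 'M[R]_(m, n1))
    (M' : V -> 'M[R]_(m, n2)) x v :
  differentiable M x -> differentiable M' x ->
  'D_v (fun y => row_mx (M y) (M' y)) x = row_mx ('D_v M x) ('D_v M' x).
Proof.
move=> dM dM'; have dr := differentiable_row_mx dM dM'.
rewrite !derive_mx; [|exact: diff_derivable..].
apply/matrixP => i j; rewrite mxE; case: (split_ordP j) => k ->.
  rewrite (_ : (fun y => _) = (fun y => M y i k)); last by apply/funext => y; rewrite row_mxEl.
  by rewrite row_mxEl mxE.
rewrite (_ : (fun y => _) = (fun y => M' y i k)); last by apply/funext => y; rewrite row_mxEr.
by rewrite row_mxEr mxE.
Qed.

Lemma scalar_mx_entry (T : Type) (f : T -> R) (i j : 'I_1) :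
  (fun y => (f y)%:M i j) = f.
Proof. by apply/funext => y; rewrite !ord1 mxE eqxx. Qed.

Lemma differentiable_scalar_mx (V : normedModType R) (f : V -> R) x :
  differentiable f x -> differentiable (fun y => (f y)%:M : 'M[R]_1) x.
Proof. by move=> df; apply/differentiable_mxP => i j; rewrite scalar_mx_entry. Qed.

Lemma derive_scalar_mx (V : normedModType R) (f : V -> R) x v :
  differentiable f x -> 'D_v (fun y => (f y)%:M : 'M[R]_1) x = ('D_v f x)%:M.
Proof.
move=> df; rewrite derive_mx; last exact/diff_derivable/differentiable_scalar_mx.
by apply/matrixP => i j; rewrite mxE scalar_mx_entry !ord1 mxE eqxx.
Qed.

Lemma differentiable_hvec (V : normedModType R) (s t : V -> R) (x : V -> 'rV[R]_n) u :
  differentiable s u -> differentiable x u -> differentiable t u ->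
  differentiable (fun y => hvec (s y) (x y) (t y)) u.
Proof.
move=> ds dx dt; apply: (@differentiable_row_mx V 1 1 (n + 1)).
  exact: differentiable_scalar_mx.
by apply: differentiable_row_mx => //; exact: differentiable_scalar_mx.
Qed.

Lemma derive_hvec (V : normedModType R) (s t : V -> R) (x : V -> 'rV[R]_n) u v :
  differentiable s u -> differentiable x u -> differentiable t u ->
  'D_v (fun y => hvec (s y) (x y) (t y)) u = hvec ('D_v s u) ('D_v x u) ('D_v t u).
Proof.
move=> ds dx dt; rewrite /hvec.
have dst := differentiable_scalar_mx ds; have dtt := differentiable_scalar_mx dt.
have dxt := differentiable_row_mx dx dtt.
apply: etrans (@derive_row_mx V 1 1 (n + 1) _ _ _ _ dst dxt) _.
by rewrite derive_row_mx// !derive_scalar_mx.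
Qed.

Lemma derive_mulmxr (V : normedModType R) m p q (M : V -> 'M[R]_(m, p)) (B : 'M[R]_(p, q)) x v :
  differentiable M x -> 'D_v (fun y => M y *m B) x = 'D_v M x *m B.
Proof.
move=> dM; have dB : differentiable (fun y : V => B) x by exact: differentiable_cst.
by rewrite derive_mulmx// derive_cst mulmx0 addr0.
Qed.

Lemma differentiable_form (V : normedModType R) m (B : 'M[R]_m) (x y : V -> 'rV[R]_m) u :
  differentiable x u -> differentiable y u ->
  differentiable (fun z => (x z *m B *m (y z)^T) 0 0) u.
Proof.
move=> dx dy; apply: (differentiable_mxP _ _).1.
by apply: differentiable_mulmx; [exact: differentiable_mulmxr|exact: differentiable_trmx].
Qed.

Lemma derive_form (V : normedModType R) m (B : 'M[R]_m) (x y : V -> 'rV[R]_m) u v :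
  differentiable x u -> differentiable y u ->
  'D_v (fun z => (x z *m B *m (y z)^T) 0 0) u =
  ('D_v x u *m B *m (y u)^T) 0 0 + (x u *m B *m ('D_v y u)^T) 0 0.
Proof.
move=> dx dy; have dxB := differentiable_mulmxr B dx; have dyT := differentiable_trmx dy.
rewrite -(derive_mxE _ _ _ (differentiable_mulmx dxB dyT)) derive_mulmx//.
by rewrite derive_mulmxr// derive_trmx// mxE.
Qed.

Section SmoothLift.
Variables (r : nat) (A : set 'rV[R]_r).
Hypothesis oA : open A.

Lemma smooth_hvec (s t : 'rV[R]_r -> R) (x : 'rV[R]_r -> 'rV[R]_n) :
  smooth_on A s -> smooth_on A x -> smooth_on A t ->
  smooth_on A (fun u => hvec (s u) (x u) (t u)).
Proof.
move=> ss sx st; apply: (@smooth_row_mx _ _ _ oA 1 1 (n + 1)).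
  exact: smooth_scalar.
by apply: smooth_row_mx => //; exact: smooth_scalar.
Qed.

Lemma smooth_qform (x y : 'rV[R]_r -> 'rV[R]_n) :
  smooth_on A x -> smooth_on A y -> smooth_on A (fun u => qform G (x u) (y u)).
Proof.
move=> sx sy; apply: ((smooth_mxP oA _).1 _ 0 0).
by apply: smooth_mulmx => //; [exact: smooth_mulmxr|exact: smooth_trmx].
Qed.

Lemma smooth_flift (x : 'rV[R]_r -> 'rV[R]_n) :
  smooth_on A x -> smooth_on A (fun u => flift G (x u)).
Proof.
move=> sx; apply: smooth_hvec => //; first exact: smooth_cst.
by apply: smoothM => //; [exact: smooth_qform|exact: smooth_cst].
Qed.

End SmoothLift.
End AmbientCalculus.

(** * Frames of line families *)

Section Frames.
Context {R : realType}.

Lemma col_mx_entryu (T : Type) m1 m2 n (M : T -> 'M[R]_(m1, n)) (M' : T -> 'M[R]_(m2, n)) i j :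
  (fun y => col_mx (M y) (M' y) (lshift m2 i) j) = (fun y => M y i j).
Proof. by apply/funext => y; rewrite col_mxEu. Qed.

Lemma col_mx_entryd (T : Type) m1 m2 n (M : T -> 'M[R]_(m1, n)) (M' : T -> 'M[R]_(m2, n)) i j :
  (fun y => col_mx (M y) (M' y) (rshift m1 i) j) = (fun y => M' y i j).
Proof. by apply/funext => y; rewrite col_mxEd. Qed.

Lemma differentiable_col_mx (V : normedModType R) m1 m2 n (M : V -> 'M[R]_(m1, n))
    (M' : V -> 'M[R]_(m2, n)) x :
  differentiable M x -> differentiable M' x -> differentiable (fun y => col_mx (M y) (M' y)) x.
Proof.
move=> dM dM'; apply/differentiable_mxP => i j; case: (split_ordP i) => k ->.
  by rewrite col_mx_entryu; exact: (differentiable_mxP _ _).1.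
by rewrite col_mx_entryd; exact: (differentiable_mxP _ _).1.
Qed.

Lemma derive_col_mx (V : normedModType R) m1 m2 n (M : V -> 'M[R]_(m1, n))
    (M' : V -> 'M[R]_(m2, n)) x v :
  differentiable M x -> differentiable M' x ->
  'D_v (fun y => col_mx (M y) (M' y)) x = col_mx ('D_v M x) ('D_v M' x).
Proof.
move=> dM dM'; have dc := differentiable_col_mx dM dM'.
rewrite !derive_mx; [|exact: diff_derivable..].
apply/matrixP => i j; rewrite mxE; case: (split_ordP i) => k ->.
  by rewrite col_mx_entryu col_mxEu mxE.
by rewrite col_mx_entryd col_mxEd mxE.
Qed.

Lemma mul_rV2_col k (z : 'rV[R]_2) (x y : 'rV[R]_k) :
  z *m (col_mx x y : 'M[R]_(1 + 1, k)) = z 0 0 *: x + z 0 1 *: y.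
Proof.
apply/rowP => j; rewrite !mxE big_ord_recl big_ord1; congr (_ * _ + _ * _).
- transitivity (col_mx x y (lshift 1 0) j); last exact: col_mxEu.
  by congr (col_mx x y _ j); exact: val_inj.
- by congr (z 0 _); exact: val_inj.
transitivity (col_mx x y (rshift 1 0) j); last exact: col_mxEd.
by congr (col_mx x y _ j); exact: val_inj.
Qed.

Lemma row_comb m k (M M' : 'M[R]_(m, k)) c c' i :
  row i (c *: M + c' *: M') = c *: row i M + c' *: row i M'.
Proof. by rewrite linearD !linearZ. Qed.

Lemma comb_congr k (x x' y y' : 'rV[R]_k) (c c' : R) :
  x = x' -> y = y' -> c *: x + c' *: y = c *: x' + c' *: y'.
Proof. by move=> -> ->. Qed.

Lemma add_congr k (x x' y y' : 'rV[R]_k) : x = x' -> y = y' -> x + y = x' + y'.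
Proof. by move=> -> ->. Qed.

Lemma rank_unit_mul m k (M : 'M[R]_m) (B : 'M[R]_(m, k)) :
  M \in unitmx -> \rank (M *m B) = \rank B.
Proof. by move=> Mu; rewrite eqmxMfull// row_full_unit. Qed.

Lemma row_dline r k (a b : 'rV[R]_r -> 'rV[R]_k.+1) u z i :
  differentiable a u -> differentiable b u ->
  row i (dline a b u z) = z 0 0 *: 'D_(delta_mx 0 i) a u + z 0 1 *: 'D_(delta_mx 0 i) b u.
Proof.
move=> da db; apply: etrans (row_comb _ _ _ _ _) _.
by apply: comb_congr; exact: row_jacobian.
Qed.

Lemma row_dline_span r k (a b : 'rV[R]_r -> 'rV[R]_k.+1) u z i :
  differentiable a u -> differentiable b u ->
  row i (dline a b u z) = z *m 'D_(delta_mx 0 i) (span_mx a b) u.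
Proof. by move=> da db; rewrite row_dline// derive_col_mx// mul_rV2_col. Qed.

(** The derivative of [P] only adds combinations of the rows of [span_mx a b u] to the derivatives
    of the points. These are absorbed by a block triangular invertible matrix, and the point with
    coordinates [z] in the new frame has coordinates [z *m P u] in the old one. *)
Lemma frame_change r k (a b a' b' : 'rV[R]_r -> 'rV[R]_k.+1) (P : 'rV[R]_r -> 'M[R]_2) u z :
  differentiable a u -> differentiable b u -> differentiable a' u -> differentiable b' u ->
  differentiable P u -> P u \in unitmx ->
  (\forall u' \near u, span_mx a' b' u' = P u' *m span_mx a b u') ->
  \rank (tangent_mx a' b' u z) = \rank (tangent_mx a b u (z *m P u)).
Proof.
move=> da db da' db' dP Pu nE.
pose E : 'M[R]_(r, 2) := \matrix_(i, j) (z *m 'D_(delta_mx 0 i) P u) 0 j.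
have ds : differentiable (span_mx a b) u := differentiable_col_mx da db.
have spanE : span_mx a' b' u = P u *m span_mx a b u by exact: nbhs_singleton nE.
have dlE : dline a' b' u z = E *m span_mx a b u + dline a b u (z *m P u).
  apply/row_matrixP => i; have rowD (X Y : 'M[R]_(r, k.+1)) : row i (X + Y) = row i X + row i Y by rewrite linearD.
  apply: etrans (row_dline_span z i da' db') _; apply: etrans _ (esym (rowD _ _)).
  apply: etrans _ (add_congr (esym (row_mul i E _)) (esym (row_dline_span _ i da db))).
  have -> : row i E = z *m 'D_(delta_mx 0 i) P u by apply/rowP => j; rewrite !mxE.
  have -> : 'D_(delta_mx 0 i) (span_mx a' b') u =
      'D_(delta_mx 0 i) P u *m span_mx a b u + P u *m 'D_(delta_mx 0 i) (span_mx a b) u.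
    by rewrite -(derive_mulmx _ dP ds); exact: near_eq_derive.
  by rewrite mulmxDr !mulmxA.
have -> : tangent_mx a' b' u z =
    (block_mx (P u) 0 E 1%:M : 'M[R]_(2 + r)) *m tangent_mx a b u (z *m P u).
  by rewrite /tangent_mx mul_block_col spanE dlE mul0mx addr0 mul1mx.
apply: (@rank_unit_mul (2 + r) k.+1); rewrite unitmxE det_lblock det1 mulr1.
by rewrite -unitmxE.
Qed.

Lemma tangent_mx_abs r k (x y : 'rV[R]_k) (X Y : 'M[R]_(r, k)) (M : 'M[R]_k) c c' :
  col_mx (col_mx (x *m M) (y *m M)) (c *: (X *m M) + c' *: (Y *m M)) =
  col_mx (col_mx x y) (c *: X + c' *: Y) *m M.
Proof. by rewrite !mul_col_mx mulmxDl -!scalemxAl. Qed.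

Lemma tangent_mx_mulmx r k (a b : 'rV[R]_r -> 'rV[R]_k.+1) (M : 'M[R]_k.+1) u z :
  differentiable a u -> differentiable b u ->
  tangent_mx (fun u => a u *m M) (fun u => b u *m M) u z = tangent_mx a b u z *m M.
Proof.
move=> da db; rewrite /tangent_mx /span_mx /dline !jacobian_mulmx//.
exact: tangent_mx_abs.
Qed.

Lemma scale_comb m k (X Y : 'M[R]_(m, k)) (z : 'rV[R]_2) c :
  (c *: z) 0 0 *: X + (c *: z) 0 1 *: Y = c *: (z 0 0 *: X + z 0 1 *: Y).
Proof. by rewrite !mxE scalerDr !scalerA. Qed.

Lemma rank_tangent_scale r k (a b : 'rV[R]_r -> 'rV[R]_k.+1) u z c : c != 0 ->
  \rank (tangent_mx a b u (c *: z)) = \rank (tangent_mx a b u z).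
Proof.
move=> c0; have -> : tangent_mx a b u (c *: z) =
    (block_mx 1%:M 0 0 c%:M : 'M[R]_(2 + r)) *m tangent_mx a b u z.
  rewrite /tangent_mx mul_block_col mul1mx !mul0mx addr0 add0r mul_scalar_mx; congr col_mx.
  exact: scale_comb.
apply: (@rank_unit_mul (2 + r) k.+1); rewrite unitmxE det_ublock det1 mul1r.
by rewrite det_scalar unitrX// unitfE.
Qed.

End Frames.

(** * Lifts of affine isotropic lines *)

Section Expression.
Context {R : realType} {n : nat}.
Variable G : 'M[R]_n.
Hypothesis Gs : G^T = G.
Local Notation N := (n + 1).+1.
Local Notation g := (qform G).

(** The derivative of [flift] at [x] along [w], which is also a vector of the ideal point of the
    line x + t w. *)
Definition fdir (x w : 'rV[R]_n) : 'rV[R]_N := hvec 0 w (g x w).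

Lemma flift_line (x w : 'rV[R]_n) t : g w w = 0 -> flift G (x + t *: w) = flift G x + t *: fdir x w.
Proof.
move=> w0; rewrite /flift /fdir hvecZ hvecD !(qformDl, qformDr, qformZl, qformZr) w0 mulr0 addr0.
by rewrite (qformC Gs w x); congr hvec; field.
Qed.

(* Its row space consists of the differentials of [flift] at [Y]. *)
Definition flift_diff (Y : 'rV[R]_n) : 'M[R]_(n, N) :=
  row_mx (0 : 'M[R]_(n, 1)) (row_mx 1%:M (Y *m G)^T).

Lemma mul_flift_diff (Y eta : 'rV[R]_n) : eta *m flift_diff Y = hvec 0 eta (g Y eta).
Proof.
rewrite /flift_diff /hvec; apply: etrans (@mul_mx_row _ 1 n 1 (n + 1) _ _ _) _.
rewrite mul_mx_row mulmx0 mulmx1 raddf0; congr (row_mx _ (row_mx _ _)).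
rewrite [LHS]mx11_scalar /qform -[in RHS](trmxK (Y *m G *m eta^T)) [in RHS]mxE.
by rewrite [in RHS]trmx_mul trmxK.
Qed.

Lemma rank_col_mxA m1 m2 m3 k (A1 : 'M[R]_(m1, k)) (A2 : 'M[R]_(m2, k)) (A3 : 'M[R]_(m3, k)) :
  \rank (col_mx (col_mx A1 A2) A3) = \rank (col_mx A1 (col_mx A2 A3)).
Proof. by rewrite [in RHS]col_mxA eqmx_cast. Qed.

(** The differentials of [flift] have x^0 = 0, so a vector with x^0 != 0 is independent of them; and
    [flift_diff Y] is injective. *)
Lemma rank_flift_diff m (Y : 'rV[R]_n) (X : 'M[R]_(m, n)) (a : 'rV[R]_N) : a 0 0 != 0 ->
  \rank (col_mx a (X *m flift_diff Y)) = (\rank X).+1.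
Proof.
move=> a0.
have fr : row_free (flift_diff Y).
  by apply: mulmx_row_eq0 => v; rewrite mul_flift_diff => /hvec_eq0[].
have an0 : a != 0 by apply: contra_neq a0 => ->; rewrite mxE.
rewrite -addsmxE mxrank_disjoint_sum ?rank_rV ?an0 ?add1n ?mxrankMfree//.
apply/eqP/rowV0P => v; rewrite sub_capmx => /andP[/sub_rVP[c ->] /submxP[y]].
rewrite mulmxA mul_flift_diff => /(congr1 (fun u : 'rV_N => u 0 0)).
rewrite hvec00 mxE => /eqP; rewrite mulf_eq0 (negbTE a0) orbF => /eqP ->.
by rewrite scale0r.
Qed.

Variable r : nat.
Implicit Types x w : 'rV[R]_r -> 'rV[R]_n.

Lemma half_qform x u : g (x u) (x u) / 2 = (x u *m (2^-1 *: G) *m (x u)^T) 0 0.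
Proof. by rewrite -scalemxAr -scalemxAl mxE mulrC. Qed.

Lemma differentiable_flift x u : differentiable x u -> differentiable (fun u => flift G (x u)) u.
Proof.
move=> dx; apply: differentiable_hvec => //.
rewrite (funext (half_qform x)); exact: differentiable_form.
Qed.

Lemma derive_flift x u v : differentiable x u ->
  'D_v (fun u => flift G (x u)) u = 'D_v x u *m flift_diff (x u).
Proof.
move=> dx; have dq : differentiable (fun u => g (x u) (x u) / 2) u.
  by rewrite (funext (half_qform x)); exact: differentiable_form.
rewrite derive_hvec//.
rewrite derive_cst mul_flift_diff; congr hvec.
rewrite (funext (half_qform x)) derive_form//.
have Q (y y' : 'rV[R]_n) : (y *m (2^-1 *: G) *m y'^T) 0 0 = 2^-1 * g y y'.
  by rewrite -scalemxAr -scalemxAl mxE.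
rewrite !Q (qformC Gs _ (x u)).
by field.
Qed.

Lemma differentiable_fdir x w u : differentiable x u -> differentiable w u ->
  differentiable (fun u => fdir (x u) (w u)) u.
Proof.
move=> dx dw; apply: differentiable_hvec => //.
exact: differentiable_form.
Qed.

Lemma derive_fdir x w u v : differentiable x u -> differentiable w u ->
  'D_v (fun u => fdir (x u) (w u)) u = hvec 0 ('D_v w u) (g ('D_v x u) (w u) + g (x u) ('D_v w u)).
Proof.
move=> dx dw; rewrite derive_hvec//; last exact: differentiable_form.
by rewrite derive_cst derive_form.
Qed.

Lemma derive_isotropic w u v : differentiable w u ->
  (\forall u' \near u, g (w u') (w u') = 0) -> g (w u) ('D_v w u) = 0.
Proof.
move=> dw w0; have : 'D_v (fun u => g (w u) (w u)) u = 0.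
  by rewrite -[RHS](@derive_cst _ _ _ (0 : R) u v); exact: near_eq_derive.
rewrite derive_form// -/(qform _ _ _) -/(qform _ _ _) (qformC Gs _ (w u)); lra.
Qed.

(** At the point x + t w, the direction and the derivatives of the lifted line are the images of w
    and of dx + t dw under the injective differential of [flift]: the quadratic terms in t drop out
    because g(w, w) and g(w, dw) vanish. The extra unit of rank is the point itself, whose x^0 is
    1. *)
Lemma expression_tangent x w u t (a := fun u => flift G (x u)) (b := fun u => fdir (x u) (w u)) (z : 'rV[R]_2) :
  differentiable x u -> differentiable w u ->
  (\forall u' \near u, g (w u') (w u') = 0) ->
  z 0 0 = 1 -> z 0 1 = t ->
  \rank (tangent_mx a b u z) = (\rank (col_mx (w u) ('J x u + t *: 'J w u))).+1.
Proof.
move=> dx dw w0 z0 z1; have da := differentiable_flift dx; have db := differentiable_fdir dx dw.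
have w0u : g (w u) (w u) = 0 by exact: nbhs_singleton w0.
have dlE : dline a b u z = ('J x u + t *: 'J w u) *m flift_diff (x u + t *: w u).
  apply/row_matrixP => i; rewrite row_dline// row_mul.
  have -> : row i ('J x u + t *: 'J w u) = 'D_(delta_mx 0 i) x u + t *: 'D_(delta_mx 0 i) w u.
    rewrite -[X in row i (X + _)]scale1r; apply: etrans (row_comb _ _ _ _ _) _.
    rewrite -[X in _ = X + _]scale1r; by apply: comb_congr; exact: row_jacobian.
  rewrite z0 z1 scale1r derive_flift// derive_fdir// !mul_flift_diff hvecZ hvecD.
  have wDw := derive_isotropic (delta_mx 0 i) dw w0.
  rewrite !(qformDl, qformDr, qformZl, qformZr) wDw (qformC Gs (w u)).
  by congr hvec; ring.
have bE : b u = w u *m flift_diff (x u + t *: w u).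
  by rewrite mul_flift_diff /b /fdir qformDl qformZl w0u mulr0 addr0.
rewrite /tangent_mx /span_mx dlE bE rank_col_mxA -mul_col_mx rank_flift_diff//.
by rewrite /a /flift hvec00 oner_neq0.
Qed.

End Expression.

(** * Isotropic planes and their orthogonal complements *)

Section Perp.
Context {R : realType} {r : nat}.
Variables (G : 'M[R]_r.+2) (E : 'M[R]_(r.+2, r.+1)) (F : 'cV[R]_r.+2)
  (K : 'M[R]_(r.+1, r.+2)) (k : 'rV[R]_r.+2).
Hypothesis mG : minkowskian G E F K k.
Local Notation N := (r.+2 + 1).+1.
Local Notation B := (ambient G).
Let Gs : G^T = G := minkowski_sym mG.
Let Gu : G \in unitmx := minkowski_unit mG.
Let Bu : B \in unitmx := ambient_unit Gu.
Let Bs : B^T = B := ambient_sym Gs.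

(* The two time coordinates of the ambient space; the quadratic form is
   positive definite on their common kernel. *)
Definition time_mx : 'M[R]_(N, 1 + 1) :=
  col_mx (row_mx 0 1%:M : 'M[R]_(1, 1 + 1)) (col_mx (row_mx F 0) (row_mx 0 1%:M)).

Lemma hvec_time s t (x : 'rV[R]_r.+2) : hvec s x t *m time_mx = row_mx (x *m F) (s + t)%:M.
Proof.
rewrite /hvec /time_mx (@mul_row_col _ 1 1 (r.+2 + 1)) mul_row_col !mul_mx_row.
by rewrite !mulmx0 !mulmx1 !add_row_mx !add0r addr0 -raddfD.
Qed.

Lemma time_pos v : v *m time_mx = 0 -> 0 <= bil G v v /\ (bil G v v = 0 -> v = 0).
Proof.
have [s [x [t ->]]] := hvecE v; rewrite hvec_time => /(congr1 (fun u : 'M[R]_(1, 1 + 1) => (lsubmx u, rsubmx u))).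
rewrite row_mxKl row_mxKr !linear0 => -[xF /matrixP/(_ 0 0)]; rewrite !mxE eqxx mulr1n => st.
have -> : bil G (hvec s x t) (hvec s x t) = dot (x *m E) (x *m E) + 2 * s ^+ 2.
  have tE : t = - s by apply/eqP; rewrite -addr_eq0 addrC; apply/eqP.
  rewrite bil_hvec (minkowski_qform mG) xF mxE tE; ring.
have d0 := dot_ge0 (x *m E); have s0 : 0 <= s ^+ 2 by exact: sqr_ge0.
split=> [|h]; first lra.
have dE : dot (x *m E) (x *m E) = 0 by lra.
have sE : s = 0 by apply/eqP; rewrite -sqrf_eq0; apply/eqP; lra.
have x0 : x = 0 by apply: (minkowski_eq0 mG) => //; exact: dot_eq0.
by move: st; rewrite sE x0 add0r => ->; rewrite hvec0.
Qed.

Section IsotropicPlane.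
Variable S : 'M[R]_(1 + 1, N).
Hypotheses (Sf : row_free S) (SS : S *m B *m S^T = 0).

(** A vector of the isotropic plane without time coordinates is zero, so the two time coordinates
    restrict to coordinates of the plane. Subtracting an element of the plane from [v] thus removes
    its time coordinates, and this does not change bil(v, v), as [v] is orthogonal to the plane. *)
Lemma perp_pos v : v *m B *m S^T = 0 ->
  0 <= bil G v v /\ (bil G v v = 0 -> (v <= S)%MS).
Proof.
move=> vS.
have Su : S *m time_mx \in unitmx.
  rewrite -row_free_unit; apply: mulmx_row_eq0 => c; rewrite mulmxA => h.
  have [_ q] := time_pos h.
  have /q : bil G (c *m S) (c *m S) = 0.
    by rewrite /bil trmx_mul !mulmxA -[c *m S *m B]mulmxA -[c *m _ *m _]mulmxA SS mulmx0 mul0mx mxE.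
  by move=> /eqP; rewrite mulmx_free_eq0// => /eqP.
pose c := v *m time_mx *m invmx (S *m time_mx).
pose w := v - c *m S.
have wt : w *m time_mx = 0 by rewrite mulmxBl -mulmxA mulmxKV// subrr.
have Sv : S *m B *m v^T = 0.
  by have /(congr1 trmx) := vS; rewrite !trmx_mul trmxK Bs trmx0 mulmxA.
have ww : bil G w w = bil G v v.
  rewrite /bil /w linearB/= !mulmxBl !mulmxBr trmx_mul.
  rewrite ![v *m B *m (S^T *m _)]mulmxA vS mul0mx subr0.
  rewrite -![c *m S *m B]mulmxA -![c *m _ *m v^T]mulmxA Sv mulmx0.
  by rewrite !mulmxA -[c *m S *m B]mulmxA -[c *m _ *m S^T]mulmxA SS mulmx0 mul0mx subr0 subr0.
have [p q] := time_pos wt; rewrite -ww; split=> // /q /eqP.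
by rewrite subr_eq0 => /eqP ->; exact: submxMl.
Qed.

Lemma perp_rank : \rank (kermx (B *m S^T)) = r.+2.
Proof.
rewrite mxrank_ker rank_unit_mul// mxrank_tr.
by move: Sf; rewrite /row_free => /eqP ->; rewrite addn1.
Qed.

Lemma perp_eq m (T : 'M[R]_(m, N)) : \rank T = r.+2 -> T *m B *m S^T = 0 ->
  forall p (X : 'M[R]_(p, N)), (X <= T)%MS = (X *m B *m S^T == 0).
Proof.
move=> Tr TS p X.
have TK : (T :=: kermx (B *m S^T))%MS.
  apply/eqmxP; rewrite -mxrank_leqif_eq ?perp_rank ?Tr//.
  by apply/sub_kermxP; rewrite mulmxA.
by rewrite TK; apply/sub_kermxP/eqP; rewrite mulmxA.
Qed.

Variables (X Y : 'M[R]_(r, N)) (z0 : 'rV[R]_2).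
Let dl (z : 'rV[R]_2) := z 0 0 *: X + z 0 1 *: Y.
Hypotheses (dlS : forall z, dl z *m B *m S^T = 0)
  (dlsym : forall z z', (dl z *m B *m (dl z')^T)^T = dl z *m B *m (dl z')^T)
  (z00 : z0 != 0) (reg0 : \rank (col_mx S (dl z0)) = r.+2).

Let T := col_mx S (dl z0).
(** Coordinates on T / l given by the pairing with the derivatives at the regular point [z0]. They
    make [dl z *m C] the mixed Gram matrix of [dl z] and [dl z0], which [dlsym] declares
    symmetric. *)
Let C := B *m (dl z0)^T.

Lemma subT p (V : 'M[R]_(p, N)) : (V <= T)%MS = (V *m B *m S^T == 0).
Proof. by apply: perp_eq => //; rewrite /T !mul_col_mx SS dlS col_mx0. Qed.

Lemma SC0 : S *m C = 0.
Proof.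
have := dlS z0; move/(congr1 trmx); rewrite !trmx_mul trmxK Bs trmx0 => h.
by rewrite /C mulmxA -mulmxA.
Qed.

(** By [perp_pos] the form could vanish only on vectors of the plane, and regularity at [z0] keeps
    nontrivial combinations of the derivatives out of it. *)
Lemma gram_posdef : posdef (dl z0 *m C).
Proof.
move=> v v0.
have -> : (v *m (dl z0 *m C) *m v^T) 0 0 = bil G (v *m dl z0) (v *m dl z0).
  by rewrite /bil /C trmx_mul !mulmxA.
have [|p q] := @perp_pos (v *m dl z0); first by rewrite -!mulmxA [dl z0 *m _]mulmxA dlS mulmx0.
rewrite lt_neqAle p andbT eq_sym; apply: contraNneq v0 => /q /submxP[c cE].
have Tf : row_free T by rewrite /row_free reg0.
have : row_mx (- c) v *m T == 0.
  by rewrite /T (@mul_row_col _ 1 (1 + 1) r) mulNmx -cE addNr.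
rewrite mulmx_free_eq0// => /eqP /(congr1 (@rsubmx _ 1 (1 + 1) r)).
by rewrite row_mxKr linear0 => ->.
Qed.

Lemma gram_det : \det (dl z0 *m C) != 0.
Proof.
have [] := symmetric_pencil (K := dl z0 *m C) (S := dl z0 *m C) _ _ gram_posdef => //.
- by rewrite /C mulmxA dlsym.
- by rewrite /C mulmxA dlsym.
Qed.

Lemma quotient_gram (V : 'rV[R]_N) : (V <= T)%MS -> (V *m C == 0) = (V <= S)%MS.
Proof.
move=> /submxP[c ->]; apply/eqP/idP; last by move=> /submxP[e ->]; rewrite -mulmxA SC0 mulmx0.
rewrite -[c](@hsubmxK _ 1 (1 + 1) r) /T (@mul_row_col _ 1 (1 + 1) r).
rewrite mulmxDl -!mulmxA SC0 mulmx0 add0r => /(congr1 (mulmx^~ (invmx (dl z0 *m C)))).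
rewrite mulmxK ?mul0mx => [->|]; last by rewrite unitmxE unitfE gram_det.
by rewrite mul0mx addr0 submxMl.
Qed.

(** A rank defect is a nontrivial combination of the rows of [dl z] lying in the plane, that is,
    with zero coordinates by [quotient_gram]. *)
Lemma regular_det z : \rank (col_mx S (dl z)) = r.+2 <-> \det (dl z *m C) != 0.
Proof.
split=> h.
  rewrite -unitfE -unitmxE -row_free_unit; apply: mulmx_row_eq0 => v; rewrite mulmxA => /eqP.
  rewrite quotient_gram; last by rewrite subT -!mulmxA [dl z *m _]mulmxA dlS mulmx0.
  move=> /submxP[c cE].
  have : row_mx (- c) v *m col_mx S (dl z) == 0.
    by rewrite (@mul_row_col _ 1 (1 + 1) r) mulNmx -cE addNr.
  rewrite mulmx_free_eq0; last by rewrite /row_free h.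
  by move=> /eqP /(congr1 (@rsubmx _ 1 (1 + 1) r)); rewrite row_mxKr linear0.
apply/eqP; change (row_free (col_mx S (dl z))); apply: mulmx_row_eq0 => c.
rewrite -[c](@hsubmxK _ 1 (1 + 1) r) (@mul_row_col _ 1 (1 + 1) r) => cE.
have v0 : rsubmx (c : 'M[R]_(1, (1 + 1) + r)) = 0.
  have := congr1 (mulmx^~ C) cE; rewrite mulmxDl -!mulmxA SC0 mulmx0 add0r mul0mx => h'.
  have uD : dl z *m C \in unitmx by rewrite unitmxE unitfE.
  by apply: (can_inj (mulmxK uD)); rewrite h' mul0mx.
move: cE; rewrite v0 mul0mx addr0 => /eqP; rewrite mulmx_free_eq0// => /eqP ->.
by rewrite row_mx0.
Qed.

Lemma gram_zeros : exists zs : seq (pspace R 1), [/\ uniq zs,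
    forall zeta, zeta \in zs <-> ~ \rank (col_mx S (dl (rep zeta))) = r.+2 &
    (\sum_(zeta <- zs) mup 0 (\det (map_mx polyC (dl (rep zeta) *m C) +
       'X *: map_mx polyC (dl (perp2 (rep zeta)) *m C))))%N = r].
Proof.
have DE z : dl z *m C = z 0 0 *: (X *m C) + z 0 1 *: (Y *m C).
  by rewrite /dl mulmxDl -!scalemxAl.
have [||||zs [zu zE zsum]] := @pencil_zeros R r (X *m C) (Y *m C) z0; rewrite -?DE.
- exact: z00.
- by rewrite /C mulmxA dlsym.
- by rewrite /C mulmxA dlsym.
- exact: gram_posdef.
exists zs; split=> // [zeta|].
  rewrite zE -DE; split=> [d0 /regular_det|h]; first by rewrite d0 eqxx.
  by apply/eqP; apply: contra_notT h => /regular_det.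
by rewrite -[RHS]zsum; apply: eq_bigr => zeta _; rewrite !DE.
Qed.

End IsotropicPlane.
End Perp.

(** * Open conditions on ranks and quadratic forms *)

Section NearLemmas.
Context {R : realType}.

Lemma continuous_sum_fct (T : topologicalType) (I : Type) (s : seq I) (f : I -> T -> R) x :
  (forall i, {for x, continuous (f i)}) -> {for x, continuous (fun y => \sum_(i <- s) f i y)}.
Proof.
move=> cf; elim: s => [|i s IH].
  rewrite (_ : (fun y => _) = cst 0); last by apply/funext => y; rewrite big_nil.
  exact: cst_continuous.
rewrite (_ : (fun y => _) = (fun y => f i y + \sum_(j <- s) f j y)).
  exact: continuousD.
by apply/funext => y; rewrite big_cons.
Qed.

Lemma continuous_prod_fct (T : topologicalType) (I : Type) (s : seq I) (f : I -> T -> R) x :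
  (forall i, {for x, continuous (f i)}) -> {for x, continuous (fun y => \prod_(i <- s) f i y)}.
Proof.
move=> cf; elim: s => [|i s IH].
  rewrite (_ : (fun y => _) = cst 1); last by apply/funext => y; rewrite big_nil.
  exact: cst_continuous.
rewrite (_ : (fun y => _) = (fun y => f i y * \prod_(j <- s) f j y)).
  exact: continuousM.
by apply/funext => y; rewrite big_cons.
Qed.

Lemma continuous_det (T : topologicalType) m (M : T -> 'M[R]_m) x :
  {for x, continuous M} -> {for x, continuous (fun y => \det (M y))}.
Proof.
move=> /continuous_mxP cM; rewrite /determinant; apply: continuous_sum_fct => s.
apply: continuousM; first exact: cst_continuous.
by apply: continuous_prod_fct => i; exact: cM.
Qed.

(** A right inverse of [M x] is kept fixed: its product with [M y] has determinant 1 at [x], hence a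
    nonzero one nearby. *)
Lemma rank_full_near (T : topologicalType) m p (M : T -> 'M[R]_(m, p)) x :
  {for x, continuous M} -> \rank (M x) = m -> \forall y \near x, \rank (M y) = m.
Proof.
move=> cM rM; have fM : row_free (M x) by rewrite /row_free rM.
have MP : M x *m pinvmx (M x) = 1%:M by apply: (row_free_inj fM); rewrite mulmxKpV ?mul1mx.
have cdet : {for x, continuous (fun y => \det (M y *m pinvmx (M x)))}.
  apply: continuous_det.
  by apply: (@continuous_comp _ _ _ M (mulmx^~ (pinvmx (M x)))); [exact: cM|exact: mulmx_continuous].
have det0 : \det (M x *m pinvmx (M x)) != 0 by rewrite MP det1 oner_neq0.
have ndet : \forall y \near x, \det (M y *m pinvmx (M x)) != 0 by exact: (cvgr_neq0 _ cdet det0).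
apply: filterS ndet => y.
rewrite -unitfE -unitmxE -row_free_unit /row_free => /eqP h.
by apply/eqP; rewrite eqn_leq rank_leq_row -[X in (X <= _)%N]h mxrankM_maxl.
Qed.

Lemma near_segment (V : normedModType R) (P : V -> Prop) (z v : V) :
  (\forall y \near z, P y) -> exists2 e : R, 0 < e & forall t : R, `|t| <= e -> P (z + t *: v).
Proof.
move=> nP; have ct : {for (0 : R), continuous (fun t : R => z + t *: v)}.
  by apply: continuousD; [exact: cst_continuous|exact: scalel_continuous].
have := ct (fun y => P y); rewrite /= scale0r addr0 => /(_ nP).
move=> /nbhs_ballP[e /= e0 eP]; exists (e / 2); first by rewrite divr_gt0.
move=> t te; apply: eP; rewrite -ball_normE /ball_/= sub0r normrN (le_lt_trans te)//; lra.
Qed.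

(** Along z + t v the form is quadratic in t; its vanishing at t = 0, e and -e kills its value at
    [v]. Polarisation then gives the entries of [M]. *)
Lemma quadratic_near_zero m (M : 'M[R]_m) (z : 'rV[R]_m) : M^T = M ->
  (\forall y \near z, (y *m M *m y^T) 0 0 = 0) -> M = 0.
Proof.
move=> Ms nz; pose q (x y : 'rV[R]_m) := (x *m M *m y^T) 0 0.
have qC x y : q x y = q y x.
  by rewrite /q -[in RHS](trmxK (y *m M *m x^T)) [in RHS]mxE !trmx_mul trmxK Ms mulmxA.
have qD x x' y : q (x + x') y = q x y + q x' y by rewrite /q !mulmxDl mxE.
have qZ c x y : q (c *: x) y = c * q x y by rewrite /q -!scalemxAl mxE.
have q0 v : q v v = 0.
  have [e e0 eP] := near_segment v nz.
  have zz : q z z = 0 by have := eP 0; rewrite normr0 scale0r addr0 => /(_ (ltW e0)).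
  have E t : q (z + t *: v) (z + t *: v) = t * (2 * q z v + t * q v v).
    by rewrite !(qD, qZ) (qC z (z + _)) (qC v (z + _)) !(qD, qZ) zz (qC v z); ring.
  have h1 := eP e; rewrite -/(q _ _) E in h1; rewrite ger0_norm ?(ltW e0)// in h1.
  have h2 := eP (- e); rewrite -/(q _ _) E in h2; rewrite normrN ger0_norm ?(ltW e0)// in h2.
  have {}h1 := h1 (lexx _); have {}h2 := h2 (lexx _).
  have e1 : 2 * q z v + e * q v v = 0 by apply: (mulfI (lt0r_neq0 e0)); rewrite h1 mulr0.
  have e2 : 2 * q z v - e * q v v = 0.
    by apply: (mulfI (lt0r_neq0 e0)); rewrite mulr0 -[RHS]oppr0 -h2; ring.
  by apply: (mulfI (lt0r_neq0 e0)); rewrite mulr0; lra.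
apply/matrixP => i j; rewrite [RHS]mxE.
have -> : M i j = q (delta_mx 0 i) (delta_mx 0 j).
  by rewrite /q trmx_delta -rowE -colE !mxE.
have := q0 (delta_mx 0 i + delta_mx 0 j).
rewrite qD !(qC _ (_ + _)) !qD !q0 (qC (delta_mx 0 j) (delta_mx 0 i)); lra.
Qed.

Lemma derive_symmetric_mx d m (A : set 'rV[R]_d) (f : 'rV[R]_d -> 'rV[R]_m) x i j :
  open A -> smooth_on A f -> A x ->
  'D_(delta_mx 0 j) (fun y => 'D_(delta_mx 0 i) f y) x =
  'D_(delta_mx 0 i) (fun y => 'D_(delta_mx 0 j) f y) x.
Proof.
move=> oA sf Ax; apply/rowP => l.
have E p q : ('D_(delta_mx 0 q) (fun y => 'D_(delta_mx 0 p) f y) x) 0 l =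
    'D_(delta_mx 0 q) (fun y => 'D_(delta_mx 0 p) (fun y => f y 0 l) y) x.
  rewrite (derive_mxE _ _ _ (smooth_differentiable (smooth_derive p sf) Ax)).
  apply: near_eq_derive; have nA : \forall y \near x, A y by exact: open_nbhs_nbhs.
  apply: filterS nA => y Ay; apply: derive_mxE.
  exact: smooth_differentiable sf Ay.
exact: etrans (E i j) (etrans (derive_symmetric i j oA ((smooth_mxP oA _).1 sf 0 l) Ax) (esym (E j i))).
Qed.

Lemma derive_mulmxl (V : normedModType R) m p q (C : 'M[R]_(m, p)) (M : V -> 'M[R]_(p, q)) x v :
  differentiable M x -> 'D_v (fun y => C *m M y) x = C *m 'D_v M x.
Proof.
move=> dM; have dC : differentiable (fun y : V => C) x by exact: differentiable_cst.
by rewrite derive_mulmx// derive_cst mul0mx add0r.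
Qed.

End NearLemmas.

(** * Orthogonality from a constant tangent space *)

Section PerpFromConstantTangent.
Context {R : realType} {r N : nat}.
Variables (B : 'M[R]_N) (S : 'M[R]_(1 + 1, N)) (X Y : 'M[R]_(r, N)) (z0 : 'rV[R]_2)
  (T : 'M[R]_(r.+2, N)).
Let dl (z : 'rV[R]_2) := z 0 0 *: X + z 0 1 *: Y.
Hypotheses (SS : S *m B *m S^T = 0)
  (anti : forall z z' : 'rV[R]_2, (dl z *m B *m (z' *m S)^T) + (dl z' *m B *m (z *m S)^T) = 0)
  (z00 : z0 != 0) (reg0 : \rank (col_mx S (dl z0)) = r.+2)
  (TE : forall z, z != 0 -> \rank (col_mx S (dl z)) = r.+2 -> (col_mx S (dl z) == T)%MS).

(* The point [z0 *m S] is orthogonal to the tangent space at itself, which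
   contains the derivatives of all the points of the line. *)
Lemma constant_tangent_perp z : dl z *m B *m S^T = 0.
Proof.
pose z1 := perp2 z0.
have dlD z' z'' : dl (z' + z'') = dl z' + dl z''.
  by rewrite /dl !mxE !scalerDl addrACA.
have dlZ c z' : dl (c *: z') = c *: dl z' by rewrite /dl !mxE -!scalerA -scalerDr.
have T0 := TE z00 reg0.
(* Regularity is an open condition, so some point [z0 + e *: z1] has the same tangent space; [dl]
   being linear in the point, [dl z1] is a difference quotient of elements of that space. *)
have dlT1 : (dl z1 <= T)%MS.
  have cT : {for z0, continuous (fun z : 'rV[R]_2 => col_mx S (dl z))}.
    apply: differentiable_continuous; apply: differentiable_col_mx.
      exact: differentiable_cst.
    by apply: differentiableD; apply: differentiableZl; exact: differentiable_coord.
  have nr := rank_full_near cT reg0.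
  have nz : \forall z \near z0, z != 0.
    exact: (open_nbhs_nbhs (conj (@nonzero_open R 1) z00)).
  have : \forall z \near z0, z != 0 /\ \rank (col_mx S (dl z)) = r.+2.
    by apply: filterS2 nz nr.
  move=> /(near_segment z1)[e e0 /(_ e)]; rewrite ger0_norm ?(ltW e0)// => /(_ (lexx _))[ze re].
  have /eqmxP Te := TE ze re.
  have h1 : (dl (z0 + e *: z1) <= T)%MS by rewrite -Te -addsmxE addsmxSr.
  have h2 : (dl z0 <= T)%MS by rewrite -(eqmxP T0) -addsmxE addsmxSr.
  have -> : dl z1 = e^-1 *: (dl (z0 + e *: z1) - dl z0).
    by rewrite dlD dlZ addrAC subrr add0r scalerA mulVf ?scale1r// gt_eqF.
  by rewrite scalemx_sub// addmx_sub// eqmx_opp.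
have a00 : dl z0 *m B *m (z0 *m S)^T = 0.
  have := anti z0 z0; rewrite -mulr2n => /eqP; rewrite -scaler_nat scaler_eq0 pnatr_eq0/=.
  by move/eqP.
have Tz0 : T *m B *m (z0 *m S)^T = 0.
  have /submxP[c ->] : (T <= col_mx S (dl z0))%MS by rewrite (eqmxP T0).
  have S0 : S *m B *m (z0 *m S)^T = 0 by rewrite trmx_mul mulmxA SS mul0mx.
  by rewrite -!(mulmxA c) !mul_col_mx a00 S0 col_mx0 mulmx0.
have a10 : dl z1 *m B *m (z0 *m S)^T = 0.
  by have /submxP[c ->] := dlT1; rewrite -!mulmxA [T *m _]mulmxA Tz0 mulmx0.
have a01 : dl z0 *m B *m (z1 *m S)^T = 0 by have := anti z0 z1; rewrite a10 addr0.
have a11 : dl z1 *m B *m (z1 *m S)^T = 0.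
  have := anti z1 z1; rewrite -mulr2n => /eqP; rewrite -scaler_nat scaler_eq0 pnatr_eq0/=.
  by move/eqP.
have full (M : 'M[R]_(r, N)) : M *m B *m (z0 *m S)^T = 0 -> M *m B *m (z1 *m S)^T = 0 ->
    M *m B *m S^T = 0.
  rewrite !trmx_mul !mulmxA => h0 h1; apply/row_matrixP => i; rewrite row0.
  have d0 (y : 'rV[R]_2) : M *m B *m S^T *m y^T = 0 -> dot y (row i (M *m B *m S^T)) = 0.
    move=> h; rewrite /dot -[y in LHS]trmxK -trmx_mul mxE -row_mul h row0.
    by rewrite mxE.
  exact: dot_perp2_eq0 z00 (d0 _ h0) (d0 _ h1).
have e0 := full _ a00 a01; have e1 := full _ a10 a11.
have zE : dot z0 z0 *: dl z = dot z z0 *: dl z0 + dot z z1 *: dl z1.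
  by rewrite -!dlZ -dlD -perp2_decomposition.
by apply: (scalerI (dot_neq0 z00)); rewrite !scalemxAl zE !mulmxDl -!scalemxAl e0 e1 !scaler0 addr0.
Qed.

End PerpFromConstantTangent.

(** * Rulings contained in the quadric *)

Lemma near2_fix (T1 T2 : topologicalType) (P : T1 -> T2 -> Prop) (x : T1) (y : T2) :
  (\forall x' \near x & y' \near y, P x' y') -> \forall y' \near y, P x y'.
Proof.
move=> [[X Y] /= [nX nY] XY]; apply: filterS nY => y' Yy.
by apply: (XY (x, y')); split=> //; exact: nbhs_singleton nX.
Qed.

Section IsotropicFrame.
Context {R : realType} {r n : nat}.
Variable G : 'M[R]_n.
Hypothesis (Gs : G^T = G).
Local Notation N := (n + 1).+1.
Local Notation B := (ambient G).
Variables (A : set 'rV[R]_r) (a b : 'rV[R]_r -> 'rV[R]_N).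
Hypotheses (oA : open A) (sa : smooth_on A a) (sb : smooth_on A b)
  (iso : forall u, A u -> span_mx a b u *m B *m (span_mx a b u)^T = 0).

Let x (z : 'rV[R]_2) u := z *m span_mx a b u.

Lemma smooth_line_vec z : smooth_on A (x z).
Proof.
apply: (smooth_mulmx oA); first exact: smooth_cst.
exact: (smooth_col_mx oA sa sb).
Qed.

Lemma line_vec_derive z u i : A u -> 'D_(delta_mx 0 i) (x z) u = row i (dline a b u z).
Proof.
move=> Au; have da := smooth_differentiable sa Au; have db := smooth_differentiable sb Au.
apply: esym; apply: etrans (row_dline_span z i da db) _.
by apply: esym; apply: derive_mulmxl; exact: (differentiable_col_mx da db).
Qed.

Lemma derive_orthogonal (f g : 'rV[R]_r -> 'rV[R]_N) u v : A u ->
  differentiable f u -> differentiable g u ->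
  (forall u, A u -> bil G (f u) (g u) = 0) ->
  bil G ('D_v f u) (g u) + bil G (f u) ('D_v g u) = 0.
Proof.
move=> Au df dg fg; apply: etrans (esym (derive_form B v df dg)) _.
rewrite -[RHS](@derive_cst _ _ _ (0 : R) u v); apply: near_eq_derive.
have nA : \forall u' \near u, A u' by exact: open_nbhs_nbhs.
by apply: filterS nA => u' Au'; exact: fg.
Qed.

Lemma col_bil m (X : 'M[R]_(m, N)) y i : (X *m B *m y^T) i 0 = bil G (row i X) y.
Proof. by rewrite /bil -!row_mul [RHS]mxE. Qed.

Lemma gram_entry m p (X : 'M[R]_(m, N)) (Y : 'M[R]_(p, N)) i j :
  (X *m B *m Y^T) i j = bil G (row i X) (row j Y).
Proof.
by rewrite /bil -row_mul [LHS]mxE [RHS]mxE; apply: eq_bigr => k _; rewrite !mxE.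
Qed.

Lemma line_vec_bil0 z z' u : A u -> bil G (x z u) (x z' u) = 0.
Proof.
move=> Au; rewrite /bil /x trmx_mul !mulmxA -[z *m _ *m B]mulmxA -[z *m _ *m _^T]mulmxA iso//.
by rewrite mulmx0 mul0mx mxE.
Qed.

(** The derivative of the relation stating that the points of each line are mutually orthogonal. *)
Lemma dline_anti u z z' : A u ->
  dline a b u z *m B *m (x z' u)^T + dline a b u z' *m B *m (x z u)^T = 0.
Proof.
move=> Au; apply/matrixP => i j; rewrite ord1 [RHS]mxE [LHS]mxE !col_bil.
rewrite -!line_vec_derive// [X in _ + X](bilC _ _ Gs); apply: derive_orthogonal => //.
- exact: smooth_differentiable (smooth_line_vec z) Au.
- exact: smooth_differentiable (smooth_line_vec z') Au.
by move=> u' Au'; exact: line_vec_bil0.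
Qed.

Hypothesis perp : forall u z, A u -> dline a b u z *m B *m (span_mx a b u)^T = 0.

(* The derivative of [bil (x z) (d (x z')) = 0]; second derivatives commute. *)
Lemma dline_gram_sym u z z' : A u ->
  (dline a b u z *m B *m (dline a b u z')^T)^T = dline a b u z *m B *m (dline a b u z')^T.
Proof.
move=> Au.
have E i j : bil G (row i (dline a b u z)) (row j (dline a b u z')) =
    - bil G (x z u) ('D_(delta_mx 0 i) (fun u => 'D_(delta_mx 0 j) (x z') u) u).
  apply/eqP; rewrite -addr_eq0; apply/eqP.
  rewrite -!line_vec_derive//; apply: derive_orthogonal => //.
  - exact: smooth_differentiable (smooth_line_vec z) Au.
  - exact: smooth_differentiable (smooth_derive j (smooth_line_vec z')) Au.
  move=> u' Au'; rewrite line_vec_derive// (bilC _ _ Gs) -col_bil /x trmx_mul mulmxA perp//.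
  by rewrite mul0mx mxE.
apply/matrixP => i j; rewrite mxE !gram_entry.
have cg y v v' : v = v' -> - bil G y v = - bil G y v' by move=> ->.
have H := cg (x z u) _ _ (derive_symmetric_mx i j oA (smooth_line_vec z') Au).
exact: etrans (E j i) (etrans H (esym (E i j))).
Qed.

End IsotropicFrame.

Section Ruling.
Context {R : realType} {r : nat}.
Variables (G : 'M[R]_r.+2) (E : 'M[R]_(r.+2, r.+1)) (F : 'cV[R]_r.+2)
  (K : 'M[R]_(r.+1, r.+2)) (k : 'rV[R]_r.+2).
Hypothesis mG : minkowskian G E F K k.
Local Notation N := (r.+2 + 1).+1.
Local Notation B := (ambient G).
Let Gs : G^T = G := minkowski_sym mG.
Variables (U : set (pspace R (r.+2 + 1))) (A : set 'rV[R]_r)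
  (a b : 'rV[R]_r -> 'rV[R]_N) (T : 'rV[R]_r -> 'M[R]_(r.+2, N)).
Hypotheses (UQ : U `<=` darboux_quadric G) (hr : ruling U A a b T).

Let oA : open A. Proof. by case: hr. Qed.
Let sa : smooth_on A a. Proof. by case: hr. Qed.
Let sb : smooth_on A b. Proof. by case: hr. Qed.

Lemma ruling_free u : A u -> row_free (span_mx a b u).
Proof. by case: hr => _ _ _ _ h /h[]. Qed.

Lemma line_vec_neq0 u (z : 'rV[R]_2) : A u -> z != 0 -> z *m span_mx a b u != 0.
Proof. by move=> Au; apply: contra_neq => /eqP; rewrite mulmx_free_eq0 ?ruling_free// => /eqP. Qed.

(** A ruling places only an open piece of the line in [U], but there the form of the quadric
    vanishes for an open set of parameters, hence on the whole plane. *)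
Lemma ruling_isotropic u : A u -> span_mx a b u *m B *m (span_mx a b u)^T = 0.
Proof.
move=> Au; have [_ _ _ _ /(_ u Au)[_ [z [z0 _ nz]] _ _ _]] := hr.
apply: (@quadratic_near_zero _ _ _ z).
  by rewrite !trmx_mul trmxK ambient_sym// mulmxA.
have nz' := near2_fix nz.
have nz0 : \forall z' \near z, z' != 0 := open_nbhs_nbhs (conj (@nonzero_open R 1) z0).
apply: filterS2 nz' nz0 => z' /UQ Uz' z'0.
have := (darboux_quadricE G (line_vec_neq0 Au z'0)).1 Uz'.
by rewrite /bil trmx_mul !mulmxA.
Qed.

Lemma ruling_perp u z : A u -> dline a b u z *m B *m (span_mx a b u)^T = 0.
Proof.
move=> Au; have [_ _ _ _ /(_ u Au)[_ [z0 [z00 rz0 _]] _ TE _]] := hr.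
have anti z' z'' := dline_anti Gs oA sa sb ruling_isotropic z' z'' Au.
exact: (@constant_tangent_perp R r N B (span_mx a b u) ('J a u) ('J b u) z0 (T u)
  (ruling_isotropic Au) anti z00 rz0 TE z).
Qed.

Lemma ruling_carries u : A u -> carries_singular_points r a b T u.
Proof.
move=> Au; have [_ _ _ _ /(_ u Au)[_ [z0 [z00 rz0 _]] _ TE _]] := hr.
have iso := ruling_isotropic Au.
have perp z := ruling_perp z Au.
have sym z z' := dline_gram_sym Gs oA sa sb ruling_perp z z' Au.
have [zs [zu zE zsum]] := gram_zeros mG (ruling_free Au) iso perp sym z00 rz0.
exists (B *m (dline a b u z0)^T), zs; split.
- move=> v vT; apply: (quotient_gram mG (ruling_free Au) iso perp sym rz0).
  by have /andP[_ h] := TE z0 z00 rz0; apply: submx_trans h.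
- exact: zu.
- exact: zE.
- exact: zsum.
Qed.

End Ruling.

(** * Isotropic lines in charts *)

Section IsotropicSpan.
Context {R : realType} {n : nat}.
Variable G : 'M[R]_n.
Hypotheses (Gs : G^T = G).
Local Notation N := (n + 1).+1.
Local Notation B := (ambient G).
Local Notation g := (qform G).
Variable S : 'M[R]_(1 + 1, N).
Hypotheses (iso : S *m B *m S^T = 0) (fS : row_free S).

Lemma span_bil0 (z z' : 'rV[R]_2) : bil G (z *m S) (z' *m S) = 0.
Proof.
rewrite /bil trmx_mul !mulmxA -[z *m _ *m B]mulmxA -[z *m _ *m _^T]mulmxA iso.
by rewrite mulmx0 mul0mx mxE.
Qed.

Variables (c : option 'rV[R]_n) (z : 'rV[R]_2).
Local Notation M := (chart_mx G c).

(** The multiple of [z *m S] that has the same x^0 in the chart is subtracted from the second point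
    [perp2 z *m S] of the line. What remains is an ideal vector of the line, and this is its middle
    component. *)
Definition line_dir : 'rV[R]_n :=
  perp2 z *m S *m invmx M *m mid_mx -
  (perp2 z *m S *m invmx M) 0 0 *: chart_coord G c (z *m S).

Hypothesis p0 : (z *m S *m invmx M) 0 0 != 0.
Let x := chart_coord G c (z *m S).
Let zd := perp2 z - ((perp2 z *m S *m invmx M) 0 0 / (z *m S *m invmx M) 0 0) *: z.

Lemma flift_line_coord : flift G x *m M = ((z *m S *m invmx M) 0 0)^-1 *: (z *m S).
Proof.
have e := chart_coordE Gs (span_bil0 z z) p0.
by apply: esym; apply: (scalerI p0); rewrite scalerA divff// scale1r.
Qed.

(** The ideal vector has x^0 = 0 and the right middle component by construction; its last coordinate
    is forced by its orthogonality to [flift G x], which isotropy of the plane provides. *)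
Lemma fdir_line_dir : fdir G x line_dir *m M = zd *m S.
Proof.
pose v := zd *m S *m invmx M.
have [s [y [t e]]] := hvecE v.
have vE : v = perp2 z *m S *m invmx M -
    ((perp2 z *m S *m invmx M) 0 0 / (z *m S *m invmx M) 0 0) *: (z *m S *m invmx M).
  by rewrite /v /zd !mulmxBl -!scalemxAl.
have s0 : s = 0.
  have : v 0 0 = s by rewrite e hvec00.
  move=> <-; rewrite vE [LHS]mxE [X in _ + X]mxE [X in _ - X]mxE.
  by rewrite divfK// subrr.
have y0 : y = line_dir.
  rewrite -(hvec_mid s t y) -e vE mulmxBl -scalemxAl /line_dir /chart_coord.
  by rewrite scalerA.
have vM : v *m M = zd *m S by rewrite /v mulmxKV ?chart_mx_unit.
have t0 : t = g x y.
  have : bil G v (flift G x) = 0.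
    by rewrite -(bil_chart_mx Gs c) vM flift_line_coord bilZr span_bil0 mulr0.
  rewrite e /flift bil_hvec s0 mul0r subr0 mulr1 => /eqP.
  by rewrite subr_eq0 qformC// => /eqP.
by rewrite -vM e s0 t0 y0.
Qed.

Lemma line_dir_isotropic : g line_dir line_dir = 0.
Proof.
have := span_bil0 zd zd; rewrite -fdir_line_dir bil_chart_mx// /fdir bil_hvec.
by rewrite mul0r mulr0 !subr0.
Qed.

Lemma line_dir_neq0 : line_dir != 0.
Proof.
apply/eqP => h.
have : zd *m S = 0.
  by rewrite -fdir_line_dir h /fdir /qform trmx0 mulmx0 mxE hvec0 mul0mx.
move/eqP; rewrite mulmx_free_eq0// => /eqP zd0.
have z0 : z != 0 by apply: contraNneq p0 => ->; rewrite !mul0mx mxE.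
have : dot zd (perp2 z) = 0 by rewrite zd0 dot2E !mxE !mul0r addr0.
have dk k : dot (perp2 z - k *: z) (perp2 z) = dot z z by rewrite !dot2E !mxE /=; ring.
by rewrite /zd dk; apply/eqP; exact: dot_neq0.
Qed.

End IsotropicSpan.

Section ChartFrame.
Context {R : realType} {r n : nat}.
Variable G : 'M[R]_n.
Hypotheses (Gs : G^T = G).
Local Notation N := (n + 1).+1.
Local Notation g := (qform G).

Lemma gram_unit m k (S : 'M[R]_(m, k)) : row_free S -> S *m S^T \in unitmx.
Proof.
move=> fS; rewrite -row_free_unit; apply: mulmx_row_eq0 => y h.
have : dot (y *m S) (y *m S) = 0.
  by rewrite /dot trmx_mul !mulmxA -(mulmxA y) h mul0mx mxE.
by move=> /dot_eq0/eqP; rewrite mulmx_free_eq0// => /eqP.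
Qed.

(** Explicit coordinates with respect to the rows of [S]. The formula depends smoothly on [S], which
    makes the transition matrices between moving frames smooth. *)
Lemma submx_pinv m k p (S : 'M[R]_(m, k)) (X : 'M[R]_(p, k)) : row_free S -> (X <= S)%MS ->
  X *m (S^T *m invmx (S *m S^T)) *m S = X.
Proof.
by move=> fS /submxP[D ->]; rewrite !mulmxA -(mulmxA D) mulmxK ?gram_unit.
Qed.

Lemma proj_line_pt (a b : 'rV[R]_r -> 'rV[R]_N) u v : row_free (span_mx a b u) -> v != 0 ->
  proj_line a b u (pt v) <-> (v <= span_mx a b u)%MS.
Proof.
move=> fS v0; split.
  move=> [z /= z0]; rewrite /line_point => e.
  have zS0 : z *m span_mx a b u != 0 by rewrite mulmx_free_eq0.
  by have [t ->] := pt_eqP v0 zS0 (esym e); rewrite scalemx_sub// submxMl.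
move=> /submxP[z e]; exists z; last by rewrite /line_point -e.
by apply: contraNneq v0 => z0 /=; rewrite e z0 mul0mx.
Qed.


(** The lifted pair formed by a point and its direction is a second smooth frame of the same lines,
    related to (a, b) by a smooth invertible matrix. Regularity is then compared in three moves: the
    lift to the ambient space, the isometry of the chart and the change of frame. *)
Lemma expression_frame (D : set 'rV[R]_r) (a b : 'rV[R]_r -> 'rV[R]_N)
    (x w : 'rV[R]_r -> 'rV[R]_n) c u :
  open D -> smooth_on D a -> smooth_on D b -> smooth_on D x -> smooth_on D w ->
  (forall u, D u -> [/\ row_free (span_mx a b u), w u != 0, g (w u) (w u) = 0,
     (flift G (x u) *m chart_mx G c <= span_mx a b u)%MS &
     (fdir G (x u) (w u) *m chart_mx G c <= span_mx a b u)%MS]) -> D u ->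
  exists P : 'M[R]_2,
    (col_mx (flift G (x u)) (fdir G (x u) (w u)) : 'M[R]_(1 + 1, N)) *m chart_mx G c =
      P *m span_mx a b u /\
    forall t (z : 'rV[R]_2), z 0 0 = 1 -> z 0 1 = t ->
      expression_regular x w u t <-> line_regular a b u (z *m P).
Proof.
move=> oD sa sb sx sw hD Du.
have nD : \forall u' \near u, D u' by exact: open_nbhs_nbhs.
pose M := chart_mx G c.
pose fx u := flift G (x u).
pose fw u := fdir G (x u) (w u).
pose a' u := fx u *m M.
pose b' u := fw u *m M.
pose Si u := (span_mx a b u)^T *m invmx (span_mx a b u *m (span_mx a b u)^T).
pose P u := span_mx a' b' u *m Si u.
have sfx : smooth_on D fx by exact: smooth_flift.
have sfw : smooth_on D fw by apply: smooth_hvec => //; [exact: smooth_cst|exact: smooth_qform].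
have sa' : smooth_on D a' by exact: smooth_mulmxr.
have sb' : smooth_on D b' by exact: smooth_mulmxr.
have sS : smooth_on D (span_mx a b) := smooth_col_mx oD sa sb.
have sP : smooth_on D P.
  apply: (smooth_mulmx oD); first exact: (smooth_col_mx oD sa' sb').
  apply: (smooth_mulmx oD); first exact: (smooth_trmx oD sS).
  apply: (smooth_invmx oD).
    by move=> u' /hD[f' _ _ _ _]; exact: gram_unit.
  exact: (smooth_mulmx oD sS (smooth_trmx oD sS)).
have fE u' : D u' -> span_mx a' b' u' = P u' *m span_mx a b u'.
  move=> /hD[f' _ _ h1 h2].
  by apply: esym; apply: submx_pinv => //; rewrite col_mx_sub h1 h2.
have MP u' : span_mx a' b' u' = (col_mx (fx u') (fw u') : 'M[R]_(1 + 1, N)) *m M.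
  by rewrite mul_col_mx.
have [f0 w0 _ _ _] := hD _ Du.
have fM : row_free M by rewrite row_free_unit chart_mx_unit.
have Pu : P u \in unitmx.
  rewrite -row_free_unit; apply: mulmx_row_eq0 => y h.
  have : y *m span_mx a' b' u = 0 by rewrite fE// mulmxA h mul0mx.
  rewrite MP mulmxA => /eqP; rewrite mulmx_free_eq0// => /eqP.
  rewrite mul_rV2_col /fx /fw /flift /fdir !hvecZ hvecD mulr0 addr0 mulr1.
  move=> /hvec_eq0[y0 yw _]; apply: rV2P; rewrite [RHS]mxE//.
  by move: yw; rewrite y0 scale0r add0r => /eqP; rewrite scaler_eq0 (negbTE w0) orbF => /eqP.
exists (P u); split; first by rewrite -fE// MP.
move=> t z z0 z1.
have dP f : smooth_on D f -> differentiable f u by move=> sf; exact: smooth_differentiable sf Du.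
have ng : \forall u' \near u, g (w u') (w u') = 0.
  by apply: filterS nD => u' /hD[].
have nE : \forall u' \near u, span_mx a' b' u' = P u' *m span_mx a b u'.
  by apply: filterS nD => u'; exact: fE.
have e1 := expression_tangent Gs (smooth_differentiable sx Du) (smooth_differentiable sw Du) ng z0 z1.
have e2 : \rank (tangent_mx a' b' u z) = \rank (tangent_mx fx fw u z).
  apply: etrans (congr1 _ (tangent_mx_mulmx M z (smooth_differentiable sfx Du) (smooth_differentiable sfw Du))) _.
  exact: mxrankMfree.
have e3 := frame_change z (smooth_differentiable sa Du) (smooth_differentiable sb Du)
  (smooth_differentiable sa' Du) (smooth_differentiable sb' Du) (smooth_differentiable sP Du) Pu nE.
have e : \rank (tangent_mx a b u (z *m P u)) = (\rank (col_mx (w u) ('J x u + t *: 'J w u))).+1.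
  exact: etrans (esym e3) (etrans e2 e1).
have key (p q : nat) : p = q.+1 -> q = r.+1 <-> p = r.+2.
  by move=> ->; split=> [->//|[]].
exact: key e.
Qed.

End ChartFrame.

Section Lines.
Context {R : realType} {r n : nat}.
Variable G : 'M[R]_n.
Hypotheses (Gs : G^T = G).
Local Notation N := (n + 1).+1.
Local Notation B := (ambient G).
Local Notation g := (qform G).
Variables (A : set 'rV[R]_r) (a b : 'rV[R]_r -> 'rV[R]_N).
Hypotheses (oA : open A) (sa : smooth_on A a) (sb : smooth_on A b)
  (fS : forall u, A u -> row_free (span_mx a b u))
  (iso : forall u, A u -> span_mx a b u *m B *m (span_mx a b u)^T = 0).
Let L u : set (cspace G) := darboux @^-1` proj_line a b u.

Lemma lines_chartE u c y : A u ->
  L u (chart G c y) <-> (flift G y *m chart_mx G c <= span_mx a b u)%MS.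
Proof.
move=> Au; rewrite /L /preimage /= darboux_chart//.
by apply: proj_line_pt; [exact: fS|exact: flift_chart_neq0].
Qed.

(** The lift of an isotropic line is affine in the parameter, so its values at t = 0 and t = 1
    already place both [flift] and [fdir] in the plane. *)
Lemma line_expression_span u0 c D x w : line_expression L u0 c D x w ->
  forall u, A u -> D u -> [/\ row_free (span_mx a b u), w u != 0, g (w u) (w u) = 0,
     (flift G (x u) *m chart_mx G c <= span_mx a b u)%MS &
     (fdir G (x u) (w u) *m chart_mx G c <= span_mx a b u)%MS].
Proof.
move=> [_ _ _ _ h] u Au Du; have [w0 gw hL] := h u Du.
have h0 : (flift G (x u) *m chart_mx G c <= span_mx a b u)%MS.
  by have /(lines_chartE _ _ Au) := hL 0; rewrite scale0r addr0.
split=> //; first exact: fS.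
have /(lines_chartE _ _ Au) := hL 1; rewrite flift_line// scale1r mulmxDl => h1.
rewrite -[X in (X <= _)%MS](addKr (flift G (x u) *m chart_mx G c)).
by rewrite addmx_sub// eqmx_opp.
Qed.

Variables (c : option 'rV[R]_n) (z : 'rV[R]_2).
Let p u := (z *m span_mx a b u *m invmx (chart_mx G c)) 0 0.
Let q u := (perp2 z *m span_mx a b u *m invmx (chart_mx G c)) 0 0.
Let D : set 'rV[R]_r := [set u | A u /\ [set t : R | t != 0] (p u)].
Let x u := chart_coord G c (z *m span_mx a b u).
Let w u := line_dir G (span_mx a b u) c z.

Let smooth_vec (y : 'rV[R]_2) : smooth_on A (fun u => y *m span_mx a b u *m invmx (chart_mx G c)).
Proof. by apply: smooth_mulmxr => //; exact: smooth_line_vec. Qed.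

Let sp : smooth_on A p. Proof. by have /(smooth_mxP oA) := smooth_vec z; apply. Qed.

Let sq : smooth_on A q. Proof. by have /(smooth_mxP oA) := smooth_vec (perp2 z); apply. Qed.

Lemma open_chart_lines : open D.
Proof.
by apply: open_preimage_on => // u Au; exact: smooth_continuous sp Au.
Qed.

(** The parameter t = 0 corresponds to the point with coordinates [z] on each line. Any point that
    is finite in the chart [c] can thus serve as origin of an expression. *)
Lemma chart_line_expression u0 : A u0 -> p u0 != 0 -> line_expression L u0 c D x w.
Proof.
move=> Au0 pu0; have oD := open_chart_lines.
have DA : D `<=` A by move=> u [].
have sx : smooth_on D x.
  apply: (smoothZ oD).
    by apply: (smoothV oD); [move=> u []|exact: smooth_subset DA sp].
  by apply: (smooth_mulmxr oD); exact: smooth_subset DA (smooth_vec z).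
split=> //.
  apply: (smoothD oD).
    by apply: (smooth_mulmxr oD); exact: smooth_subset DA (smooth_vec (perp2 z)).
  have -> : (fun u => - (q u *: x u)) = (fun u => (- 1) *: (q u *: x u)).
    by apply/funext => u; rewrite scaleN1r.
  apply: (smoothZ oD); first exact: smooth_cst.
  by apply: (smoothZ oD) => //; exact: smooth_subset DA sq.
move=> u [Au pu].
have iu := iso Au; have fu := fS Au.
split; first exact: line_dir_neq0.
  exact: line_dir_isotropic.
move=> t; apply/lines_chartE => //.
rewrite flift_line//; last exact: line_dir_isotropic.
rewrite mulmxDl -scalemxAl flift_line_coord// fdir_line_dir// addmx_sub ?scalemx_sub ?submxMl//.
Qed.

Lemma chart_line_point u t (k := q u / p u) : A u -> p u != 0 ->
  flift G (x u + t *: w u) *m chart_mx G c =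
  (p u)^-1 *: ((z + t *: (p u *: perp2 z - q u *: z)) *m span_mx a b u).
Proof.
move=> Au pu; have iu := iso Au; have fu := fS Au.
rewrite flift_line//; last exact: line_dir_isotropic.
rewrite mulmxDl -scalemxAl flift_line_coord// fdir_line_dir//.
rewrite -/(p u) -/(q u) !scalemxAl -mulmxDl; congr (_ *m _).
have key (k1 k2 : R) (y y' : 'rV[R]_2) : k1 != 0 ->
    k1^-1 *: y + t *: (y' - (k2 / k1) *: y) = k1^-1 *: (y + t *: (k1 *: y' - k2 *: y)).
  by move=> k10; apply/rowP => j; rewrite !mxE; field.
exact: key.
Qed.

End Lines.

(** * Comparison of the singular points *)

Section Singular.
Context {R : realType} {r n : nat}.
Variable G : 'M[R]_n.
Hypotheses (Gs : G^T = G) (Gu : G \in unitmx).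
Local Notation N := (n + 1).+1.
Local Notation B := (ambient G).
Variables (A : set 'rV[R]_r) (a b : 'rV[R]_r -> 'rV[R]_N).
Hypotheses (oA : open A) (sa : smooth_on A a) (sb : smooth_on A b)
  (fS : forall u, A u -> row_free (span_mx a b u))
  (iso : forall u, A u -> span_mx a b u *m B *m (span_mx a b u)^T = 0).
Let L u : set (cspace G) := darboux @^-1` proj_line a b u.

Lemma line_expression_regular u c D x w : A u -> line_expression L u c D x w ->
  exists P : 'M[R]_2, forall t (z : 'rV[R]_2), z 0 0 = 1 -> z 0 1 = t ->
    (expression_regular x w u t <-> line_regular a b u (z *m P)) /\
    flift G (x u + t *: w u) *m chart_mx G c = z *m P *m span_mx a b u.
Proof.
move=> Au hL; have [oD Du sx sw gw] := hL.
have oAD : open (A `&` D) := openI oA oD.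
have sub1 : A `&` D `<=` A by move=> y [].
have sub2 : A `&` D `<=` D by move=> y [].
have [P [PE Pr]] := expression_frame Gs oAD (smooth_subset sub1 sa) (smooth_subset sub1 sb)
  (smooth_subset sub2 sx) (smooth_subset sub2 sw)
  (fun u (h : (A `&` D) u) => line_expression_span Gs fS hL h.1 h.2) (conj Au Du).
exists P => t z z0 z1; split; first exact: Pr.
rewrite -mulmxA -PE mulmxA mul_rV2_col z0 z1 scale1r flift_line//.
by have [] := gw u Du.
Qed.

Section AtPoint.
Variables (u : 'rV[R]_r) (z : 'rV[R]_2) (c : option 'rV[R]_n).
Hypotheses (Au : A u) (pu : (z *m span_mx a b u *m invmx (chart_mx G c)) 0 0 != 0).
Let x u := chart_coord G c (z *m span_mx a b u).
Let w u := line_dir G (span_mx a b u) c z.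
Let hL := chart_line_expression Gs oA sa sb fS iso Au pu.

Lemma chart_line_regular : expression_regular x w u 0 <-> line_regular a b u z.
Proof.
have [P hP] := line_expression_regular Au hL.
pose e : 'rV[R]_2 := delta_mx 0 0.
have e0 : e 0 0 = 1 by rewrite mxE !eqxx.
have e1 : e 0 1 = 0 by rewrite mxE.
have [h1 h2] := hP 0 e e0 e1.
apply: (iff_trans h1).
have -> : e *m P = ((z *m span_mx a b u *m invmx (chart_mx G c)) 0 0)^-1 *: z.
  apply: (row_free_inj (fS Au)); rewrite /= -h2.
  rewrite scale0r addr0 flift_line_coord//; last exact: iso.
  by rewrite -scalemxAl.
by rewrite /line_regular rank_tangent_scale// invr_eq0.
Qed.

End AtPoint.

(** From left to right, a chart in which the given point is finite provides an expression with that
    point at t = 0. From right to left, an arbitrary expression is referred to the frame (a, b) by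
    its matrix [P]. *)
Lemma singular_points_isotropic u : A u ->
  singular_points a b u = darboux @` isotropic_singular_points L u.
Proof.
move=> Au; have fu := fS Au; have iu := iso Au.
apply/seteqP; split=> [_ [z [z0 /= nr] <-]|_ [_ [c [D [x [w [t [hL -> nr]]]]]] <-]].
  have zS0 : z *m span_mx a b u != 0 by rewrite mulmx_free_eq0.
  have [c pc] := chart_cover Gu zS0.
  have hL := chart_line_expression Gs oA sa sb fS iso Au pc.
  exists (chart G c (chart_coord G c (z *m span_mx a b u))).
    exists c; do 3 eexists; exists 0; split; first exact: hL.
      by rewrite scale0r addr0.
    by move=> /(chart_line_regular Au pc)/nr.
  rewrite darboux_chart// flift_line_coord//.
  by apply: (pt_eq zS0 _ erefl); rewrite invr_eq0.
have [P hP] := line_expression_regular Au hL.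
pose z : 'rV[R]_2 := \row_(j < 2) (if j == 0 then 1 else t).
have z0 : z 0 0 = 1 by rewrite mxE.
have z1 : z 0 1 = t by rewrite mxE.
have [h1 h2] := hP t z z0 z1.
exists (z *m P).
  split; last by move=> /h1.2/nr.
  apply/eqP => zP; have := flift_chart_neq0 G c (x u + t *: w u).
  by rewrite h2 zP mul0mx eqxx.
by rewrite darboux_chart// h2.
Qed.

Lemma isotropic_expressions (V : set (cspace G)) u z : A u -> sweeps (darboux @` V) a b u z ->
  exists c D x w (t : R), [/\ line_expression L u c D x w,
      expression_regular x w u t &
      \forall u' \near u & t' \near t, V (chart G c (x u' + t' *: w u'))].
Proof.
move=> Au [z0 rz nz].
have zS0 : z *m span_mx a b u != 0 by rewrite mulmx_free_eq0 ?fS.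
have [c pc] := chart_cover Gu zS0.
have hL := chart_line_expression Gs oA sa sb fS iso Au pc.
exists c; do 3 eexists; exists 0; split; [exact: hL|exact/chart_line_regular|].
have [oD Du _ _ _] := hL.
pose p u := (z *m span_mx a b u *m invmx (chart_mx G c)) 0 0.
pose q u := (perp2 z *m span_mx a b u *m invmx (chart_mx G c)) 0 0.
(* Coordinates, in the frame (a, b), of the point with parameter [y.2] on the expression of the line
   [y.1], up to a scalar. They tend to [z] at (u, 0), which brings the neighbourhood supplied by
   [sweeps] into play. *)
pose zz (y : 'rV[R]_r * R) := z + y.2 *: (p y.1 *: perp2 z - q y.1 *: z).
have sv (y : 'rV[R]_2) : smooth_on A (fun u => (y *m span_mx a b u *m invmx (chart_mx G c)) 0 0).
  have /(smooth_mxP oA) : smooth_on A (fun u => y *m span_mx a b u *m invmx (chart_mx G c)).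
    by apply: smooth_mulmxr => //; exact: smooth_line_vec.
  by apply.
have cp (y : 'rV[R]_2) : (fun v : 'rV[R]_r * R => (y *m span_mx a b v.1 *m invmx (chart_mx G c)) 0 0)
    @ (u, 0 : R) --> (y *m span_mx a b u *m invmx (chart_mx G c)) 0 0.
  have cf : (fst : 'rV[R]_r * R -> 'rV[R]_r) @ (u, 0 : R) --> u by exact: cvg_fst.
  exact: (cvg_comp _ _ cf (smooth_continuous (sv y) Au)).
have czz : zz @ (u, 0 : R) --> z.
  have : zz @ (u, 0 : R) --> z + 0 *: (p u *: perp2 z - q u *: z).
    apply: cvgD; first exact: cvg_cst.
    apply: cvgZ; first exact: cvg_snd.
    by apply: cvgB; apply: cvgZr_tmp; exact: cp.
  by rewrite scale0r addr0.
have [[X Y] /= [nX nY] XY] := nz.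
have [[X' Y'] /= [nX' nY'] XY'] := czz _ nY.
have nD := open_nbhs_nbhs (conj oD Du).
exists (X `&` X' `&` [set u | A u /\ [set t : R | t != 0] (p u)], Y').
  by split=> //=; apply: filterI nD; exact: filterI.
move=> [u' t'] /= [[[Xu Xu'] [Au' pu']] Yt'].
have := XY (u', zz (u', t')) (conj Xu (XY' (u', t') (conj Xu' Yt'))).
case=> v Vv /= ev.
suff -> : chart G c (chart_coord G c (z *m span_mx a b u') + t' *: line_dir G (span_mx a b u') c z) = v by [].
apply: darboux_inj; rewrite ev darboux_chart// (chart_line_point Gs fS iso)//.
apply: pt_eq erefl; last by rewrite invr_eq0.
have := flift_chart_neq0 G c (chart_coord G c (z *m span_mx a b u') + t' *: line_dir G (span_mx a b u') c z).
by rewrite (chart_line_point Gs fS iso)// scaler_eq0 negb_or => /andP[].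
Qed.

End Singular.

Lemma free_eqmx (K : fieldType) m n (X Y : 'M[K]_(m, n)) :
  row_free X -> row_free Y -> (X <= Y)%MS -> (X :=: Y)%MS.
Proof.
move=> fX fY XY; apply/eqmxP.
by rewrite -(geq_leqif (mxrank_leqif_eq XY)) (eqP fX) (eqP fY).
Qed.

(** * Generators of the quadric as isotropic lines *)

Section IsotropicLines.
Context {R : realType} {m r : nat}.
Variables (G : 'M[R]_r.+2) (E : 'M[R]_(r.+2, r.+1)) (F : 'cV[R]_r.+2)
  (K : 'M[R]_(r.+1, r.+2)) (k : 'rV[R]_r.+2).
Hypothesis mG : minkowskian G E F K k.
Local Notation N := (r.+2 + 1).+1.
Local Notation B := (ambient G).
Local Notation g := (qform G).
Let Gs : G^T = G := minkowski_sym mG.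
Variables (a b : 'rV[R]_m -> 'rV[R]_N) (u : 'rV[R]_m).
Local Notation S := (span_mx a b u).
Hypotheses (iso : S *m B *m S^T = 0) (fS : row_free S).
Let L : set (cspace G) := darboux @^-1` proj_line a b u.

Lemma line_FinE y : L (Fin G y) <-> (flift G y <= S)%MS.
Proof. by apply: proj_line_pt => //; exact: fin_neq0. Qed.

Lemma line_IdealE c y (h : ideal_cone G (pt (ideal_vec c y))) : ideal_vec c y != 0 ->
  L (Ideal h) <-> (hvec 0 y c <= S)%MS.
Proof.
move=> v0; rewrite /L /preimage /= -[X in proj_line a b u X]/(darboux (Ideal h)) darboux_Ideal_pt//.
apply: proj_line_pt => //; apply: contra_neq v0 => /hvec_eq0[_ -> ->].
by rewrite /ideal_vec raddf0 row_mx0.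
Qed.

Lemma ideal_vecE (v : 'rV[R]_(1 + r.+2)) : v = ideal_vec (lsubmx v 0 0) (rsubmx v).
Proof. by rewrite /ideal_vec -mx11_scalar; exact: esym (hsubmxK v). Qed.

Lemma ideal_vecD c c' (y y' : 'rV[R]_r.+2) :
  ideal_vec c y + ideal_vec c' y' = ideal_vec (c + c') (y + y').
Proof. by rewrite /ideal_vec raddfD; exact: (@add_row_mx _ 1 1 r.+2). Qed.

Lemma ideal_vecZ t c (y : 'rV[R]_r.+2) : t *: ideal_vec c y = ideal_vec (t * c) (t *: y).
Proof. by rewrite /ideal_vec -scale_scalar_mx; exact: (@scale_row_mx _ 1 1 r.+2). Qed.

Lemma ideal_vec_inj c c' (y y' : 'rV[R]_r.+2) : ideal_vec c y = ideal_vec c' y' -> c = c' /\ y = y'.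
Proof.
move=> /(@eq_row_mx _ 1 1 r.+2)[/matrixP/(_ 0 0) h1 h2].
by move: h1; rewrite !mxE eqxx.
Qed.

Lemma cspaceP (P : cspace G -> Prop) : (forall y, P (Fin G y)) ->
  (forall c y (h : ideal_cone G (pt (ideal_vec c y))), ideal_vec c y != 0 -> P (Ideal h)) ->
  forall q, P q.
Proof.
move=> hF hI [y|I hI']; first exact: hF.
have e : I = pt (ideal_vec (lsubmx (rep I : 'rV[R]_(1 + r.+2)) 0 0) (rsubmx (rep I : 'rV[R]_(1 + r.+2)))).
  by rewrite -ideal_vecE pt_rep.
have v0 : ideal_vec (lsubmx (rep I : 'rV[R]_(1 + r.+2)) 0 0) (rsubmx (rep I : 'rV[R]_(1 + r.+2))) != 0.
  by rewrite -ideal_vecE rep_neq0.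
by move: v0 hI'; set v := ideal_vec _ _ in e *; move: e => -> v0 hI'; exact: hI.
Qed.

(** With one finite point, the affine chart presents the plane as the span of [flift G x] and
    [fdir G x w]. Its finite points have a nonzero coefficient on the former, and the latter is its
    only ideal point. *)
Lemma line_affine (z : 'rV[R]_2) : (z *m S) 0 0 != 0 -> exists x w, [/\ w != 0, g w w = 0 & L = affine_isotropic_line x w].
Proof.
move=> z0.
have p0 : (z *m S *m invmx (chart_mx G None)) 0 0 != 0 by rewrite invmx1 mulmx1.
pose x := chart_coord G None (z *m S); pose w := line_dir G S None z.
have w0 : w != 0 by exact: line_dir_neq0.
have gw : g w w = 0 by exact: line_dir_isotropic.
exists x, w; split=> //.
pose X : 'M[R]_(1 + 1, N) := col_mx (flift G x) (fdir G x w).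
have fX : row_free X.
  apply: mulmx_row_eq0 => y; rewrite mul_rV2_col /flift /fdir !hvecZ hvecD mulr0 addr0 mulr1.
  move=> /hvec_eq0[y0 yw _]; apply: rV2P; rewrite [RHS]mxE//.
  by move: yw; rewrite y0 scale0r add0r => /eqP; rewrite scaler_eq0 (negbTE w0) orbF => /eqP.
have XS : (X :=: S)%MS.
  apply: free_eqmx => //; rewrite /X col_mx_sub -[flift G x]mulmx1 -[fdir G x w]mulmx1.
  rewrite -[1%:M]/(chart_mx G None) flift_line_coord// fdir_line_dir//.
  by rewrite scalemx_sub ?submxMl.
have memX v : (v <= S)%MS <-> exists s t, v = s *: flift G x + t *: fdir G x w.
  rewrite -XS; split=> [/submxP[y ->]|[s [t ->]]].
    by exists (y 0 0), (y 0 1); rewrite mul_rV2_col.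
  by rewrite addmx_sub// scalemx_sub// /X -addsmxE ?addsmxSl ?addsmxSr.
apply/seteqP; split; apply: cspaceP => /=.
- move=> y /line_FinE/memX[s [t]].
  rewrite /flift /fdir !hvecZ hvecD mulr0 addr0 mulr1 => /hvec_inj[<- -> _].
  by exists t; rewrite scale1r.
- move=> c y h v0 /line_IdealE -/(_ v0)/memX[s [t]].
  rewrite /flift /fdir !hvecZ hvecD mulr0 addr0 mulr1 => /hvec_inj[s0 yE cE].
  move: yE cE; rewrite -s0 scale0r mul0r !add0r => yE cE.
  have vE : ideal_vec c y = t *: ideal_vec (g x w) w by rewrite ideal_vecZ yE cE.
  apply: (pt_eq _ _ vE).
    by apply: contraNneq v0 => e; rewrite vE e scaler0.
  by apply: contraNneq v0 => e; rewrite vE e scale0r.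
- move=> y [t ->]; apply/line_FinE/memX; exists 1, t.
  by rewrite flift_line// scale1r.
- move=> c y h v0 /pt_eqP -/(_ v0)[|t].
    by apply: contra_neq w0; rewrite -[0]/(0 : 'rV[R]_(1 + _)) -(@row_mx0 _ 1 1 r.+2) => /(@eq_row_mx _ 1 1 r.+2)[].
  rewrite ideal_vecZ => /ideal_vec_inj[cE yE]; apply/line_IdealE => //; apply/memX.
  by exists 0, t; rewrite scale0r add0r /fdir hvecZ mulr0 cE yE.
Qed.

(** Being two-dimensional, the plane contains a nonzero vector whose middle part has no time
    coordinate. This middle part is isotropic, hence zero, so the vector is the vertex of the ideal
    cone; the line joins it to another ideal point, which provides [w]. *)
Lemma line_infinite : (forall z : 'rV[R]_2, (z *m S) 0 0 = 0) ->
  exists w, [/\ w != 0, g w w = 0 & L = isotropic_line_at_infinity w].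
Proof.
move=> S0.
have ex0 : exists2 z : 'rV[R]_2, z != 0 & z *m (S *m mid_mx *m F) = 0.
  case: (eqVneq (\rank (kermx (S *m mid_mx *m F))) 0) => [h|h].
    have := mxrank_ker (S *m mid_mx *m F); rewrite h => /esym/eqP; rewrite subn_eq0.
    by move=> /leq_trans/(_ (rank_leq_col _)).
  have : kermx (S *m mid_mx *m F) != 0 by rewrite -mxrank_eq0.
  move=> /rowV0Pn[z /sub_kermxP zk z0]; by exists z.
have [z z0 zF] := ex0.
have [s [y [t e]]] := hvecE (z *m S).
have s0 : s = 0 by have := S0 z; rewrite e hvec00.
have y0 : y = 0.
  apply: (minkowski_isotropic_time mG).
    by have := span_bil0 iso z z; rewrite e bil_hvec s0 mul0r mulr0 !subr0.
  by rewrite -(hvec_mid s t y) -e -!mulmxA mulmxA mulmxA -(mulmxA z) in zF *; rewrite zF.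
have t0 : t != 0.
  have : z *m S != 0 by rewrite mulmx_free_eq0.
  by apply: contraNneq => t0; rewrite e s0 y0 t0 hvec0.
have [s' [w [t' e']]] := hvecE (perp2 z *m S).
have s'0 : s' = 0 by have := S0 (perp2 z); rewrite e' hvec00.
have gw : g w w = 0.
  by have := span_bil0 iso (perp2 z) (perp2 z); rewrite e' bil_hvec s'0 mul0r mulr0 !subr0.
have memX v : (v <= S)%MS <-> exists p q, v = hvec 0 (p *: w) q.
  split=> [/submxP[y' ->]|[p [q ->]]].
    have -> : y' = (dot z z)^-1 *: (dot y' z *: z + dot y' (perp2 z) *: perp2 z).
      by rewrite -perp2_decomposition scalerA mulVf ?dot_neq0// scale1r.
    rewrite -scalemxAl mulmxDl -!scalemxAl e e' s0 y0 s'0 !hvecZ hvecD hvecZ.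
    rewrite !mulr0 addr0 mulr0 scaler0 add0r scalerA.
    by do 2 eexists.
  have -> : hvec 0 (p *: w) q = ((q - p * t') / t) *: (z *m S) + p *: (perp2 z *m S).
    rewrite e e' s0 y0 s'0 !hvecZ hvecD !mulr0 addr0 scaler0 add0r; congr hvec.
    by rewrite divfK// subrK.
  by rewrite !scalemxAl -mulmxDl submxMl.
have w0 : w != 0.
  apply/eqP => w0.
  have h : perp2 z *m S = (t' / t) *: (z *m S).
    by rewrite e e' s0 y0 s'0 w0 hvecZ mulr0 scaler0 divfK.
  have pz : perp2 z = (t' / t) *: z by apply: (row_free_inj fS); rewrite /= h scalemxAl.
  have : dot (perp2 z - (t' / t) *: z) (perp2 z) = dot z z by rewrite !dot2E !mxE /=; ring.
  rewrite -pz subrr dot2E !mxE !mul0r addr0 => /esym/eqP.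
  by rewrite (negbTE (dot_neq0 z0)).
exists w; split=> //.
apply/seteqP; split; apply: cspaceP => /=.
- by move=> y' /line_FinE/memX[p [q]] /hvec_inj[/eqP]; rewrite oner_eq0.
- move=> c y' h v0 /line_IdealE -/(_ v0)/memX[p [q]] /hvec_inj[_ yE cE].
  rewrite val_pt// -memvE; apply/memv_addP; exists (q *: ideal_vec 1 0); first by rewrite memvZ// memv_line.
  exists (p *: ideal_vec 0 w); first by rewrite memvZ// memv_line.
  by rewrite !ideal_vecZ ideal_vecD mulr0 mulr1 scaler0 add0r addr0 yE cE.
- by [].
- move=> c y' h v0; rewrite val_pt// -memvE => /memv_addP[_ /vlineP[q ->] [_ /vlineP[p ->]]].
  rewrite !ideal_vecZ ideal_vecD mulr0 mulr1 scaler0 add0r addr0 => /ideal_vec_inj[cE yE].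
  by apply/line_IdealE => //; apply/memX; exists p, q; rewrite yE cE.
Qed.

Lemma line_isotropic : isotropic_line L.
Proof.
have [[z z0]|h] := pselect (exists z : 'rV[R]_2, (z *m S) 0 0 != 0).
  have [x [w [w0 gw LE]]] := line_affine z0.
  by exists w; split=> //; left; exists x.
have [w [w0 gw LE]] : exists w, [/\ w != 0, g w w = 0 & L = isotropic_line_at_infinity w].
  by apply: line_infinite => z; apply/eqP; apply: contra_notT h => z0; exists z.
by exists w; split=> //; right.
Qed.

End IsotropicLines.

(** * Rulings by isotropic planes *)

Lemma mxvec_comb (R : fieldType) r m p q (v : 'rV[R]_r) (X : 'I_r -> 'M[R]_(m, p)) (C : 'M[R]_(p, q)) :
  v *m (\matrix_(i < r) mxvec (X i *m C)) = mxvec ((\sum_i v 0 i *: X i) *m C).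
Proof.
rewrite mulmx_sum_row mulmx_suml linear_sum; apply: eq_bigr => i _.
by rewrite rowK -scalemxAl [in RHS]linearZ.
Qed.

Lemma row_comb_free (R : fieldType) m r k (S : 'M[R]_(m, k)) (X : 'M[R]_(r, k)) (v : 'rV[R]_r) :
  \rank (col_mx S X) = (m + r)%N -> (v *m X <= S)%MS -> v = 0.
Proof.
move=> fT /submxP[w e].
have : row_mx (- w) v *m col_mx S X = 0 by rewrite mul_row_col mulNmx e addNr.
move/eqP; rewrite mulmx_free_eq0; last by rewrite /row_free fT.
by rewrite -(@row_mx0 _ 1 m r) => /eqP/eq_row_mx[].
Qed.

Lemma perp_col_mx (R : pzRingType) m r k (S : 'M[R]_(m, k)) (X : 'M[R]_(r, k)) (B : 'M[R]_k) :
  S *m B *m S^T = 0 -> X *m B *m S^T = 0 -> col_mx S X *m B *m S^T = 0.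
Proof. by move=> h1 h2; rewrite !mul_col_mx h1 h2 col_mx0. Qed.

Section PerpRuling.
Context {R : realType} {r : nat}.
Variables (G : 'M[R]_r.+2) (E : 'M[R]_(r.+2, r.+1)) (F : 'cV[R]_r.+2)
  (K : 'M[R]_(r.+1, r.+2)) (k : 'rV[R]_r.+2).
Hypothesis mG : minkowskian G E F K k.
Local Notation N := (r.+2 + 1).+1.
Local Notation B := (ambient G).
Variables (A : set 'rV[R]_r) (a b : 'rV[R]_r -> 'rV[R]_N) (z1 : 'rV[R]_2).
Hypotheses (oA : open A) (sa : smooth_on A a) (sb : smooth_on A b)
  (fS : forall u, A u -> row_free (span_mx a b u))
  (iso : forall u, A u -> span_mx a b u *m B *m (span_mx a b u)^T = 0)
  (perp : forall u z, A u -> dline a b u z *m B *m (span_mx a b u)^T = 0)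
  (reg : forall u, A u -> line_regular a b u z1).
Let T : 'rV[R]_r -> 'M[R]_(r.+2, N) := fun u => tangent_mx a b u z1.

Lemma smooth_dline z : smooth_on A (fun u => dline a b u z).
Proof.
apply: (smoothD oA); apply: (smoothZ oA).
- exact: smooth_cst.
- exact: smooth_jacobian.
- exact: smooth_cst.
- exact: smooth_jacobian.
Qed.

Lemma smooth_tangent : smooth_on A T.
Proof. exact: (smooth_col_mx oA (smooth_col_mx oA sa sb) (smooth_dline z1)). Qed.

Lemma derive_span u v (z : 'rV[R]_2) : A u -> z *m 'D_v (span_mx a b) u = v *m dline a b u z.
Proof.
move=> Au; have ds := smooth_differentiable (smooth_col_mx oA sa sb) Au.
have dx := smooth_differentiable (smooth_line_vec oA sa sb z) Au.
apply: etrans (esym (derive_mulmxl z v ds)) _.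
apply: etrans (derive_rowE v dx) _.
apply: esym; apply: etrans (mulmx_sum_row _ _) _.
apply: eq_bigr => i _; congr (_ *: _).
exact: esym (line_vec_derive sa sb z i Au).
Qed.

Lemma tangent_perp u : A u -> T u *m B *m (span_mx a b u)^T = 0.
Proof. by move=> Au; exact: perp_col_mx (iso Au) (perp z1 Au). Qed.

Lemma perp_tangent_eq u z : A u -> line_regular a b u z -> (tangent_mx a b u z == T u)%MS.
Proof.
move=> Au rz; have fu := fS Au; have iu := iso Au.
have P z' : tangent_mx a b u z' *m B *m (span_mx a b u)^T = 0.
  exact: perp_col_mx (iso Au) (perp z' Au).
have h1 := perp_eq mG fu rz (P z).
have h2 := perp_eq mG fu (reg Au) (P z1).
by apply/andP; rewrite h1 h2 !P eqxx.
Qed.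

(* If [dT(v)] takes values in [T], differentiating the orthogonality of [T] and
   the line shows that [dl(v)] is orthogonal to [T], to which it belongs; being
   isotropic it lies in the line, which regularity excludes for v != 0. *)
Lemma perp_gauss_rank u : A u -> gauss_rank T u = r.
Proof.
move=> Au; apply/eqP; apply: mulmx_row_eq0 => v h.
have dT := smooth_differentiable smooth_tangent Au.
have ds := smooth_differentiable (smooth_col_mx oA sa sb) Au.
have DT : 'D_v T u *m cokermx (T u) = 0.
  apply: (can_inj mxvecK); apply: etrans _ (esym (linear0 _)); apply: etrans _ h.
  apply: esym; apply: etrans (mxvec_comb _ _ _) _.
  have key m p q (X Y : 'M[R]_(m, p)) (C : 'M[R]_(p, q)) : Y = X -> mxvec (X *m C) = mxvec (Y *m C).
    by move=> ->.
  apply: key; exact: (derive_rowE v dT).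
have /submxP[X DX] : ('D_v T u <= T u)%MS by rewrite submxE DT.
have TS := tangent_perp Au.
have e0 : 'D_v (fun u => T u *m B *m (span_mx a b u)^T) u = 0.
  rewrite -[RHS](@derive_cst _ _ _ (0 : 'M[R]_(r.+2, 1 + 1)) u v); apply: near_eq_derive.
  have nA : \forall u' \near u, A u' by exact: open_nbhs_nbhs.
  by apply: filterS nA => u' Au'; exact: tangent_perp.
have dTB := differentiable_mulmxr B dT.
have dst := differentiable_trmx ds.
have e1 := derive_mulmx v dTB dst.
have e2 : T u *m B *m ('D_v (span_mx a b) u)^T = 0.
  have e3 : 'D_v (fun u => T u *m B) u *m (span_mx a b u)^T = 0.
    apply: etrans (congr1 (fun X => X *m (span_mx a b u)^T) (derive_mulmxr B v dT)) _.
    by rewrite DX -!mulmxA [T u *m _]mulmxA TS mulmx0.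
  have e4 := derive_trmx v ds.
  have key m p (P Q S : 'M[R]_(m, p)) : P = 0 -> Q = P + S -> Q = 0 -> S = 0.
    by move=> -> ->; rewrite add0r.
  have e5 := key _ _ _ _ _ e3 e1 e0.
  by apply: etrans (congr1 (fun X => T u *m B *m X) (esym e4)) e5.
pose y := v *m dline a b u z1.
have yE : y = z1 *m 'D_v (span_mx a b) u by apply: esym; exact: derive_span.
have yS : y *m B *m (span_mx a b u)^T = 0.
  by rewrite /y -!mulmxA [dline _ _ _ _ *m _]mulmxA perp// mulmx0.
have yy : bil G y y = 0.
  have dT' (P : 'M[R]_(1 + 1, N)) (Q : 'M[R]_(r, N)) : (Q <= col_mx P Q)%MS by rewrite -addsmxE addsmxSr.
  have /submxP[Y yT] : (y <= T u)%MS := submx_trans (submxMl v _) (dT' _ _).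
  rewrite /bil {2}yE trmx_mul yT -!mulmxA [T u *m _]mulmxA [T u *m B *m _]mulmxA e2.
  by rewrite mul0mx mulmx0 mxE.
have /(_ yy) yS' := (perp_pos mG (fS Au) (iso Au) yS).2.
exact: row_comb_free (reg Au) yS'.
Qed.

Lemma perp_ruling U : (forall u, A u -> sweeps U a b u z1) -> ruling U A a b T.
Proof.
move=> sw; split=> //; first exact: smooth_tangent.
move=> u Au; split.
- exact: fS.
- by exists z1; exact: sw.
- by rewrite /row_free; apply/eqP; exact: reg.
- by move=> z _; exact: perp_tangent_eq.
- exact: perp_gauss_rank.
Qed.

End PerpRuling.

(** * Orthogonality conditions on a moving frame *)

Section PerpFrame.
Context {R : realType} {r n : nat}.
Variable G : 'M[R]_n.
Hypothesis (Gs : G^T = G).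
Local Notation N := (n + 1).+1.
Local Notation B := (ambient G).
Variables (A : set 'rV[R]_r) (a b : 'rV[R]_r -> 'rV[R]_N).
Hypotheses (oA : open A) (sa : smooth_on A a) (sb : smooth_on A b)
  (aa : forall u, A u -> bil G (a u) (a u) = 0)
  (ab : forall u, A u -> bil G (a u) (b u) = 0)
  (bb : forall u, A u -> bil G (b u) (b u) = 0)
  (dab : forall u i, A u -> bil G ('D_(delta_mx 0 i) a u) (b u) = 0).

Lemma frame_isotropic u : A u -> span_mx a b u *m B *m (span_mx a b u)^T = 0.
Proof.
move=> Au; rewrite mul_col_mx tr_col_mx mul_mx_row !mul_col_mx.
have key x y : bil G x y = 0 -> x *m B *m y^T = 0.
  by move=> h; apply/matrixP => i j; rewrite !ord1 [RHS]mxE.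
rewrite (key _ _ (aa Au)) (key _ _ (ab Au)) (key _ _ (bb Au)).
by rewrite (key _ _ (etrans (bilC _ _ Gs) (ab Au))) col_mx0 row_mx0.
Qed.

Lemma bil_derive_sym (f : 'rV[R]_r -> 'rV[R]_N) u v : A u -> smooth_on A f ->
  (forall u, A u -> bil G (f u) (f u) = 0) -> bil G ('D_v f u) (f u) = 0.
Proof.
move=> Au sf ff; have df := smooth_differentiable sf Au.
have := derive_orthogonal oA v Au df df ff.
rewrite [X in _ + X](bilC _ _ Gs) -mulr2n => /eqP; by rewrite mulrn_eq0 /= => /eqP.
Qed.

(** Of the four pairings, the two diagonal ones are derivatives of isotropy relations, one is the
    hypothesis [dab], and the last follows from it by differentiating [ab]. *)
Lemma frame_perp u z : A u -> dline a b u z *m B *m (span_mx a b u)^T = 0.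
Proof.
move=> Au; have da := smooth_differentiable sa Au; have db := smooth_differentiable sb Au.
have key x y X Y (c1 c2 : R) : bil G X x = 0 -> bil G X y = 0 -> bil G Y x = 0 -> bil G Y y = 0 ->
    (c1 *: X + c2 *: Y) *m B *m (col_mx x y : 'M[R]_(1 + 1, N))^T = 0.
  move=> h1 h2 h3 h4; rewrite tr_col_mx mul_mx_row.
  have key' X' y' : bil G X' y' = 0 -> X' *m B *m y'^T = 0.
    by move=> h; apply/matrixP => i j; rewrite !ord1 [RHS]mxE.
  by rewrite !mulmxDl -!scalemxAl !key'// !scaler0 addr0 row_mx0.
apply/row_matrixP => i; rewrite row0 !row_mul.
apply: etrans (congr1 (fun X => X *m B *m (span_mx a b u)^T) (row_dline z i da db)) _.
apply: key.
- exact: bil_derive_sym.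
- exact: dab.
- have := derive_orthogonal oA (delta_mx 0 i) Au da db ab.
  by rewrite dab// add0r (bilC _ _ Gs).
- exact: bil_derive_sym.
Qed.

End PerpFrame.

(** * The characteristics of a lightlike graph *)

Section Slice.
Context {R : realType}.

Lemma free_basis (K : fieldType) m n r (X : 'M[K]_(m, n)) : \rank X = r ->
  exists S : 'M[K]_(r, n), row_free S /\ (S :=: X)%MS.
Proof. by move=> <-; exists (row_base X); split; [exact: row_base_free|exact: eq_row_base]. Qed.

(** Applied with [e] the gradient at a point: the slice orthogonal to it is transversal to the
    nearby characteristics and parametrises them. *)
Lemma orthogonal_slice r (e : 'rV[R]_r.+1) : e != 0 -> exists S : 'M[R]_(r, r.+1),
  [/\ row_free S, S *m e^T = 0 & forall v : 'rV[R]_r.+1, dot v e = 0 -> (v <= S)%MS].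
Proof.
move=> e0.
have rk : \rank (kermx e^T) = r.
  by rewrite mxrank_ker mxrank_tr (rank_rV e) e0 subn1.
have [S [fS SE]] := free_basis rk.
exists S; split=> //; first by apply/sub_kermxP; rewrite SE.
move=> v ve; rewrite SE; apply/sub_kermxP; apply/matrixP => i j.
by rewrite !ord1 [RHS]mxE.
Qed.

(** After projection by [E], the direction becomes [e] and the other rows are independent and
    orthogonal to it. The term [0 *: Z] gives the matrix the shape of [expression_regular] at t =
    0. *)
Lemma transversal_rank r n (w : 'rV[R]_n) (X Z : 'M[R]_(r, n)) (E : 'M[R]_(n, r.+1)) e :
  w *m E = e -> e != 0 -> row_free (X *m E) -> X *m E *m e^T = 0 ->
  \rank (col_mx w (X + 0 *: Z)) = r.+1.
Proof.
move=> wE e0 fX Xe; rewrite scale0r addr0; apply/eqP; rewrite -[r.+1]/(1 + r)%N -/(row_free _).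
apply: mulmx_row_eq0 => y; rewrite -[y]hsubmxK mul_row_col => h.
have h1 : lsubmx y *m e + rsubmx y *m (X *m E) = 0.
  by rewrite -wE !mulmxA -mulmxDl h mul0mx.
have h2 : lsubmx y = 0.
  have : (lsubmx y *m e + rsubmx y *m (X *m E)) *m e^T = 0 by rewrite h1 mul0mx.
  rewrite mulmxDl -!mulmxA [X *m _]mulmxA Xe mulmx0 addr0 [e *m e^T]mx11_scalar mul_mx_scalar.
  move/eqP; rewrite scaler_eq0 => /orP[/eqP/dot_eq0/eqP|/eqP //].
  by rewrite (negbTE e0).
move: h1; rewrite h2 mul0mx add0r => /eqP; rewrite mulmx_free_eq0// => /eqP ->.
by rewrite row_mx0.
Qed.

Lemma row_free_usub m p n (X : 'M[R]_(m, n)) (Z : 'M[R]_(p, n)) :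
  \rank (col_mx X Z) = (m + p)%N -> row_free X.
Proof.
move=> rk; apply: mulmx_row_eq0 => y h.
have : row_mx y (0 : 'rV[R]_p) *m col_mx X Z = 0 by rewrite mul_row_col h mul0mx addr0.
move/eqP; rewrite mulmx_free_eq0; last by rewrite /row_free rk.
by rewrite -(@row_mx0 _ 1 m p) => /eqP/eq_row_mx[].
Qed.

Lemma continuous_col_mx (T : topologicalType) m1 m2 n (M : T -> 'M[R]_(m1, n))
    (M' : T -> 'M[R]_(m2, n)) x :
  {for x, continuous M} -> {for x, continuous M'} ->
  {for x, continuous (fun y => col_mx (M y) (M' y))}.
Proof.
move=> /continuous_mxP cM /continuous_mxP cM'; apply/continuous_mxP => i j.
case: (split_ordP i) => l ->; first by rewrite col_mx_entryu; exact: cM.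
by rewrite col_mx_entryd; exact: cM'.
Qed.

End Slice.

Section Graph.
Context {R : realType} {r : nat}.
Variables (G : 'M[R]_r.+2) (E : 'M[R]_(r.+2, r.+1)) (F : 'cV[R]_r.+2)
  (K : 'M[R]_(r.+1, r.+2)) (k : 'rV[R]_r.+2).
Hypothesis mG : minkowskian G E F K k.
Local Notation N := (r.+2 + 1).+1.
Local Notation g := (qform G).
Let Gs : G^T = G := minkowski_sym mG.
Variables (Y : set 'rV[R]_r.+1) (f : 'rV[R]_r.+1 -> R).
Hypotheses (oY : open Y) (sf : smooth_on Y f)
  (unit_grad : forall y, Y y -> dot (grad f y) (grad f y) = 1).

Definition graph_point y : 'rV[R]_r.+2 := y *m K + f y *: k.
(** The normal of the graph with respect to g. Being isotropic when |grad f| = 1, it is also tangent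
    to the graph, and it is the direction of the generator. *)
Definition graph_normal y : 'rV[R]_r.+2 := grad f y *m K + k.

Lemma graph_pointE y : graph_point y *m E = y.
Proof.
have [_ _ [KE _ kE _]] := mG.
by rewrite mulmxDl -mulmxA KE mulmx1 -scalemxAl kE scaler0 addr0.
Qed.

Lemma graph_pointF y : graph_point y *m F = (f y)%:M.
Proof.
have [_ _ [_ KF _ kF]] := mG.
by rewrite mulmxDl -mulmxA KF mulmx0 add0r -scalemxAl kF scalemx1.
Qed.

Lemma graph_normalE y : graph_normal y *m E = grad f y.
Proof.
have [_ _ [KE _ kE _]] := mG.
by rewrite mulmxDl -mulmxA KE mulmx1 kE addr0.
Qed.

Lemma graph_normalF y : graph_normal y *m F = 1%:M.
Proof.
have [_ _ [_ KF _ kF]] := mG.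
by rewrite mulmxDl -mulmxA KF mulmx0 add0r kF.
Qed.

Lemma graph_normal_isotropic y : Y y -> g (graph_normal y) (graph_normal y) = 0.
Proof.
move=> Yy; rewrite (minkowski_qform mG) graph_normalE graph_normalF unit_grad// mxE.
by rewrite mulr1 subrr.
Qed.

Lemma smooth_graph_point : smooth_on Y graph_point.
Proof.
apply: (smoothD oY); first by apply: (smooth_mulmxr oY); exact: smooth_id.
by apply: (smoothZ oY) => //; exact: smooth_cst.
Qed.

Lemma smooth_graph_normal : smooth_on Y graph_normal.
Proof.
apply: (smoothD oY); first by apply: (smooth_mulmxr oY); exact: smooth_grad.
exact: smooth_cst.
Qed.

Variables (c : option 'rV[R]_r.+2) (U : set (pspace R (r.+2 + 1))).
Local Notation M := (chart_mx G c).
Hypothesis hU : forall Y', open Y' -> Y' `<=` Y -> exists2 O, open O &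
  (fun y => pt (flift G (graph_point y) *m M)) @` Y' = U `&` O.
Variable y0 : 'rV[R]_r.+1.
Hypothesis Yy0 : Y y0.
Variables (e : R) (S : 'M[R]_(r, r.+1)).
Let e0 := grad f y0.
Hypotheses (e_gt0 : 0 < e)
  (eik : forall y (s : R), ball y0 e y -> `|s| < e ->
    [/\ Y (y + s *: grad f y), f (y + s *: grad f y) = f y + s &
        grad f (y + s *: grad f y) = grad f y])
  (fS : row_free S) (Se : S *m e0^T = 0)
  (eS : forall v : 'rV[R]_r.+1, dot v e0 = 0 -> (v <= S)%MS).

(** The point of the slice with parameter [u]; the generators start from the points of the graph
    above it, so that the coordinates (1, 0) on a line mark its foot. *)
Let yy (u : 'rV[R]_r) := y0 + u *m S.
Let A0 : set 'rV[R]_r := [set u | setT u /\ ball y0 e (yy u)].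
Let x u := graph_point (yy u).
Let w u := graph_normal (yy u).
Let a u := flift G (x u) *m M.
Let b u := fdir G (x u) (w u) *m M.

Let smooth_yy A : open A -> smooth_on A yy.
Proof.
move=> oA; apply: (smoothD oA); first exact: smooth_cst.
by apply: (smooth_mulmxr oA); exact: smooth_id.
Qed.

Let oA0 : open A0.
Proof.
apply: open_preimage_on; [exact: openT| |exact: ball_open].
by move=> u _; exact: smooth_continuous (smooth_yy openT) I.
Qed.

Lemma eikonal_ball y : ball y0 e y -> Y y.
Proof. by move=> By; have [] := eik By (s := 0); rewrite ?normr0// scale0r addr0. Qed.

Let A0Y u : A0 u -> Y (yy u). Proof. by move=> [_ /eikonal_ball]. Qed.

Let sx : smooth_on A0 x.
Proof. exact: (smooth_comp oA0 oY A0Y smooth_graph_point (smooth_yy oA0)). Qed.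

Let sw : smooth_on A0 w.
Proof. exact: (smooth_comp oA0 oY A0Y smooth_graph_normal (smooth_yy oA0)). Qed.

Let sa : smooth_on A0 a.
Proof. by apply: (smooth_mulmxr oA0); exact: smooth_flift. Qed.

Let sb : smooth_on A0 b.
Proof.
apply: (smooth_mulmxr oA0); apply: smooth_hvec => //; first exact: smooth_cst.
exact: smooth_qform.
Qed.

Let gw u : A0 u -> g (w u) (w u) = 0.
Proof. by move=> /A0Y; exact: graph_normal_isotropic. Qed.

Let aa u : A0 u -> bil G (a u) (a u) = 0.
Proof. by move=> _; rewrite /a bil_chart_mx// bil_flift. Qed.

Let ab u : A0 u -> bil G (a u) (b u) = 0.
Proof. by move=> _; rewrite /a /b bil_chart_mx// /flift /fdir bil_hvec mul1r mulr0 subr0 subrr. Qed.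

Let bb u : A0 u -> bil G (b u) (b u) = 0.
Proof. by move=> Au; rewrite /b bil_chart_mx// /fdir bil_hvec gw// mul0r mulr0 !subr0. Qed.

(* The normal is orthogonal to the graph. *)
Let dab u i : A0 u -> bil G ('D_(delta_mx 0 i) a u) (b u) = 0.
Proof.
move=> Au; have dx := smooth_differentiable sx Au.
have dy := smooth_differentiable (smooth_yy oA0) Au.
have df := smooth_differentiable sf (A0Y Au).
pose v : 'rV[R]_r := delta_mx 0 i.
have ex : 'D_v x u *m E = 'D_v yy u.
  apply: etrans (esym (derive_mulmxr E v dx)) _.
  by congr ('D_v _ u); apply/funext => u'; exact: graph_pointE.
have fx : 'D_v x u *m F = (dot ('D_v yy u) (grad f (yy u)))%:M.
  apply: etrans (esym (derive_mulmxr F v dx)) _.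
  have -> : (fun u => x u *m F) = (fun u => (f (yy u))%:M : 'M[R]_1).
    by apply/funext => u'; exact: graph_pointF.
  apply: etrans (derive_scalar_mx v (differentiable_comp dy df)) _.
  congr (_%:M); apply: etrans (derive_comp v dy df) _.
  exact: derive_grad.
have -> : 'D_v a u = 'D_v x u *m flift_diff G (x u) *m M.
  apply: etrans (derive_mulmxr M v (differentiable_flift G dx)) _.
  have key (X X' : 'rV[R]_N) : X = X' -> X *m M = X' *m M by move=> ->.
  exact: key (derive_flift Gs v dx).
rewrite mul_flift_diff /b bil_chart_mx// /fdir bil_hvec mul0r mulr0 !subr0.
rewrite (minkowski_qform mG) ex fx graph_normalE graph_normalF !mxE.
by rewrite mulr1 subrr.
Qed.

Lemma graph_line u t : A0 u -> `|t| < e ->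
  a u + t *: b u = flift G (graph_point (yy u + t *: grad f (yy u))) *m M.
Proof.
move=> Au te; have [_ Bu] := Au; have [_ h _] := eik Bu te.
have -> : graph_point (yy u + t *: grad f (yy u)) = x u + t *: w u.
  rewrite /graph_point h /x /w /graph_point /graph_normal.
  by rewrite mulmxDl scalerDl scalerDr -scalemxAl addrACA.
by rewrite flift_line ?gw// mulmxDl -scalemxAl.
Qed.

Lemma graph_U y : Y y -> U (pt (flift G (graph_point y) *m M)).
Proof.
move=> Yy; have [Q _ e'] := hU oY (@subset_refl _ Y).
by have [] : (U `&` Q) (pt (flift G (graph_point y) *m M)) by rewrite -e'; exists y.
Qed.

Lemma graph_line_U u (z : 'rV[R]_2) : A0 u -> z 0 0 != 0 -> `|z 0 1 / z 0 0| < e ->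
  U (line_point a b u z).
Proof.
move=> Au z0 ze; have [_ Bu] := Au; have [Yt _ _] := eik Bu ze.
have := graph_U Yt; rewrite -graph_line//.
have zE : z *m span_mx a b u = z 0 0 *: (a u + (z 0 1 / z 0 0) *: b u).
  by rewrite /span_mx mul_rV2_col scalerDr scalerA mulrCA divff// mulr1.
have n0 : a u + (z 0 1 / z 0 0) *: b u != 0 by rewrite graph_line// flift_chart_neq0.
by rewrite /line_point (pt_eq n0 z0 zE).
Qed.

Let e1 : 'rV[R]_2 := delta_mx 0 0.

Let A00 : A0 0.
Proof. by split=> //; rewrite /yy mul0mx addr0; exact: ballxx. Qed.

Let e0_neq0 : e0 != 0.
Proof.
apply/eqP => h; have := unit_grad Yy0; rewrite -/e0 h /dot mul0mx mxE => /eqP.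
by rewrite eq_sym oner_eq0.
Qed.

Lemma graph_regular0 : line_regular a b 0 e1.
Proof.
pose fx u := flift G (x u); pose fw u := fdir G (x u) (w u).
have sfx : smooth_on A0 fx by exact: smooth_flift.
have sfw : smooth_on A0 fw by apply: smooth_hvec => //; [exact: smooth_cst|exact: smooth_qform].
have e10 : e1 0 0 = 1 by rewrite mxE !eqxx.
have e11 : e1 0 1 = 0 by rewrite mxE.
have fM : row_free M by rewrite row_free_unit chart_mx_unit.
have dx := smooth_differentiable sx A00; have dw := smooth_differentiable sw A00.
have dy := smooth_differentiable (smooth_yy oA0) A00.
have nA : \forall u \near (0 : 'rV[R]_r), A0 u by exact: open_nbhs_nbhs.
have ng : \forall u' \near (0 : 'rV[R]_r), g (w u') (w u') = 0.
  by apply: filterS nA => u'; exact: gw.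
have h1 := expression_tangent Gs dx dw ng e10 e11.
have h2 : \rank (tangent_mx a b 0 e1) = \rank (tangent_mx fx fw 0 e1).
  apply: etrans (congr1 _ (tangent_mx_mulmx M e1 (smooth_differentiable sfx A00) (smooth_differentiable sfw A00))) _.
  exact: mxrankMfree.
have JS : 'J x 0 *m E = S.
  have e2 : (fun u => x u *m E) = yy by apply/funext => u'; exact: graph_pointE.
  apply: etrans (esym (jacobian_mulmx E dx)) _.
  apply: etrans (congr1 (fun h => 'J h 0) e2) _.
  apply/row_matrixP => i; apply: etrans (row_jacobian i dy) _.
  have did : differentiable (id : 'rV[R]_r -> 'rV[R]_r) 0 by [].
  have dS : differentiable (fun u : 'rV[R]_r => u *m S) 0.
    by apply: differentiable_mulmxr; exact: did.
  apply: etrans (deriveD (diff_derivable (differentiable_cst y0 0)) (diff_derivable dS)) _.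
  apply: etrans (add_congr (derive_cst _ _ _) (derive_mulmxr S _ did)) _.
  by rewrite derive_id add0r -rowE.
have wE : w 0 *m E = e0 by rewrite /w graph_normalE /yy mul0mx addr0.
have h3 := transversal_rank ('J w 0) wE e0_neq0.
have h4 : \rank (col_mx (w 0) ('J x 0 + 0 *: 'J w 0)) = r.+1.
  by apply: h3; rewrite JS.
exact: etrans h2 (etrans h1 (congr1 succn h4)).
Qed.

(** Regularity is open, and [near_join] turns inclusion in [U] near the foot into inclusion near
    every neighbouring point. The condition is needed both at the feet and at the points that have
    to be covered. *)
Lemma graph_sweeps_near : \forall p \near (0 : 'rV[R]_r, e1), A0 p.1 /\ sweeps U a b p.1 p.2.
Proof.
have FF : Filter (nbhs ((0 : 'rV[R]_r), e1)) by exact: nbhs_filter.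
have cA (W : normedModType R) (h : 'rV[R]_r -> W) : smooth_on A0 h ->
    {for (0 : 'rV[R]_r, e1), continuous (fun p : 'rV[R]_r * 'rV[R]_2 => h p.1)}.
  move=> sh; have cf : (fst : 'rV[R]_r * 'rV[R]_2 -> 'rV[R]_r) @ (0 : 'rV[R]_r, e1) --> (0 : 'rV[R]_r) by exact: cvg_fst.
  exact: (cvg_comp _ _ cf (smooth_continuous sh A00)).
have cz (j : 'I_2) : {for (0 : 'rV[R]_r, e1), continuous (fun p : 'rV[R]_r * 'rV[R]_2 => p.2 0 j)}.
  have cf : (snd : 'rV[R]_r * 'rV[R]_2 -> 'rV[R]_2) @ (0 : 'rV[R]_r, e1) --> e1 by exact: cvg_snd.
  exact: (cvg_comp _ _ cf (@coord_continuous _ 1 2 0 j e1)).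
have e10 : e1 0 0 = 1 by rewrite mxE !eqxx.
have e11 : e1 0 1 = 0 by rewrite mxE.
have nA : \forall p \near (0 : 'rV[R]_r, e1), A0 p.1.
  have cf : (fst : 'rV[R]_r * 'rV[R]_2 -> 'rV[R]_r) @ (0 : 'rV[R]_r, e1) --> (0 : 'rV[R]_r) by exact: cvg_fst.
  by apply: cf; exact: open_nbhs_nbhs.
have n0 : \forall p \near (0 : 'rV[R]_r, e1), (p : 'rV[R]_r * 'rV[R]_2).2 0 0 != 0.
  by apply: cvgr_neq0 (cz 0) _; rewrite /= e10 oner_neq0.
have ne : \forall p \near (0 : 'rV[R]_r, e1), `|(p : 'rV[R]_r * 'rV[R]_2).2 0 1 / p.2 0 0| < e.
  have cq : (fun p : 'rV[R]_r * 'rV[R]_2 => p.2 0 1 / p.2 0 0) @ (0 : 'rV[R]_r, e1) --> (0 : R).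
    have -> : (0 : R) = e1 0 1 / e1 0 0 by rewrite e11 mul0r.
    by apply: cvgM; [exact: cz|apply: cvgV; [rewrite e10 oner_neq0|exact: cz]].
  exact: cvgr0_norm_lt cq _ e_gt0.
have nr : \forall p \near (0 : 'rV[R]_r, e1), \rank (tangent_mx a b p.1 p.2) = r.+2.
  have cM : {for (0 : 'rV[R]_r, e1), continuous (fun p : 'rV[R]_r * 'rV[R]_2 => tangent_mx a b p.1 p.2)}.
    apply: continuous_col_mx; first exact: cA (smooth_col_mx oA0 sa sb).
    by apply: cvgD; apply: cvgZ; [exact: cz|exact: cA (smooth_jacobian oA0 sa)|exact: cz|exact: cA (smooth_jacobian oA0 sb)].
  exact: rank_full_near cM graph_regular0.
have nU : \forall p \near (0 : 'rV[R]_r, e1), U (line_point a b p.1 p.2).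
  have n3 := filterI nA (filterI n0 ne).
  apply: filterS (n3 FF FF) => -[u z] /= [Au [z0 ze]]; exact: graph_line_U.
have nnU : \forall p \near (0 : 'rV[R]_r, e1), \forall q \near p, U (line_point a b q.1 q.2).
  exact: near_join nU.
have n3 := filterI nA (filterI n0 (filterI nr nnU)).
apply: filterS (n3 FF FF FF) => -[u z] /= [Au [z0 [rz nz]]]; split=> //; split=> //.
by apply: contraNneq z0 => ->; rewrite mxE.
Qed.

Lemma graph_ruling : exists (A : set 'rV[R]_r) (a b : 'rV[R]_r -> 'rV[R]_N)
      (T : 'rV[R]_r -> 'M[R]_(r.+2, N)) (O : set (pspace R (r.+2 + 1))),
    [/\ ruling U A a b T, open O, O (pt (flift G (graph_point y0) *m M)) &
        forall q, U q -> O q -> exists u z,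
          [/\ A u, sweeps U a b u z & q = line_point a b u z]].
Proof.
have [[X Z] /= [nX nZ] XZ] := graph_sweeps_near.
pose A := X^°.
have A0A : A 0 by [].
have Asub : A `<=` A0.
  by move=> u Au; have [] := XZ (u, e1) (conj (interior_subset Au) (nbhs_singleton nZ)).
have Asw u : A u -> sweeps U a b u e1.
  by move=> Au; have [] := XZ (u, e1) (conj (interior_subset Au) (nbhs_singleton nZ)).
have oA : open A by exact: open_interior.
have iso := frame_isotropic Gs aa ab bb.
have perp := frame_perp Gs oA0 sa sb aa ab bb dab.
have fS' u : A u -> row_free (span_mx a b u).
  by move=> /Asw[_ rg _]; exact: row_free_usub rg.
have sa' : smooth_on A a by exact: smooth_subset Asub sa.
have sb' : smooth_on A b by exact: smooth_subset Asub sb.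
have rul : ruling U A a b (fun u => tangent_mx a b u e1).
  apply: (perp_ruling mG oA sa' sb' fS').
  - by move=> u /Asub; exact: iso.
  - by move=> u z /Asub; exact: perp.
  - by move=> u /Asw[].
  - exact: Asw.
(* The solution of dot (y - t grad f y - y0) e0 = 0, for which y - t grad f y lies in the slice. The
   denominator is 1 at [y0]. *)
pose t y := dot (y - y0) e0 / dot (grad f y) e0.
pose Y2 : set 'rV[R]_r.+1 := [set y | Y y /\ [set s : R | s != 0] (dot (grad f y) e0)].
have sdot (W : set 'rV[R]_r.+1) (h : 'rV[R]_r.+1 -> 'rV[R]_r.+1) : open W -> smooth_on W h ->
    smooth_on W (fun y => dot (h y) e0).
  by move=> oW sh; have /(smooth_mxP oW) := smooth_mulmxr oW e0^T sh; apply.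
have sg := smooth_grad oY sf.
have oY2 : open Y2.
  by apply: open_preimage_on => // y Yy; exact: smooth_continuous (sdot _ _ oY sg) Yy.
have d0 : dot e0 e0 = 1 by exact: unit_grad.
have Y20 : Y2 y0 by split=> //=; rewrite -/e0 d0 oner_neq0.
have Y2Y : Y2 `<=` Y by move=> y [].
have sid : smooth_on Y2 (fun y => y - y0).
  by apply: (smoothD oY2); [exact: smooth_id|exact: smooth_cst].
have st : smooth_on Y2 t.
  apply: (smoothM oY2); first exact: sdot.
  by apply: (smoothV oY2); [move=> y []|exact: smooth_subset Y2Y (sdot _ _ oY sg)].
(* [uu y] and [t y] are the foot in the slice and the parameter of the
   characteristic through [y]. *)
pose uu y := (y - y0 + (- t y) *: grad f y) *m (S^T *m invmx (S *m S^T)).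
pose zz y := e1 + t y *: delta_mx 0 1.
have su : smooth_on Y2 uu.
  apply: (smooth_mulmxr oY2); apply: (smoothD oY2) => //.
  apply: (smoothZ oY2); last exact: smooth_subset Y2Y sg.
  have sm : smooth_on Y2 (fun y => - 1 * t y) by apply: (smoothM oY2) => //; exact: smooth_cst.
  by apply: (eq_smooth oY2 _ sm) => y _; rewrite mulN1r.
have sz : smooth_on Y2 zz.
  apply: (smoothD oY2); first exact: smooth_cst.
  by apply: (smoothZ oY2) => //; exact: smooth_cst.
have t0 : t y0 = 0 by rewrite /t subrr /dot mul0mx mxE mul0r.
have u0 : uu y0 = 0 by rewrite /uu t0 subrr oppr0 scale0r addr0 mul0mx.
have z0 : zz y0 = e1 by rewrite /zz t0 scale0r addr0.
have cu : uu @ y0 --> (0 : 'rV[R]_r) by rewrite -u0; exact: smooth_continuous su Y20.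
have cz : zz @ y0 --> e1 by rewrite -z0; exact: smooth_continuous sz Y20.
have ct : t @ y0 --> (0 : R) by rewrite -t0; exact: smooth_continuous st Y20.
have n1 : \forall y \near y0, A (uu y) by apply: cu; exact: open_nbhs_nbhs.
have n2 : \forall y \near y0, X (uu y) by exact: cu nX.
have n3 : \forall y \near y0, Z (zz y) by exact: cz nZ.
have n4 : \forall y \near y0, `|t y| < e by exact: cvgr0_norm_lt ct _ e_gt0.
have n5 : \forall y \near y0, ball y0 e y by exact: nbhsx_ballx.
have n6 : \forall y \near y0, Y2 y by exact: open_nbhs_nbhs.
have n7 := filterI n1 (filterI n2 (filterI n3 (filterI n4 (filterI n5 n6)))).
set Y3 := (X in nbhs _ X) in n7.
have FF : Filter (nbhs y0) := nbhs_filter y0.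
have {}n7 := n7 FF FF FF FF FF.
(* [Y3] collects the points whose foot and parameter fall in the neighbourhoods where everything
   holds; its image in [U] is relatively open, which supplies the required open set. *)
have [Q oQ QE] := hU (@open_interior _ Y3) (fun y Yy => Y2Y _ (interior_subset Yy).2.2.2.2.2).
exists A, a, b, (fun u => tangent_mx a b u e1), Q; split=> //.
  by have [] : (U `&` Q) (pt (flift G (graph_point y0) *m M)) by rewrite -QE; exists y0.
move=> q Uq Qq; have : (U `&` Q) q by [].
rewrite -QE => -[y /interior_subset [Au [Xu [Zz [te [By [Yy ny]]]]]] <-].
exists (uu y), (zz y); split=> //; first by have [] := XZ (uu y, zz y) (conj Xu Zz).
have yyE : yy (uu y) = y + (- t y) *: grad f y.
  rewrite /yy /uu submx_pinv//; first by rewrite addrA [y0 + _]addrC subrK.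
  apply: eS; rewrite /dot mulmxDl -scalemxAl mxE [X in _ + X]mxE.
  by rewrite -/(dot (y - y0) e0) -/(dot (grad f y) e0) mulNr /t divfK// subrr.
(* The gradient at the foot equals the gradient at [y], so the characteristic launched from the foot
   comes back to [y] at the parameter [t y]. *)
have [] := eik By (s := - t y); first by rewrite normrN.
move=> _ _ gE.
rewrite /line_point /span_mx mul_rV2_col.
have -> : zz y 0 0 = 1 by rewrite !mxE /= mulr0 addr0.
have -> : zz y 0 1 = t y by rewrite !mxE /= add0r mulr1.
rewrite scale1r (graph_line (Asub _ Au) te).
by rewrite yyE gE scaleNr subrK.
Qed.

End Graph.

(** * Lightlike hypersurfaces *)

Section LocalParam.
Context {R : realType} {r : nat}.
Variables (G : 'M[R]_r.+2) (E : 'M[R]_(r.+2, r.+1)) (F : 'cV[R]_r.+2)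
  (K : 'M[R]_(r.+1, r.+2)) (k : 'rV[R]_r.+2).
Hypothesis mG : minkowskian G E F K k.
Local Notation N := (r.+2 + 1).+1.
Let Gs : G^T = G := minkowski_sym mG.
Let Gu : G \in unitmx := minkowski_unit mG.
Variables (V : set (cspace G)) (c : option 'rV[R]_r.+2) (W : set 'rV[R]_r.+1)
  (h : 'rV[R]_r.+1 -> 'rV[R]_r.+2).
Hypothesis lp : local_param V c W h.
Local Notation M := (chart_mx G c).
Let U : set (pspace R (r.+2 + 1)) := darboux @` V.
Let oW : open W. Proof. by case: lp. Qed.
Let sh : smooth_on W h. Proof. by case: lp. Qed.
Let rh w : W w -> \rank ('J h w) = r.+1. Proof. by case: lp => _ _ + _; apply. Qed.

Lemma darboux_open_embedding :
  open_embedding W (fun w => pt (flift G (h w) *m M)) U.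
Proof.
have [_ _ _ [inj emb]] := lp.
have E' w : pt (flift G (h w) *m M) = darboux (chart G c (h w)) by rewrite darboux_chart.
split=> [w w' Ww Ww' e|W' oW' W'W].
  by apply: inj => //; apply: darboux_inj; rewrite /= -!E'.
have [Q oQ QE] := emb W' oW' W'W; have [Q' oQ' QQ'] := darboux_open Gs Gu oQ.
exists Q' => //; apply/seteqP; split=> [_ [w W'w <-]|_ [[q Vq <-] /QQ' Qq]].
  have : (V `&` Q) (chart G c (h w)) by rewrite -QE; exists w.
  by move=> [Vw /QQ' Qw]; rewrite E'; split=> //; exists (chart G c (h w)).
have : (V `&` Q) q by [].
by rewrite -QE => -[w W'w <-]; exists w => //; rewrite E'.
Qed.

Lemma lift_rank w : W w ->
  \rank (col_mx (flift G (h w) *m M) ('J (fun w => flift G (h w) *m M) w)) = r.+2.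
Proof.
move=> Ww; have dh := smooth_differentiable sh Ww.
have df := differentiable_flift G dh.
have dF := differentiable_mulmxr M df.
have JE : 'J (fun w => flift G (h w) *m M) w = 'J h w *m flift_diff G (h w) *m M.
  apply/row_matrixP => i; apply: etrans (row_jacobian i dF) _.
  apply: etrans (derive_mulmxr M _ df) _.
  have key (X X' : 'rV[R]_N) : X = X' -> X *m M = X' *m M by move=> ->.
  apply: etrans (key _ _ (derive_flift Gs _ dh)) _.
  have key' (X X' : 'rV[R]_r.+2) (Z : 'M[R]_(r.+2, N)) : X = X' -> X *m Z *m M = X' *m Z *m M by move=> ->.
  apply: etrans (key' _ _ _ (esym (row_jacobian i dh))) _.
  by rewrite !row_mul.
rewrite JE -mul_col_mx mxrankMfree; last by rewrite row_free_unit chart_mx_unit.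
by rewrite rank_flift_diff ?rh// /flift hvec00 oner_neq0.
Qed.

Hypothesis cone : forall w, W w -> tangent_to_cone G ('J h w).

Let s w := h w *m E.

(** A tangent vector without spatial part is orthogonal to [xi], whose time coordinate is nonzero,
    so its own time coordinate vanishes. Hence the hypersurface projects locally diffeomorphically
    to space and is a graph. *)
Lemma shadow_unit w : W w -> 'J s w \in unitmx.
Proof.
move=> Ww; have [xi [xi0 gxi tan]] := cone Ww.
have xF : (xi *m F) 0 0 != 0.
  apply: contra_neq xi0 => e; apply: (minkowski_isotropic_time mG) => //.
  by rewrite [LHS]mx11_scalar e raddf0.
rewrite -row_free_unit; apply: mulmx_row_eq0 => v.
have -> : 'J s w = 'J h w *m E by exact: jacobian_mulmx (smooth_differentiable sh Ww).
rewrite mulmxA => vE.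
have := (tan (v *m 'J h w)).1 (submxMl _ _).
rewrite (minkowski_qform mG) vE /dot trmx0 mulmx0 mxE sub0r => /eqP.
rewrite oppr_eq0 mulf_eq0 (negbTE xF) /= => /eqP vF.
have : v *m 'J h w = 0.
  by apply: (minkowski_eq0 mG) => //; rewrite [LHS]mx11_scalar vF raddf0.
by move/eqP; rewrite mulmx_free_eq0 => [/eqP|]; rewrite /row_free ?rh.
Qed.

Variable w0 : 'rV[R]_r.+1.
Hypothesis Ww0 : W w0.

(* The isotropic vector [xi] is orthogonal to its tangent hyperplane, which
   forces [xi *m E] to be a multiple of the gradient of the height [f]. *)
Lemma lightlike_graph : exists (Y : set 'rV[R]_r.+1) (f : 'rV[R]_r.+1 -> R) (y0 : 'rV[R]_r.+1),
  [/\ open Y /\ smooth_on Y f, (forall y, Y y -> dot (grad f y) (grad f y) = 1),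
      Y y0, graph_point K k f y0 = h w0 &
      forall Y', open Y' -> Y' `<=` Y ->
        exists W', [/\ open W', W' `<=` W & graph_point K k f @` Y' = h @` W']].
Proof.
have ss : smooth_on W s by exact: smooth_mulmxr.
have [B [Y [ka [[oB Bw0 BW] [oY sk] hB hY]]]] := inverse_function oW ss Ww0 (shadow_unit Ww0).
pose H y := h (ka y).
have YW y : Y y -> W (ka y) by move=> /hY[/BW].
have sH : smooth_on Y H by exact: (smooth_comp oY oW YW sh sk).
pose f y := (H y *m F) 0 0.
have sF : smooth_on Y (fun y => H y *m F) by exact: smooth_mulmxr.
have sf : smooth_on Y f by move/(smooth_mxP oY): sF; apply.
have HE y : Y y -> H y *m E = y by move=> /hY[].
have GH y : Y y -> graph_point K k f y = H y.
  move=> Yy; have [_ EK _] := mG.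
  rewrite -[RHS]mulmx1 -EK mulmxDr !mulmxA HE// /graph_point; congr (_ + _).
  by rewrite [H y *m F]mx11_scalar mul_scalar_mx.
have [Yw0 kw0 _] := hB _ Bw0.
exists Y, f, (s w0); split=> //.
- move=> y Yy; have Wy := YW _ Yy; have [xi [xi0 gxi tan]] := cone Wy.
  have dk := smooth_differentiable sk Yy; have dh := smooth_differentiable sh Wy.
  have dH := smooth_differentiable sH Yy; have df := smooth_differentiable sf Yy.
  have dF := smooth_differentiable sF Yy.
  have xF : (xi *m F) 0 0 != 0.
    apply: contra_neq xi0 => e; apply: (minkowski_isotropic_time mG) => //.
    by rewrite [LHS]mx11_scalar e raddf0.
  (* The tangent vector above the spatial direction [v] has time coordinate dot v (grad f y); this
     is its orthogonality to [xi]. *)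
  have orth v : dot (xi *m E) v = (xi *m F) 0 0 * dot v (grad f y).
    have et : ('D_v H y <= 'J h (ka y))%MS.
      have e : 'D_v H y = 'D_v ka y *m 'J h (ka y).
        have e1 := derive_comp v dk dh.
        have e2 := deriveEjacobian ('D_v ka y) dh.
        exact: etrans e1 e2.
      by rewrite e submxMl.
    have /eqP := (tan _).1 et.
    have eE : 'D_v H y *m E = v.
      apply: etrans (esym (derive_mulmxr E v dH)) _.
      apply: etrans _ (derive_id y v); apply: near_eq_derive.
      have nY : \forall y' \near y, Y y' by exact: open_nbhs_nbhs.
      by apply: filterS nY => y' /HE.
    have eF : ('D_v H y *m F) 0 0 = dot v (grad f y).
      have e1 := congr1 (fun X : 'M[R]_1 => X 0 0) (derive_mulmxr F v dH).
      have e2 := derive_mxE v 0 0 dF.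
      exact: etrans (esym e1) (etrans e2 (derive_grad v df)).
    by rewrite (minkowski_qform mG) eE eF subr_eq0 => /eqP.
  (* For [d] the difference of the two sides, [orth] at [d] says that |d|^2 = 0. *)
  have xE : xi *m E = (xi *m F) 0 0 *: grad f y.
    apply/eqP; rewrite -subr_eq0; apply/eqP; apply: dot_eq0.
    set d := _ - _.
    have : dot (xi *m E) d - (xi *m F) 0 0 * dot d (grad f y) = 0 by rewrite orth subrr.
    move=> <-; rewrite !dotE mulr_sumr -sumrB; apply: eq_bigr => j _.
    by rewrite {1}/d !mxE; ring.
  (* With [xE], isotropy of [xi] reads c^2 |grad f|^2 = c^2, where c is the nonzero time coordinate
     of [xi]. *)
  move: gxi; rewrite (minkowski_qform mG) xE => /eqP.
  rewrite /dot linearZ /= -scalemxAl -scalemxAr scalerA mxE subr_eq0 -/(dot _ _) => /eqP e.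
  by apply: (mulfI (mulf_neq0 xF xF)); rewrite mulr1.
- by rewrite GH// /H kw0.
- move=> Y' oY' Y'Y; exists [set w | B w /\ Y' (s w)]; split.
  + apply: (open_preimage_on oB _ oY') => w Bw.
    exact: smooth_continuous ss (BW _ Bw).
  + by move=> w [/BW].
  + apply/seteqP; split=> [_ [y Y'y <-]|_ [w [Bw Y'w] <-]].
      have Yy := Y'Y _ Y'y; have [Bk sk'] := hY _ Yy.
      by exists (ka y); [rewrite /= sk'|rewrite GH].
    have [Yw kw _] := hB _ Bw.
    by exists (s w) => //; rewrite GH// /H kw.
Qed.

End LocalParam.

(** * The image is ruled and tangentially degenerate *)

Section Degenerate.
Context {R : realType} {r : nat}.
Variables (G : 'M[R]_r.+2) (E : 'M[R]_(r.+2, r.+1)) (F : 'cV[R]_r.+2)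
  (K : 'M[R]_(r.+1, r.+2)) (k : 'rV[R]_r.+2).
Hypothesis mG : minkowskian G E F K k.

Lemma lightlike_degenerate (V : set (cspace G)) : hypersurface V -> lightlike V ->
  ruled_tangentially_degenerate r (darboux @` V).
Proof.
move=> [cover _ _] hl; have Gs := minkowski_sym mG.
have cover' p : (darboux @` V) p -> exists c W h w, [/\ local_param V c W h, W w &
    p = pt (flift G (h w) *m chart_mx G c)].
  move=> [q /cover[c [W [h [lp [w Ww <-]]]]] <-].
  by exists c, W, h, w; split=> //; exact: darboux_chart.
split=> p /cover'[c [W [h [w [lp Ww ->]]]]].
  exists W, (fun w => flift G (h w) *m chart_mx G c).
  have [oW sh _ _] := lp; split=> //.
  - by apply: (smooth_mulmxr oW); exact: smooth_flift.
  - by move=> w' Ww'; have hh := lift_rank mG lp Ww'; exact: hh.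
  - have hh := darboux_open_embedding mG lp; exact: hh.
  - by exists w.
have [Y [f [y0 [[oY sf] ug Yy0 gE gW]]]] := lightlike_graph mG lp (hl _ _ _ lp) Ww.
have hU Y' : open Y' -> Y' `<=` Y -> exists2 O, open O &
    (fun y => pt (flift G (graph_point K k f y) *m chart_mx G c)) @` Y' = (darboux @` V) `&` O.
  move=> oY' Y'Y; have [W' [oW' W'W e]] := gW Y' oY' Y'Y.
  have [_ /(_ W' oW' W'W)[Q oQ QE]] := darboux_open_embedding mG lp.
  exists Q => //; rewrite -QE.
  rewrite -[LHS](image_comp (graph_point K k f) (fun x => pt (flift G x *m chart_mx G c))).
  by rewrite e image_comp.
have [e e0 eik] := eikonal_lines oY sf ug Yy0.
have g0 : grad f y0 != 0.
  apply/eqP => h0; have := ug _ Yy0; rewrite h0 /dot mul0mx mxE => /eqP.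
  by rewrite eq_sym oner_eq0.
have [S [fS Se eS]] := orthogonal_slice g0.
by rewrite -gE; exact: (graph_ruling mG oY sf ug hU Yy0 e0 eik fS Se eS).
Qed.

End Degenerate.

Theorem theorem1 (R : realType) (n : nat) (G : 'M[R]_n) (V : set (cspace G))
    (hn : (3 <= n)%N) (hG : has_signature G n.-1 1)
    (hV : hypersurface V) (hlight : lightlike V) :
  let U : set (pspace R (n + 1)) := darboux @` V in
  ruled_tangentially_degenerate n.-2 U /\
  forall (A : set 'rV[R]_n.-2) (a b : 'rV[R]_n.-2 -> 'rV[R]_(n + 1).+1)
      (T : 'rV[R]_n.-2 -> 'M[R]_(n.-2.+2, (n + 1).+1)),
    ruling U A a b T ->
    let L u : set (cspace G) := darboux @^-1` proj_line a b u in
    isotropic_family V A L /\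
    forall u, A u ->
      carries_singular_points n.-2 a b T u /\
      singular_points a b u =
        darboux @` isotropic_singular_points L u.
Proof.
case: n G V hn hG hV hlight => [//|[//|r]] G V _ hG hV hlight U.
have [E [F [K [k mG]]]] := signature_minkowski hG.
have Gs := minkowski_sym mG; have Gu := minkowski_unit mG.
have deg := lightlike_degenerate mG hV hlight.
split; first exact: deg.
(* The given ruling need not be the one built from characteristics; what follows rests on [U] lying
   in the quadric and on the clauses of [ruling]. *)
move=> A a b T hr L.
have UQ : U `<=` darboux_quadric G.
  have [QQ _ _] := @darboux_bij R r.+2 G.
  by move=> _ [q _ <-]; exact: QQ.
have [oA sa sb _ hA] := hr.
have fS := ruling_free hr.
have iso := ruling_isotropic mG UQ hr.
split.
  split=> // u Au; have hL := line_isotropic mG (iso _ Au) (fS _ Au); split; first exact: hL.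
  have [_ [z sw] _ _ _] := hA u Au.
  have hx := isotropic_expressions Gs Gu oA sa sb fS iso Au sw; exact: hx.
move=> u Au; have hc := ruling_carries mG UQ hr Au.
have hs := singular_points_isotropic Gs Gu oA sa sb fS iso Au.
by split; [exact: hc|exact: hs].
Qed.
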